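(* Let $f:\Sigma\to\Sigma$ be a measurable invertible map on a topological space $\Sigma$, let $\mu$ be an $f$-invariant ergodic probability measure, let $\tau\in L^1(\mu)$ be a roof function bounded away from zero, and let $(X_t)_t$ be the suspension semiflow over $(f,\mu,\tau)$ on $\Sigma_\tau$, preserving $\bar\mu=\frac{(\mu\times m)|_{\Sigma_\tau}}{\int_\Sigma\tau\,d\mu}$. Then, for any positive $\mu$-measure set $A\subset\Sigma$, $$\int_A n_A(x,0)\,d\mu_A=\frac{1}{\mu(A)}\int_\Sigma\tau\,d\mu ,$$ where $\mu_A=\mu(\cdot\cap A)/\mu(A)$ is the normalization of $\mu|_A$ on the cross-section $\Sigma$. In particular, if $f_A:A\to A$ denotes the first return time map, then $$\int_A n_A(x,0)\,d\mu_A=\frac{h_{\mu_A}(f_A)}{h_{\bar\mu}(X_1)} ,$$ that is, the mean return time is the entropy of the first return time map divided by the entropy of the flow.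
   Context: Suspension: given a measurable map $f:\Sigma\to\Sigma$ and a roof function $\tau$ on $\Sigma$, positive and bounded away from zero, let $\Sigma_\tau=\{(x,s)\in\Sigma\times[0,\infty):0\le s\le\tau(x)\}/\sim$, where $(x,\tau(x))\sim(f(x),0)$ for every $x\in\Sigma$. The suspension (semi)flow $(X_s)_s$ on $\Sigma_\tau$ is $$X_s(x,t)=\Big(f^k(x),\,t+s-\sum_{j=0}^{k-1}\tau(f^j(x))\Big),$$ where $k=k(x,t,s)\ge0$ is determined by $\sum_{j=0}^{k-1}\tau(f^j(x))\le t+s<\sum_{j=0}^{k}\tau(f^j(x))$. $m$ denotes Lebesgue measure on $\mathbb R$. A set $A\subset\Sigma$ is identified with $A\times\{0\}\subset\Sigma_\tau$. For a subset $A$ of $\Sigma_\tau$, the escape time is $e_A(x,t)=\inf\{s>0:X_s(x,t)\notin A\}$ and the hitting time is $n_A(x,t)=\inf\{s>e_A(x,t):X_s(x,t)\in A\}$; here $n_A(x,0)$ is the (continuous-time) hitting time to $A\times\{0\}$ under the semiflow. The first return time map is $f_A(x)=f^{k(x)}(x)$ with $k(x)=\inf\{k\ge1:f^k(x)\in A\}$, defined for $\mu$-almost every $x\in A$. $h_{\mu_A}(f_A)$ is the measure-theoretic entropy of $f_A$ with respect to $\mu_A$, and $h_{\bar\mu}(X_1)$ that of the time-one map $X_1$ with respect to $\bar\mu$.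
   Formalization: The second formula, expressing the mean return time as a quotient of entropies, is stated under the hypothesis that the entropy of the time-one map X_1 is positive and finite; otherwise the quotient is the undefined 0/0 or ∞/∞. *)

(* Defs.v *)
From Stdlib Require Import Relation_Operators.
From HB Require Import structures.
From mathcomp Require Import all_boot all_order all_algebra.
From mathcomp Require Import all_classical all_reals all_analysis.

Set Implicit Arguments.
Unset Strict Implicit.
Unset Printing Implicit Defensive.
Import Order.TTheory GRing.Theory Num.Theory.
Import numFieldNormedType.Exports.
Local Open Scope classical_set_scope.
Local Open Scope ring_scope.

Notation borel S := (g_sigma_algebraType (@open S)).

Section measure_preserving.
Context d (T : measurableType d) (R : realType).
Implicit Types (mu : set T -> \bar R) (f : T -> T).

Definition invariant_measure mu f :=
  forall B, measurable B -> mu (f @^-1` B) = mu B.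

Definition ergodic_measure mu f :=
  forall B, measurable B -> f @^-1` B = B -> mu B = 0%E \/ mu B = 1%E.

Definition normalized_restriction mu (A : set T) : set T -> \bar R :=
  fun B => (mu (B `&` A) / mu A)%E.

End measure_preserving.

Section kolmogorov_sinai_entropy.
Context d (T : measurableType d) (R : realType).
Implicit Types (mu : set T -> \bar R) (g : T -> T).

Definition measurable_partition k (P : 'I_k -> set T) :=
  [/\ forall i, measurable (P i), trivIset [set: 'I_k] P &
      \bigcup_i P i = [set: T]].

(* The atoms of the join of the g^{-i}(P), i < n, are indexed by words of
   length n. Empty pieces and empty atoms are harmless: they have measure 0
   and 0 * ln 0 = 0. *)
Definition join_atom g k (P : 'I_k -> set T) n (w : {ffun 'I_n -> 'I_k}) :
  set T := \bigcap_(i in [set: 'I_n]) (iter i g @^-1` P (w i)).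

Definition join_entropy mu g k (P : 'I_k -> set T) n : R :=
  - \sum_(w : {ffun 'I_n -> 'I_k})
      fine (mu (join_atom g P w)) * ln (fine (mu (join_atom g P w))).

Definition partition_entropy mu g k (P : 'I_k -> set T) : R :=
  limn (fun n => join_entropy mu g P n / n%:R).

(* When mu is concentrated on a measurable set D that g maps into itself up
   to a mu-null set, this is the entropy of the system (D, mu, g): the traces
   on D of the measurable partitions of T are those of D, and the values of g
   off D do not matter. *)
Definition entropy mu g : \bar R :=
  ereal_sup [set h | exists k (P : 'I_k -> set T),
    measurable_partition P /\ h = (partition_entropy mu g P)%:E].

End kolmogorov_sinai_entropy.

Section first_return.
Context (T : Type) (f : T -> T) (A : set T).

(* 0 if the orbit of x never reaches A, so that [first_return] is then the
   identity at x; by Poincare recurrence this concerns a null set of A. *)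
Definition first_return_time (x : T) : nat :=
  xget 0%N [set k | [/\ (0 < k)%N, A (iter k f x) &
    forall j, (0 < j < k)%N -> ~ A (iter j f x)]].

Definition first_return (x : T) : T := iter (first_return_time x) f x.

End first_return.

Section suspension.
Context (R : realType) (T : Type) (f : T -> T) (tau : T -> R).
Implicit Types (p q : T * R) (s : R) (S : set (T * R)).

Definition roof_function := exists2 c : R, 0 < c & forall x, c <= tau x.

Definition birkhoff_sum k (x : T) : R := \sum_(j < k) tau (iter j f x).

(* The region 0 <= s <= tau x under the graph of the roof, and the
   identification (x, tau x) ~ (f x, 0). *)
Definition under_roof : set (T * R) := [set p | 0 <= p.2 <= tau p.1].

Definition glue p q := exists x, p = (x, tau x) /\ q = (f x, 0).

Definition glue_equiv : T * R -> T * R -> Prop :=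
  clos_refl_sym_trans (T * R) glue.

(* The quotient of [under_roof] by [glue_equiv], as the set of the
   representatives (x, s) with s < tau x. The formula of the flow always
   returns such a representative ([susp_flow_space]); at time 0 it is the
   canonical surjection ([susp_flow_id], [susp_flow0P]), through which the
   flow factors ([susp_flow_quotient]). *)
Definition susp_space : set (T * R) := [set p | 0 <= p.2 < tau p.1].

Definition susp_index s p : nat :=
  xget 0%N [set k | birkhoff_sum k p.1 <= p.2 + s < birkhoff_sum k.+1 p.1].

Definition susp_flow s p : T * R :=
  let k := susp_index s p in
  (iter k f p.1, p.2 + s - birkhoff_sum k p.1).

(* The infimum of the empty set is +oo. *)
Definition escape_time S p : \bar R :=
  ereal_inf [set s%:E | s in [set s | 0 < s /\ ~ S (susp_flow s p)]].

Definition hitting_time S p : \bar R :=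
  ereal_inf [set s%:E | s in
    [set s | (escape_time S p < s%:E)%E /\ S (susp_flow s p)]].

Definition cross_section (A : set T) : set (T * R) := A `*` [set 0].

Hypothesis roof : roof_function.

Let tau_gt0 x : 0 < tau x.
Proof. by have [c c0 /(_ x)] := roof; exact: lt_le_trans. Qed.

Lemma birkhoff_sumS k x : birkhoff_sum k.+1 x = tau x + birkhoff_sum k (f x).
Proof.
rewrite /birkhoff_sum big_ord_recl /=; congr (_ + _).
by apply: eq_bigr => i _; rewrite -iterSr.
Qed.

Lemma le_birkhoff_sum x : {homo birkhoff_sum^~ x : m n / (m <= n)%N >-> m <= n}.
Proof.
apply: homo_leq => // [? ? ?|k]; first exact: le_trans.
by rewrite /birkhoff_sum big_ord_recr /= lerDl ltW.
Qed.

Lemma susp_indexP s p k :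
  birkhoff_sum k p.1 <= p.2 + s < birkhoff_sum k.+1 p.1 -> susp_index s p = k.
Proof.
move=> kP; rewrite /susp_index.
case: xgetP => [l _ /= /andP[l1 l2]|/(_ k)//].
move: kP => /andP[k1 k2]; apply/eqP; rewrite eqn_leq.
apply/andP; split; rewrite leqNgt; apply/negP => /(@le_birkhoff_sum p.1).
  by move=> /(lt_le_trans k2); rewrite ltNge l1.
by move=> /(lt_le_trans l2); rewrite ltNge k1.
Qed.

Lemma susp_index_ex s p : 0 <= p.2 + s ->
  exists k, birkhoff_sum k p.1 <= p.2 + s < birkhoff_sum k.+1 p.1.
Proof.
move=> s0; have [c c0 ctau] := roof.
have ub k : c * k%:R <= birkhoff_sum k p.1.
  elim: k => [|k IH]; first by rewrite /birkhoff_sum big_ord0 mulr0.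
  by rewrite /birkhoff_sum big_ord_recr /= mulrSr mulrDr mulr1 lerD.
have ex : exists k, p.2 + s < birkhoff_sum k p.1.
  exists (Num.truncn ((p.2 + s) / c)).+1; apply: lt_le_trans (ub _).
  by rewrite -ltr_pdivrMl// mulrC truncnS_gt.
case: (ex_minnP ex) => -[|k] kP kmin.
  by move: kP; rewrite /birkhoff_sum big_ord0 ltNge s0.
exists k; rewrite kP andbT leNgt; apply/negP => /kmin.
by rewrite ltnn.
Qed.

Lemma susp_flow_space s p : 0 <= p.2 + s -> susp_space (susp_flow s p).
Proof.
move=> /susp_index_ex[k kP]; rewrite /susp_space /susp_flow /= (susp_indexP kP).
move: kP => /andP[k1]; rewrite /birkhoff_sum big_ord_recr /= => k2.
by rewrite subr_ge0 k1 ltrBlDl.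
Qed.

Lemma susp_flow_id p : susp_space p -> susp_flow 0 p = p.
Proof.
move=> /andP[p0 p1]; rewrite /susp_flow (@susp_indexP _ _ 0%N).
  by rewrite /birkhoff_sum big_ord0 addr0 subr0 -surjective_pairing.
by rewrite /birkhoff_sum big_ord0 big_ord1 /= addr0 p0.
Qed.

Lemma susp_flow_roof x s : 0 <= s ->
  susp_flow s (x, tau x) = susp_flow s (f x, 0).
Proof.
move=> s0; have [|k kP] := @susp_index_ex s (f x, 0); first by rewrite add0r.
rewrite /susp_flow (susp_indexP kP) (@susp_indexP _ _ k.+1).
  by rewrite iterSr birkhoff_sumS /= add0r opprD addrACA subrr add0r.
by move: kP; rewrite /= !birkhoff_sumS lerD2l ltrD2l add0r.
Qed.

Lemma susp_flow_quotient s p : under_roof p -> 0 <= s ->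
  susp_flow s (susp_flow 0 p) = susp_flow s p.
Proof.
move: p => [x t] /= /andP[/= t0]; rewrite le_eqVlt => /orP[/eqP-> s0|tx _].
  rewrite susp_flow_roof// susp_flow_roof// susp_flow_id//.
  by rewrite /susp_space /= lexx tau_gt0.
by rewrite (@susp_flow_id (x, t))// /susp_space /= t0.
Qed.

Lemma susp_flow0P p q : under_roof p -> under_roof q ->
  susp_flow 0 p = susp_flow 0 q <-> glue_equiv p q.
Proof.
have H r : under_roof r -> glue_equiv r (susp_flow 0 r).
  move: r => [x t] /= /andP[/= t0]; rewrite le_eqVlt => /orP[/eqP->|tx].
    rewrite susp_flow_roof// susp_flow_id; last first.
      by rewrite /susp_space /= lexx tau_gt0.
    by apply: rst_step; exists x.
  by rewrite susp_flow_id; [exact: rst_refl|rewrite /susp_space /= t0].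
move=> pD qD; split => [pq|].
  by apply: rst_trans (H _ pD) _; rewrite pq; apply: rst_sym; exact: H.
elim=> [_ _ [x [-> ->]]|//|? ? _ -> //|? ? ? _ -> _ ->//].
exact: susp_flow_roof.
Qed.

End suspension.

(* The lines s = tau x being null for mu x m, restricting to [susp_space]
   or to [under_roof] is the same. *)
Definition susp_measure (R : realType) d (T : measurableType d)
    (mu : set T -> \bar R) (tau : T -> R) :
    set (T * measurableTypeR R) -> \bar R :=
  fun B => ((mu \x @lebesgue_measure R) (B `&` susp_space tau) /
            \int[mu]_x (tau x)%:E)%E.

(* Main.v *)
Require Import Defs.
From HB Require Import structures.
From mathcomp Require Import all_boot all_order all_algebra.
From mathcomp Require Import all_classical all_reals all_analysis.
From mathcomp Require Import measurable_realfun ring lra.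

(** Both equalities compare two ways of cutting the orbits of the flow into
    pieces: by the visits to the section, and by the clock.

    Mean return time. The flow line of (x, 0) is over [A] at height 0 exactly
    at the times tau(x) + ... + tau(f^(k-1) x) with f^k x in A, so that
    n_A(x, 0) is the sum of tau over the excursion of x out of [A]
    ([hitting_cross_section]). Almost every point enters [A]
    ([ergodic_sweep]), and then the excursions tile the base: restricting mu
    to the points of [A] that have not come back by the time j, pushing forward
    by f^j and summing over j gives mu again ([kac_cvg]).
    Integrating tau gives the first equality ([mean_return_time]).

    Entropy. It remains to see that h(X_1) * int tau = mu(A) * h(f_A). Since
    the inverse of f may fail to be measurable and the space is arbitrary, the
    argument uses neither generators nor conditioning on the past: finite
    partitions are random variables with values in finite types, and entropy
    is the limit of the conditional entropies of a symbol given the n next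
    ones.

    Let t0 = 1 / N be smaller than the lower bound of tau. As X_1 is the N-th
    power of X_t0, h(X_1) = N h(X_t0) ([entropy_iter]). The box
    B = A x [0, t0[ is met once by each passage of a flow line over [A], so
    the first return of X_t0 to [B] is f_A in the base, together with the
    rotation by - n_A(x, 0) of the fiber, a circle of length t0
    ([first_return_flow]). The box has measure mu(A) t0 / int tau, and two
    theorems finish the computation.

    First, h(T) = m(B) h(T_B) for an endomorphism T and a set [B] that almost
    every orbit enters ([entropy_first_return]). Let xi be a finite variable
    that determines membership in [B], and zeta a finite variable on [B]. Let
    U_L(w) consist of the values of xi along the orbit of w until it enters
    [B], followed by the value of zeta at the point of entry, the reading
    being stopped after L steps. Off [B], U_(L+1)(w) is the pair of xi(w) and
    U_L(Tw); on [B] it is zeta(w). Comparing entropies on [B] and off [B],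
      H(xi | U_L o T) = m(B) (H_B(xi, U_L o T) - H_B(zeta))
                        + H(U_(L+1)) - H(U_L),
    where the last difference is at most a constant times the probability not
    to enter [B] before the time L ([CH_entry_name], [H_entry_name_le]). If
    zeta is a long T-word, U_L knows the future of xi, and the identity bounds
    h(T_B) ([induced_rate_le]); if zeta is a long T_B-word of truncated
    excursions, U_L o T is a part of the future of the process, and the
    identity bounds h(T) ([rate_le_induced]).

    Second, rotating the fibers adds no entropy
    ([entropy_rotation_extension]). Every finite partition of the box is
    close to one read from a partition of the base and a subdivision of the
    fiber into K arcs ([grid_approx_rv]). Given the successive angles of
    rotation, the position at time 0 in a subdivision into K n^2 arcs
    determines the positions at n successive times in the subdivision into K
    arcs, except near the n rotated boundaries: these positions carry an
    entropy of order ln n only ([CH_word_grid]). *)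

Set Implicit Arguments.
Unset Strict Implicit.
Unset Printing Implicit Defensive.
Import Order.TTheory GRing.Theory Num.Theory.
Import numFieldNormedType.Exports.
Local Open Scope classical_set_scope.
Local Open Scope ring_scope.

(** * Entropy of finite-valued random variables *)

Section phi.
Context {R : realType}.
Implicit Types t q : R.

Definition phi t := - (t * ln t).

Lemma phi0 : phi 0 = 0 :> R.
Proof. by rewrite /phi mul0r oppr0. Qed.

Lemma phi1 : phi 1 = 0 :> R.
Proof. by rewrite /phi ln1 mulr0 oppr0. Qed.

Lemma ln_le_sub1 t : 0 < t -> ln t <= t - 1.
Proof.
move=> t0; rewrite -[leLHS]opprK lerNl opprB.
have := @expR_ge1Dx R (ln t); rewrite lnK ?posrE// => h.
by rewrite lerNr opprB lerBrDl.
Qed.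

(** From [ln x <= x - 1] at [x = q / t]. *)
Lemma phi_gibbs t q : 0 <= t -> 0 <= q -> (t != 0 -> 0 < q) ->
  phi t <= - (t * ln q) + (q - t).
Proof.
move=> t0 q0 qt; have [->|tn0] := eqVneq t 0.
  by rewrite phi0 mul0r oppr0 add0r addr0.
have {}t0 : 0 < t by rewrite lt_neqAle eq_sym tn0.
have {}q0 := qt tn0; rewrite /phi.
have := ln_le_sub1 (divr_gt0 q0 t0); rewrite ln_div ?posrE// => h.
have := ler_wpM2l (ltW t0) h.
rewrite !mulrBr mulr1 mulrCA mulfV// mulr1; lra.
Qed.

Lemma phi_sum (I : finType) (P : pred I) (p : I -> R) : (forall i, 0 <= p i) ->
  phi (\sum_(i | P i) p i) <= \sum_(i | P i) phi (p i).
Proof.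
move=> p0; rewrite /phi mulr_suml -sumrN; apply: ler_sum => i Pi.
rewrite lerN2; have [->|n0] := eqVneq (p i) 0; first by rewrite !mul0r.
have pi0 : 0 < p i by rewrite lt_neqAle eq_sym n0 p0.
rewrite ler_wpM2l// ler_ln ?posrE//; last first.
  apply: lt_le_trans pi0 _; rewrite (bigD1 i)//= lerDl.
  by apply: sumr_ge0.
by rewrite (bigD1 i)//= lerDl; apply: sumr_ge0.
Qed.

Lemma phi_ge0 t : 0 <= t <= 1 -> 0 <= phi t.
Proof.
move=> /andP[t0 t1]; rewrite /phi -mulrN mulr_ge0// oppr_ge0.
exact: ln_le0.
Qed.

Lemma phiM s t : 0 <= s -> 0 <= t -> phi (s * t) = s * phi t + t * phi s.
Proof.
move=> s0 t0; rewrite /phi.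
have [->|sn0] := eqVneq s 0; first by rewrite !(mul0r,mulr0,oppr0,addr0).
have [->|tn0] := eqVneq t 0; first by rewrite !(mul0r,mulr0,oppr0,addr0).
rewrite lnM ?posrE ?lt_neqAle 1?eq_sym ?sn0 ?tn0//; ring.
Qed.

End phi.

Section rv.
Context d (T : measurableType d).

(** Finite measurable partitions are handled as level sets of such variables:
    joins become pairs, and refinement becomes [det]. *)
Definition mrv (I : finType) (X : T -> I) :=
  forall i, measurable (X @^-1` [set i]).

Lemma mrv_pre (I : finType) (X : T -> I) (P : set I) :
  mrv X -> measurable (X @^-1` P).
Proof.
move=> mX; rewrite (_ : _ @^-1` _ = \bigcup_(i in P) X @^-1` [set i]).
  by apply: fin_bigcup_measurable => //; exact: finite_finset.
apply/seteqP; split=> w /=; first by exists (X w).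
by case=> i Pi /= ->.
Qed.

Lemma mrv_comp (I J : finType) (h : I -> J) (X : T -> I) :
  mrv X -> mrv (fun w => h (X w)).
Proof. by move=> mX j; apply: (mrv_pre (h @^-1` [set j]) mX). Qed.

Lemma mrv_pair (I J : finType) (X : T -> I) (Y : T -> J) :
  mrv X -> mrv Y -> mrv (fun w => (X w, Y w)).
Proof.
move=> mX mY [i j].
rewrite (_ : _ @^-1` _ = X @^-1` [set i] `&` Y @^-1` [set j]).
  exact: measurableI.
by apply/seteqP; split=> w /=; [case=> <- <-|case=> /= -> ->].
Qed.

Lemma mrv_compr (I : finType) (X : T -> I) (g : T -> T) :
  measurable_fun setT g -> mrv X -> mrv (fun w => X (g w)).
Proof.
by move=> mg mX i; have := mg measurableT _ (mX i); rewrite setTI.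
Qed.

Lemma mrv_cst (I : finType) (i : I) : mrv (fun _ : T => i).
Proof.
move=> j; have [->|ij] := eqVneq i j.
  by rewrite (_ : _ @^-1` _ = setT)//; apply/seteqP; split.
rewrite (_ : _ @^-1` _ = set0)//; apply/seteqP; split=> // w /= E.
by rewrite E eqxx in ij.
Qed.

Lemma mrv_in (B : set T) : measurable B -> mrv (fun w => w \in B).
Proof.
move=> mB [].
  rewrite (_ : _ @^-1` _ = B)//; apply/seteqP; split=> w /=.
    by move=> h; exact: (set_mem h).
  exact: mem_set.
rewrite (_ : _ @^-1` _ = ~` B); first exact: measurableC.
apply/seteqP; split=> w /=.
  by move=> h Bw; rewrite (mem_set Bw) in h.
by move=> h; exact: memNset.
Qed.

Lemma mrv_if (I : finType) (b : T -> bool) (X Y : T -> I) :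
  mrv b -> mrv X -> mrv Y -> mrv (fun w => if b w then X w else Y w).
Proof.
move=> mb mX mY.
exact: (mrv_comp (fun p => if p.1 then p.2.1 else p.2.2)
  (mrv_pair mb (mrv_pair mX mY))).
Qed.

Lemma mrv_ffun (K I : finType) (X : K -> T -> I) :
  (forall k, mrv (X k)) -> mrv (fun w => [ffun k => X k w]).
Proof.
move=> mX u.
rewrite (_ : _ @^-1` _ = \bigcap_(k in [set: K]) X k @^-1` [set u k]).
  apply: fin_bigcap_measurable; first exact: finite_finset.
  by move=> k _; exact: mX.
apply/seteqP; split=> [w /= <- k _|w h]; first by rewrite /= ffunE.
by apply/ffunP => k; rewrite ffunE; exact: h.
Qed.

End rv.

Section det.
Context {T : Type}.

(** Stated on pairs of points, so that functions between the types of values,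
    some of them recursively defined, never have to be exhibited. *)
Definition det (D : set T) (J I : Type) (Y : T -> J) (X : T -> I) :=
  forall w w', D w -> D w' -> Y w = Y w' -> X w = X w'.

Lemma det_fun (D : set T) (I J : finType) (Y : T -> J) (X : T -> I) (i0 : I) :
  det D Y X -> exists h : J -> I, forall w, D w -> X w = h (Y w).
Proof.
move=> dYX.
exists (fun j => xget i0 [set i | exists2 w, D w & Y w = j /\ X w = i]).
move=> w Dw; case: xgetP => [i _ [w' Dw' [Yw <-]]|/(_ (X w))[]].
  exact: dYX.
by exists w.
Qed.

End det.

Section entropy.
Context d (T : measurableType d) (R : realType) (m : probability T R).

Definition mass (C : set T) : R := fine (m C).

Lemma massE C : measurable C -> m C = (mass C)%:E.
Proof. by move=> mC; rewrite /mass fineK// fin_num_measure. Qed.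

Lemma mass_ge0 C : 0 <= mass C.
Proof. exact: fine_ge0. Qed.

Lemma massT : mass setT = 1.
Proof. by rewrite /mass probability_setT. Qed.

Lemma mass0 : mass set0 = 0.
Proof. by rewrite /mass measure0. Qed.

Lemma le_mass C E : measurable C -> measurable E -> C `<=` E ->
  mass C <= mass E.
Proof.
move=> mC mE CE; rewrite -lee_fin -!massE//.
by apply: le_measure => //; rewrite inE.
Qed.

Lemma mass_le1 C : measurable C -> mass C <= 1.
Proof. by move=> mC; rewrite -massT; exact: le_mass. Qed.

Lemma massU C E : measurable C -> measurable E -> [disjoint C & E] ->
  mass (C `|` E) = mass C + mass E.
Proof.
move=> mC mE /eqP CE; apply: EFin_inj; rewrite EFinD -!massE//.
  by rewrite measureU.
exact: measurableU.
Qed.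

Lemma massUle C E : measurable C -> measurable E ->
  mass (C `|` E) <= mass C + mass E.
Proof.
move=> mC mE; rewrite -lee_fin EFinD -!massE//.
  exact: measureU2.
exact: measurableU.
Qed.

Lemma massC C : measurable C -> mass (~` C) = 1 - mass C.
Proof.
move=> mC; apply/eqP; rewrite eq_sym subr_eq -massT -(setvU C).
rewrite massU//; first exact: measurableC.
by apply/eqP; rewrite setICl.
Qed.

Lemma mass_split C E : measurable C -> measurable E ->
  mass E = mass (E `&` C) + mass (E `&` ~` C).
Proof.
move=> mC mE; rewrite -massU.
- by rewrite -setIUr setUv setIT.
- exact: measurableI.
- by apply: measurableI => //; exact: measurableC.
- by apply/eqP; rewrite setIACA setICr setI0.
Qed.

Lemma mass_cvg0 (F : (set T)^nat) : (forall n, measurable (F n)) ->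
  nonincreasing_seq F -> m (\bigcap_n F n) = 0%E ->
  (fun n => mass (F n)) @ \oo --> 0.
Proof.
move=> mF nF F0.
have mI : measurable (\bigcap_n F n) by exact: bigcapT_measurable.
have F00 : (m (F 0%N) < +oo)%E by rewrite -ge0_fin_numE// fin_num_measure.
have : m (F n) @[n --> \oo] --> 0%:E.
  by rewrite -[X in _ --> X]F0; exact: nonincreasing_cvg_mu.
exact: fine_cvg.
Qed.

Section pr.
Context (I : finType).
Implicit Type X : T -> I.

Definition pr X i : R := mass (X @^-1` [set i]).

Lemma pr_ge0 X i : 0 <= pr X i.
Proof. exact: mass_ge0. Qed.

Lemma mass_rv X (C : set T) : mrv X -> measurable C ->
  mass C = \sum_i mass (C `&` X @^-1` [set i]).
Proof.
move=> mX mC; apply: EFin_inj; rewrite -massE// -sumEFin.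
rewrite {1}(_ : C = \bigcup_(i in [set: I]) (C `&` X @^-1` [set i])); last first.
  apply/seteqP; split=> [w Cw|w [i _ []//]].
  by exists (X w).
rewrite measure_fin_bigcup//.
- rewrite -(_ : [set` index_enum I] = setT); last first.
    by apply/seteqP; split=> // i _ /=; rewrite mem_index_enum.
  rewrite -fsbig_seq ?index_enum_uniq//; apply: eq_bigr => i _.
  by apply: massE; exact: measurableI.
- exact: finite_finset.
- by move=> i j _ _ [w [[_ <-] [_ <-]]].
- by move=> i _; exact: measurableI.
Qed.

Lemma pr_sum1 X : mrv X -> \sum_i pr X i = 1.
Proof.
move=> mX; rewrite -massT (mass_rv mX)//.
by apply: eq_bigr => i _; rewrite setTI.
Qed.

End pr.

Lemma pr_margr (I J : finType) (X : T -> I) (Y : T -> J) j :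
  mrv X -> mrv Y -> pr Y j = \sum_i pr (fun w => (X w, Y w)) (i, j).
Proof.
move=> mX mY; rewrite /pr (mass_rv mX)//; apply: eq_bigr => i _.
congr mass; apply/seteqP; split=> w /=; first by case=> -> ->.
by case=> -> ->.
Qed.

Lemma pr_comp (I J : finType) (h : I -> J) (X : T -> I) j :
  mrv X -> pr (fun w => h (X w)) j = \sum_(i | h i == j) pr X i.
Proof.
move=> mX; rewrite /pr (mass_rv mX)/=; last first.
  exact: (mrv_comp h mX).
rewrite [RHS]big_mkcond/=; apply: eq_bigr => i _.
case: ifPn => [/eqP <-|/eqP hij].
  by congr mass; apply/seteqP; split=> w /= => [[]//|->].
rewrite (_ : _ `&` _ = set0) ?mass0//.
by apply/seteqP; split=> // w /= [] + E; rewrite E.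
Qed.

Lemma pr_ae (D : set T) (I : finType) (X Y : T -> I) i :
  measurable D -> mass (~` D) = 0 -> mrv X -> mrv Y ->
  (forall w, D w -> X w = Y w) -> pr X i = pr Y i.
Proof.
move=> mD D0 mX mY XY; rewrite /pr.
rewrite (mass_split mD (mX i)) (mass_split mD (mY i)).
have E0 C : measurable C -> mass (C `&` ~` D) = 0.
  move=> mC; apply/eqP; rewrite eq_le mass_ge0 andbT -D0.
  apply: le_mass; [|exact: measurableC|by apply: subIsetr].
  by apply: measurableI => //; exact: measurableC.
rewrite !E0//; congr (mass _ + _).
by apply/seteqP; split=> w /= [] <- Dw; rewrite XY.
Qed.

Definition rv_entropy (I : finType) (X : T -> I) : R := \sum_i phi (pr X i).

Local Notation H := rv_entropy.

Definition cond_entropy (I J : finType) (X : T -> I) (Y : T -> J) : R :=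
  H (fun w => (X w, Y w)) - H Y.

Local Notation CH := cond_entropy.

Lemma H_ge0 (I : finType) (X : T -> I) : mrv X -> 0 <= H X.
Proof.
by move=> mX; apply: sumr_ge0 => i _; rewrite phi_ge0// pr_ge0/= mass_le1.
Qed.

Lemma H_comp (I J : finType) (h : I -> J) (X : T -> I) :
  mrv X -> H (fun w => h (X w)) <= H X.
Proof.
move=> mX; rewrite [leRHS](partition_big h xpredT)//=.
apply: ler_sum => j _; rewrite pr_comp//; apply: phi_sum => i.
exact: pr_ge0.
Qed.

(** Coding bound: conditional entropy is at most the mean length of any
    prefix code, [q i j] being the subprobability of the symbol [i] in the
    context [j]. All the estimates on conditional entropies below come from
    a choice of [q]. *)
Lemma CH_code (I J : finType) (X : T -> I) (Y : T -> J) (q : I -> J -> R) :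
  mrv X -> mrv Y ->
  (forall i j, 0 <= q i j) -> (forall j, \sum_i q i j <= 1) ->
  (forall i j, pr (fun w => (X w, Y w)) (i, j) != 0 -> 0 < q i j) ->
  CH X Y <= \sum_j \sum_i - (pr (fun w => (X w, Y w)) (i, j) * ln (q i j)).
Proof.
move=> mX mY q0 q1 qp; set p := pr _.
have p0 ij : 0 <= p ij by exact: pr_ge0.
have pY j : pr Y j = \sum_i p (i, j) by exact: pr_margr.
rewrite /cond_entropy lerBlDr {1}/rv_entropy -/p.
rewrite (eq_bigr (fun ij => phi (p (ij.1, ij.2)))) => [|[]//].
rewrite -(pair_bigA _ (fun i j => phi (p (i, j))))/= exchange_big/=.
rewrite /rv_entropy -big_split/=.
have -> : \sum_j (\sum_i - (p (i, j) * ln (q i j)) + phi (pr Y j)) =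
    \sum_j \sum_i (- (p (i, j) * ln (q i j)) - p (i, j) * ln (pr Y j)).
  apply: eq_bigr => j _; rewrite big_split/=; congr (_ + _).
  by rewrite sumrN -mulr_suml -pY.
suff : \sum_j \sum_i phi (p (i, j)) <=
    \sum_j (\sum_i (- (p (i, j) * ln (q i j)) - p (i, j) * ln (pr Y j)) +
      (pr Y j * (\sum_i q i j) - pr Y j)).
  rewrite big_split/= => /le_trans; apply; rewrite gerDl.
  apply: sumr_le0 => j _; rewrite subr_le0 ler_piMr//; exact: pr_ge0.
apply: ler_sum => j _; rewrite {3}pY mulr_sumr -sumrB -big_split/=.
apply: ler_sum => i _.
have [->|pn0] := eqVneq (p (i, j)) 0.
  by rewrite phi0 !(mul0r,oppr0,addr0,add0r) mulr_ge0//; exact: pr_ge0.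
have ppos : 0 < p (i, j) by rewrite lt_neqAle eq_sym pn0 p0.
have Ypos : 0 < pr Y j.
  apply: (lt_le_trans ppos); rewrite pY (bigD1 i)//= lerDl.
  exact: sumr_ge0.
have qpos := qp _ _ pn0.
have := @phi_gibbs R (p (i, j)) (pr Y j * q i j) (ltW ppos)
  (mulr_ge0 (ltW Ypos) (ltW qpos)) (fun=> mulr_gt0 Ypos qpos).
rewrite lnM ?posrE// mulrDr; lra.
Qed.

Lemma card_gt0_rv (I : finType) (X : T -> I) : 0 < #|I|%:R :> R.
Proof. by rewrite ltr0n; apply/card_gt0P; exists (X point). Qed.

Lemma card_ge1_rv (I : finType) (X : T -> I) : 1 <= #|I|%:R :> R.
Proof. by rewrite (ler_nat R 1) -(ltr_nat R 0); exact: card_gt0_rv X. Qed.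

(** The code is uniform in the contexts satisfying [b], and spends nothing in
    the others, where the symbol is known. *)
Lemma CH_le_cond (I J : finType) (X : T -> I) (Y : T -> J) (b : J -> bool)
    (x0 : I) : mrv X -> mrv Y -> (forall w, ~~ b (Y w) -> X w = x0) ->
  CH X Y <= mass [set w | b (Y w)] * ln #|I|%:R.
Proof.
move=> mX mY Xb; have I0 := card_gt0_rv X.
pose q i j : R := if b j then #|I|%:R^-1 else (i == x0)%:R.
have p0 i j : ~~ b j -> i != x0 -> pr (fun w => (X w, Y w)) (i, j) = 0.
  move=> bj ix; rewrite /pr (_ : _ @^-1` _ = set0) ?mass0//.
  apply/seteqP; split=> // w [] Xi Yj; apply/negP: ix; rewrite negbK.
  by rewrite -Xi Xb// Yj.
apply: (le_trans (@CH_code _ _ X Y q mX mY _ _ _)).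
- by move=> i j; rewrite /q; case: ifP => // _; rewrite invr_ge0 ltW.
- move=> j; rewrite /q; case: (b j).
    by rewrite sumr_const -[leLHS]mulr_natr mulVf// gt_eqF.
  by rewrite (bigD1 x0)//= eqxx big1 ?addr0// => i /negPf ->.
- move=> i j; rewrite /q; case: ifPn => bj; first by rewrite invr_gt0.
  by have [//|ix] := eqVneq i x0; rewrite (p0 _ _ bj ix) eqxx.
have -> : mass [set w | b (Y w)] = \sum_(j | b j) pr Y j.
  transitivity (pr (fun w => b (Y w)) true); first by [].
  by rewrite pr_comp//; apply: eq_bigl => j; rewrite eqb_id.
rewrite mulr_suml [leRHS]big_mkcond/= le_eqVlt; apply/orP; left; apply/eqP.
apply: eq_bigr => j _; rewrite /q; case: ifPn => bj.
  rewrite (pr_margr j mX mY) mulr_suml; apply: eq_bigr => i _.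
  by rewrite lnV ?posrE// mulrN opprK.
apply: big1 => i _; have [_|ix] := eqVneq i x0.
  by rewrite ln1 mulr0 oppr0.
by rewrite p0// mul0r oppr0.
Qed.

Lemma CH_le_card (I J : finType) (X : T -> I) (Y : T -> J) :
  mrv X -> mrv Y -> CH X Y <= ln #|I|%:R.
Proof.
move=> mX mY.
apply: le_trans (@CH_le_cond _ _ X Y xpredT (X point) mX mY _) _ => //.
by rewrite (_ : [set w | _] = setT) ?massT ?mul1r//; apply/seteqP; split.
Qed.

(** The code gives the probability [1 - e] to the predicted symbol and spreads
    [e] over all symbols. Leaving [e] free allows it to be fixed before the
    mass of the exceptional set. *)
Lemma CH_fano (I J : finType) (X : T -> I) (Y : T -> J) (G : set T) (e : R) :
  mrv X -> mrv Y -> measurable G -> det G Y X -> 0 < e < 1 ->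
  CH X Y <= - ln (1 - e) + mass (~` G) * ln (#|I|%:R / e).
Proof.
move=> mX mY mG /det_fun -/(_ (X point))[h hE] /andP[e0 e1].
have I0 := card_gt0_rv X; have I1 := card_ge1_rv X.
pose q i j : R := if i == h j then 1 - e else e / #|I|%:R.
have q0 i j : 0 < q i j.
  by rewrite /q; case: ifP => _; rewrite ?subr_gt0// divr_gt0.
apply: (le_trans (@CH_code _ _ X Y q mX mY _ _ _)).
- by move=> i j; exact: ltW.
- move=> j; rewrite (bigD1 (h j))//= {1}/q eqxx.
  rewrite (eq_bigr (fun=> e / #|I|%:R)) => [|i /negPf]; last by rewrite /q => ->.
  rewrite -[leRHS](subrK e) lerD2l sumr_const -[leLHS]mulr_natr -[leRHS]mulr1.
  rewrite -mulrA (ler_wpM2l (ltW e0))// ler_pdivrMl// mulr1 ler_nat.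
  exact: max_card.
- by move=> *; exact: q0.
set p := pr _; have p0 ij : 0 <= p ij by exact: pr_ge0.
have mXY := mrv_pair mX mY.
have s1 : \sum_j \sum_i p (i, j) = 1.
  rewrite exchange_big/= pair_bigA/= -(pr_sum1 mXY).
  by apply: eq_bigr => -[].
have s2 : \sum_j \sum_(i | i != h j) p (i, j) <= mass (~` G).
  rewrite (_ : \sum_j _ = pr (fun w => X w != h (Y w)) true); last first.
    rewrite (@pr_comp _ _ (fun ij => ij.1 != h ij.2) _ _ mXY).
    rewrite (exchange_big_dep xpredT)//= pair_big_dep/=.
    by apply: eq_big => [[i j]|[i j]//] /=; rewrite eqb_id.
  apply: le_mass.
  - exact: (mrv_comp (fun ij => ij.1 != h ij.2) mXY true).
  - exact: measurableC.
  - by move=> w /= /eqP Xh Gw; apply: Xh; rewrite hE.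
have le1e : 0 <= - ln (1 - e).
  by rewrite oppr_ge0 ln_le0// gerBl ltW.
have lIe : 0 <= ln (#|I|%:R / e).
  by rewrite ln_ge0// ler_pdivlMr// mul1r (le_trans (ltW e1)).
apply: (@le_trans _ _ (\sum_j (\sum_i p (i, j) * - ln (1 - e)
   + \sum_(i | i != h j) p (i, j) * ln (#|I|%:R / e)))); last first.
  rewrite big_split/=; apply: lerD.
    under eq_bigr do rewrite -mulr_suml.
    by rewrite -mulr_suml s1 mul1r.
  under eq_bigr do rewrite -mulr_suml.
  by rewrite -mulr_suml ler_wpM2r.
apply: ler_sum => j _; rewrite [X in _ + X]big_mkcond/= -big_split/=.
apply: ler_sum => i _; rewrite /q; case: eqP => _ /=.
  by rewrite addr0 mulrN.
rewrite -[e / _]invrK invf_div lnV ?posrE ?divr_gt0// mulrN opprK lerDr.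
exact: mulr_ge0.
Qed.

(** In the applications [Y] is a word of unbounded length: [de] is chosen from
    the number of values of [X] alone. *)
Lemma CH_fano_small (c : nat) (e : R) : 0 < e -> exists2 de : R, 0 < de &
  forall (I J : finType) (X : T -> I) (Y : T -> J) (G : set T), #|I| = c ->
    mrv X -> mrv Y -> measurable G -> det G Y X -> mass (~` G) < de ->
    CH X Y < e.
Proof.
move=> e0; pose t : R := 1 - expR (- (e / 2)).
have t01 : 0 < t < 1.
  rewrite subr_gt0 expR_lt1 oppr_lt0 divr_gt0//= gtrBl expR_gt0//.
have et : - ln (1 - t) = e / 2 by rewrite subKr expRK opprK.
pose K : R := `|ln (c%:R / t)| + 1.
have K0 : 0 < K by rewrite ltr_wpDl.
exists (e / 2 / K) => [|I J X Y G cI mX mY mG dG de].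
  by rewrite !divr_gt0.
apply: (le_lt_trans (CH_fano mX mY mG dG t01)); rewrite et cI.
rewrite [ltRHS](splitr e) ltrD2l.
apply: (@le_lt_trans _ _ (mass (~` G) * K)).
  by rewrite ler_wpM2l ?mass_ge0// (le_trans (ler_norm _))// lerDl.
by rewrite -ltr_pdivlMr.
Qed.

End entropy.

Section conditional_entropy.
Context d (T : measurableType d) (R : realType) (m : probability T R).
Variable D : set T.
Hypotheses (mD : measurable D) (D0 : mass m (~` D) = 0).
Implicit Types I J K : finType.
Local Notation H := (rv_entropy m).
Local Notation CH := (cond_entropy m).

(** The set [D] of full measure serves for induced systems, whose maps are
    controlled on the inducing set only. *)
Lemma H_det I J (X : T -> I) (Y : T -> J) : mrv X -> mrv Y ->
  det D Y X -> H X <= H Y.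
Proof.
move=> mX mY /det_fun -/(_ (X point))[h hE].
rewrite (_ : H X = H (fun w => h (Y w))); first exact: H_comp.
by apply: eq_bigr => i _; congr phi; apply: (pr_ae i mD D0) => //; exact: mrv_comp.
Qed.

Lemma H_eq_det I J (X : T -> I) (Y : T -> J) : mrv X -> mrv Y ->
  det D Y X -> det D X Y -> H X = H Y.
Proof. by move=> mX mY YX XY; apply/eqP; rewrite eq_le !H_det. Qed.

Lemma CH_ge0 I J (X : T -> I) (Y : T -> J) : mrv X -> mrv Y -> 0 <= CH X Y.
Proof.
move=> mX mY; rewrite subr_ge0; apply: H_det => //; first exact: mrv_pair.
by move=> w w' _ _ [].
Qed.

Lemma CH_chain I J K (X : T -> I) (Y : T -> J) (Z : T -> K) :
  mrv X -> mrv Y -> mrv Z ->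
  CH (fun w => (X w, Y w)) Z = CH Y Z + CH X (fun w => (Y w, Z w)).
Proof.
move=> mX mY mZ; rewrite /cond_entropy [RHS]addrC addrA subrK; congr (_ - _).
by apply: H_eq_det; [by do ?apply: mrv_pair|by do ?apply: mrv_pair| |] => w w' _ _ [] -> -> ->.
Qed.

(** Strong subadditivity: the conditional law given [Z] is also a code for the
    contexts [(Y, Z)]. *)
Lemma CH_SSA I J K (X : T -> I) (Y : T -> J) (Z : T -> K) :
  mrv X -> mrv Y -> mrv Z -> CH X (fun w => (Y w, Z w)) <= CH X Z.
Proof.
move=> mX mY mZ; have mYZ := mrv_pair mY mZ; have mXZ := mrv_pair mX mZ.
pose q (i : I) (jk : J * K) := pr m (fun w => (X w, Z w)) (i, jk.2) / pr m Z jk.2.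
have sub i j k : pr m (fun w => (X w, (Y w, Z w))) (i, (j, k)) <=
    pr m (fun w => (X w, Z w)) (i, k).
  apply: le_mass; [exact: (mrv_pair mX mYZ)|exact: mXZ|].
  by move=> w /= [-> _ ->].
have subZ i k : pr m (fun w => (X w, Z w)) (i, k) <= pr m Z k.
  by apply: le_mass; [exact: mXZ|exact: mZ|move=> w /= [_ ->]].
have pos i j k : pr m (fun w => (X w, (Y w, Z w))) (i, (j, k)) != 0 ->
    0 < pr m (fun w => (X w, Z w)) (i, k).
  by move=> n0; apply: lt_le_trans (sub i j k); rewrite lt_neqAle eq_sym n0 pr_ge0.
have posZ i k : 0 < pr m (fun w => (X w, Z w)) (i, k) -> 0 < pr m Z k.
  by move=> /lt_le_trans; apply; exact: subZ.
apply: (le_trans (@CH_code _ _ _ m _ _ X (fun w => (Y w, Z w)) q mX mYZ _ _ _)).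
- by move=> i jk; rewrite divr_ge0// pr_ge0.
- move=> [j k] /=; rewrite -mulr_suml -(pr_margr m k mX mZ).
  by have [->|n0] := eqVneq (pr m Z k) 0; rewrite ?mul0r// divff.
- move=> i [j k] /pos h; rewrite divr_gt0//; exact: posZ h.
rewrite /cond_entropy /rv_entropy.
have XZ : \sum_ik phi (pr m (fun w => (X w, Z w)) ik) =
    \sum_k \sum_i - (pr m (fun w => (X w, Z w)) (i, k) *
      ln (pr m (fun w => (X w, Z w)) (i, k))).
  by rewrite exchange_big/= pair_bigA/=; apply: eq_bigr => -[].
have EZ : \sum_k phi (pr m Z k) =
    \sum_k \sum_i - (pr m (fun w => (X w, Z w)) (i, k) * ln (pr m Z k)).
  apply: eq_bigr => k _; rewrite sumrN -mulr_suml -(pr_margr m k mX mZ)//.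
rewrite XZ EZ -sumrB; under [leRHS]eq_bigr do rewrite -sumrB.
have marg i k : pr m (fun w => (X w, Z w)) (i, k) =
    \sum_j pr m (fun w => (X w, (Y w, Z w))) (i, (j, k)).
  rewrite (pr_margr m (i, k) mY mXZ); apply: eq_bigr => j _; congr mass.
  by apply/seteqP; split=> w /= [-> -> ->].
rewrite [leLHS](_ : _ = \sum_k \sum_i \sum_j
    - (pr m (fun w => (X w, (Y w, Z w))) (i, (j, k)) * ln (q i (j, k)))); last first.
  under [RHS]eq_bigr do rewrite exchange_big/=.
  by rewrite [RHS]exchange_big pair_bigA/=; apply: eq_bigr => -[j k].
apply: ler_sum => k _; apply: ler_sum => i _.
rewrite opprK -mulrN -mulrDr {1}marg mulr_suml; apply: ler_sum => j _.
have [->|n0] := eqVneq (pr m (fun w => (X w, (Y w, Z w))) (i, (j, k))) 0.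
  by rewrite !mul0r oppr0.
have h := pos _ _ _ n0; have hZ := posZ _ _ h.
by rewrite /q/= ln_div// -mulrN opprB addrC.
Qed.

Lemma CH_le_r I J K (X : T -> I) (Y : T -> J) (Z : T -> K) :
  mrv X -> mrv Y -> mrv Z -> det D Y Z -> CH X Y <= CH X Z.
Proof.
move=> mX mY mZ YZ; apply: le_trans (CH_SSA mX mY mZ).
rewrite le_eqVlt; apply/orP; left; apply/eqP; congr (_ - _).
  apply: H_eq_det; [by do ?apply: mrv_pair|by do ?apply: mrv_pair| |].
    by move=> w w' _ _ [-> -> _].
  by move=> w w' Dw Dw' [-> YE]; rewrite YE (YZ _ _ Dw Dw' YE).
apply: H_eq_det; [by do ?apply: mrv_pair|by do ?apply: mrv_pair| |].
  by move=> w w' _ _ [].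
by move=> w w' Dw Dw' YE; rewrite YE (YZ _ _ Dw Dw' YE).
Qed.

Lemma CH_le_l I J K (X : T -> I) (Y : T -> J) (Z : T -> K) :
  mrv X -> mrv Y -> mrv Z -> det D (fun w => (Y w, Z w)) X -> CH X Z <= CH Y Z.
Proof.
move=> mX mY mZ h; rewrite /cond_entropy lerD2r; apply: H_det; [exact: mrv_pair..|].
by move=> w w' Dw Dw' [YE ZE]; rewrite ZE (h w w')// YE ZE.
Qed.

Lemma CH_triangle I J K (X : T -> I) (Y : T -> J) (Z : T -> K) :
  mrv X -> mrv Y -> mrv Z -> CH X Z <= CH X Y + CH Y Z.
Proof.
move=> mX mY mZ; apply: (@le_trans _ _ (CH (fun w => (X w, Y w)) Z)).
  apply: CH_le_l => //; first exact: mrv_pair.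
  by move=> w w' _ _ [].
rewrite CH_chain// addrC lerD2r; apply: CH_le_r => //; first exact: mrv_pair.
by move=> w w' _ _ [].
Qed.

Lemma CH_pair_le I J K (X : T -> I) (Y : T -> J) (Z : T -> K) :
  mrv X -> mrv Y -> mrv Z ->
  CH (fun w => (X w, Y w)) Z <= CH X Z + CH Y Z.
Proof.
move=> mX mY mZ; rewrite CH_chain// addrC lerD2r.
apply: CH_le_r => //; first exact: mrv_pair.
by move=> w w' _ _ [].
Qed.

Lemma CH0_det I J (X : T -> I) (Y : T -> J) :
  mrv X -> mrv Y -> det D Y X -> CH X Y = 0.
Proof.
move=> mX mY h; apply/eqP; rewrite subr_eq0; apply/eqP.
apply: H_eq_det; [exact: mrv_pair|by []| |].
  by move=> w w' Dw Dw' YE; rewrite YE (h w w').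
by move=> w w' _ _ [].
Qed.

End conditional_entropy.

(** * Processes and Kolmogorov-Sinai entropy *)

Section process.
Context d (T : measurableType d) (R : realType) (m : probability T R).
Variables (g : T -> T) (D : set T).
Hypotheses (mg : measurable_fun setT g) (minv : invariant_measure m g).
Hypotheses (mD : measurable D) (D0 : mass m (~` D) = 0).
Implicit Types I J K : finType.
Local Notation H := (rv_entropy m).
Local Notation CH := (cond_entropy m).

Definition word I (X : T -> I) n (w : T) : {ffun 'I_n -> I} :=
  [ffun i : 'I_n => X (iter i g w)].

Lemma word_eq I (X : T -> I) n w w' :
  (forall i, (i < n)%N -> X (iter i g w) = X (iter i g w')) <->
  word X n w = word X n w'.
Proof.
split=> [h|/ffunP h i ilt]; first by apply/ffunP => i; rewrite !ffunE h.
by have := h (Ordinal ilt); rewrite !ffunE.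
Qed.

Lemma measurable_iter n : measurable_fun setT (iter n g).
Proof.
by elim: n => [|n IH]; [exact: measurable_id|exact: (measurableT_comp mg IH)].
Qed.

Lemma mass_inv C : measurable C -> mass m (g @^-1` C) = mass m C.
Proof. by move=> mC; rewrite /mass minv. Qed.

Lemma mass_inv_iter n C : measurable C -> mass m (iter n g @^-1` C) = mass m C.
Proof.
elim: n C => // n IH C mC; have mgC : measurable (g @^-1` C).
  by have := mg measurableT mC; rewrite setTI.
by rewrite -[RHS]mass_inv// -[RHS]IH.
Qed.

Lemma mrv_iter I (X : T -> I) n : mrv X -> mrv (fun w => X (iter n g w)).
Proof. by move=> mX; apply: mrv_compr mX; exact: measurable_iter. Qed.

Lemma mrv_word I (X : T -> I) n : mrv X -> mrv (word X n).
Proof. by move=> mX; apply: mrv_ffun => k; exact: mrv_iter. Qed.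

Lemma mrv_wordg I (X : T -> I) n : mrv X -> mrv (fun w => word X n (g w)).
Proof. by move=> mX; apply: mrv_compr => //; exact: mrv_word. Qed.

Lemma H_inv I (X : T -> I) : mrv X -> H (fun w => X (g w)) = H X.
Proof.
by move=> mX; apply: eq_bigr => i _; rewrite /pr -(mass_inv (mX i)).
Qed.

Lemma CH_inv I J (X : T -> I) (Y : T -> J) : mrv X -> mrv Y ->
  CH (fun w => X (g w)) (fun w => Y (g w)) = CH X Y.
Proof.
move=> mX mY; rewrite /cond_entropy (H_inv mY); congr (_ - _).
exact: (H_inv (mrv_pair mX mY)).
Qed.

(** The symbol at time 0 is conditioned on the future: the past of a
    non-invertible system is not available. *)
Definition inc I (X : T -> I) n := CH X (fun w => word X n (g w)).

Lemma word_consP I (X : T -> I) n w w' :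
  word X n.+1 w = word X n.+1 w' <->
  (X w, word X n (g w)) = (X w', word X n (g w')).
Proof.
split=> [/word_eq h|[h0 /word_eq h]].
  congr (_, _); first exact: (h 0%N).
  by apply/word_eq => i ilt; rewrite -!iterSr h.
by apply/word_eq => -[|i] //; rewrite ltnS !iterSr; exact: h.
Qed.

Lemma incE I (X : T -> I) n : mrv X ->
  inc X n = H (word X n.+1) - H (word X n).
Proof.
move=> mX; rewrite /inc /cond_entropy (H_inv (mrv_word (n:=n) mX)); congr (_ - _).
apply: (H_eq_det mD D0).
- by apply: mrv_pair => //; exact: mrv_wordg.
- exact: mrv_word.
- by move=> w w' _ _ /word_consP.
- by move=> w w' _ _ /word_consP.
Qed.

Lemma inc_ge0 I (X : T -> I) n : mrv X -> 0 <= inc X n.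
Proof. by move=> mX; apply: (CH_ge0 mD D0) => //; exact: mrv_wordg. Qed.

Lemma word_le I (X : T -> I) n k w w' : (n <= k)%N ->
  word X k w = word X k w' -> word X n w = word X n w'.
Proof.
move=> nk /word_eq h; apply/word_eq => i ilt; apply: h.
exact: leq_trans ilt nk.
Qed.

Lemma inc_noninc I (X : T -> I) : mrv X -> nonincreasing_seq (inc X).
Proof.
move=> mX n k nk; apply: (CH_le_r mD D0) => //; [exact: mrv_wordg..|].
by move=> w w' _ _; exact: word_le.
Qed.

Lemma H_word I (X : T -> I) n : mrv X ->
  H (word X n) = \sum_(0 <= i < n) inc X i.
Proof.
move=> mX; elim: n => [|n IH]; last first.
  by rewrite big_nat_recr//= -IH incE// addrC subrK.
rewrite big_geq//; apply/eqP; rewrite eq_le H_ge0 ?andbT; last exact: mrv_word.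
have [i0] : exists i0 : {ffun 'I_0 -> I}, forall i, i = i0.
  by exists [ffun i => X point] => u; apply/ffunP => -[].
move=> i0P; rewrite /rv_entropy (bigD1 i0)//= big1 ?addr0; last first.
  by move=> i; rewrite (i0P i) eqxx.
rewrite (_ : pr m _ _ = 1) ?phi1// -(massT m); congr mass.
by apply/seteqP; split=> // w _ /=.
Qed.

Definition rate I (X : T -> I) := limn (inc X).

Lemma cvg_inc I (X : T -> I) : mrv X -> inc X @ \oo --> rate X.
Proof.
move=> mX; apply: (nonincreasing_is_cvgn (inc_noninc mX)).
by exists 0 => _ [n _ <-]; exact: inc_ge0.
Qed.

Lemma rate_le_inc I (X : T -> I) n : mrv X -> rate X <= inc X n.
Proof.
move=> mX; apply: nonincreasing_cvgn_ge; first exact: inc_noninc.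
by apply/cvg_ex; exists (rate X); exact: cvg_inc.
Qed.

Lemma rate_ge0 I (X : T -> I) : mrv X -> 0 <= rate X.
Proof.
move=> mX; apply: limr_ge; first by apply/cvg_ex; exists (rate X); exact: cvg_inc.
by near=> n; exact: inc_ge0.
Unshelve. all: by end_near. Qed.

Lemma le_rate I (X : T -> I) a : mrv X ->
  (\forall n \near \oo, a <= inc X n) -> a <= rate X.
Proof.
move=> mX h; apply: (ler_cvg_to (cvg_cst _) (cvg_inc mX)); exact: h.
Qed.

Lemma cvg_Hword I (X : T -> I) : mrv X ->
  (fun n => H (word X n) / n%:R) @ \oo --> rate X.
Proof.
move=> mX; rewrite -cvg_shiftS; apply: cvg_trans (cesaro (cvg_inc mX)).
apply: near_eq_cvg; near=> n.
by rewrite /arithmetic_mean/= H_word// /series/= mulrC.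
Unshelve. all: by end_near. Qed.

Lemma CH_word_le I J (X : T -> I) (Y : T -> J) n : mrv X -> mrv Y ->
  CH (word X n) (word Y n) <= n%:R * CH X Y.
Proof.
move=> mX mY; elim: n => [|n IH].
  rewrite mul0r (CH0_det mD D0) //; [exact: mrv_word..|].
  by move=> w w' _ _ _; apply/word_eq.
apply: (@le_trans _ _ (CH (fun w => (X w, word X n (g w))) (word Y n.+1))).
  apply: (CH_le_l mD D0); [exact: mrv_word|
    by apply: mrv_pair => //; exact: mrv_wordg|exact: mrv_word|].
  by move=> w w' _ _ [? ? _]; apply/word_consP; congr (_, _).
apply: (le_trans (CH_pair_le mD D0 _ _ _)) => //; [exact: mrv_wordg|exact: mrv_word|].
rewrite -natr1 mulrDl mul1r addrC lerD//.
  apply: le_trans IH; rewrite -(CH_inv (mrv_word (n:=n) mX) (mrv_word (n:=n) mY)).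
  apply: (CH_le_r mD D0); [exact: mrv_wordg|exact: mrv_word|exact: mrv_wordg|].
  by move=> w w' _ _ /word_consP[].
apply: (CH_le_r mD D0) => //; first exact: mrv_word.
by move=> w w' _ _ /word_consP[].
Qed.

(** Replacing [Y] by [X] costs at most [CH X Y] per unit of time. With Fano's
    inequality, this makes the entropy of a process continuous in measure. *)
Lemma rate_le_CH I J (X : T -> I) (Y : T -> J) : mrv X -> mrv Y ->
  rate X <= rate Y + CH X Y.
Proof.
move=> mX mY; have h1 := cvg_Hword mX.
have h2 : (fun n => H (word Y n) / n%:R + CH X Y) @ \oo --> rate Y + CH X Y.
  by apply: cvgD; [exact: cvg_Hword|exact: cvg_cst].
apply: ler_cvg_to h1 h2 _; near=> n.
have n0 : (0 < n)%N by near: n; exact: nbhs_infty_gt.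
rewrite ler_pdivrMr ?ltr0n// mulrDl divfK ?pnatr_eq0 -?lt0n//.
rewrite -lerBlDl mulrC; apply: le_trans (CH_word_le n mX mY).
rewrite lerD2r; apply: (H_det mD D0).
- exact: mrv_word.
- by apply: mrv_pair; exact: mrv_word.
- by move=> w w' _ _ [].
Unshelve. all: by end_near. Qed.

Lemma rate_det I J (X : T -> I) (Y : T -> J) : mrv X -> mrv Y ->
  det D Y X -> rate X <= rate Y.
Proof.
by move=> mX mY h; rewrite -[leRHS]addr0 -(CH0_det mD D0 mX mY h) rate_le_CH.
Qed.

Lemma join_entropyE k (P : 'I_k -> set T) (X : T -> 'I_k) n :
  (forall i, P i = X @^-1` [set i]) -> join_entropy m g P n = H (word X n).
Proof.
move=> PX; rewrite /join_entropy -sumrN; apply: eq_bigr => u _.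
rewrite /pr /mass (_ : join_atom g P u = word X n @^-1` [set u])//.
apply/seteqP; split=> w /=.
  by move=> h; apply/ffunP => i; rewrite ffunE; have := h i I; rewrite PX.
by move=> <- i _; rewrite PX /= ffunE.
Qed.

Lemma partition_entropyE k (P : 'I_k -> set T) (X : T -> 'I_k) :
  mrv X -> (forall i, P i = X @^-1` [set i]) -> partition_entropy m g P = rate X.
Proof.
move=> mX PX; apply/cvg_lim => //.
rewrite (_ : (fun n => _) = (fun n => H (word X n) / n%:R)).
  exact: cvg_Hword.
by apply/funext => n; rewrite (join_entropyE n PX).
Qed.

Lemma rate_le_entropy I (X : T -> I) : mrv X -> ((rate X)%:E <= entropy m g)%E.
Proof.
move=> mX; pose Y w := enum_rank (X w).
have mY : mrv Y by exact: mrv_comp.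
apply: (@le_trans _ _ (rate Y)%:E).
  rewrite lee_fin rate_det// => w w' _ _; exact: enum_rank_inj.
apply: ereal_sup_ubound; exists #|I|, (fun i => Y @^-1` [set i]); split.
  split=> // [i j _ _ [w [<- <-]]//|].
  by apply/seteqP; split=> // w _; exists (Y w).
by rewrite (@partition_entropyE _ _ Y).
Qed.

Lemma entropy_le y :
  (forall k (X : T -> 'I_k), mrv X -> ((rate X)%:E <= y)%E) ->
  (entropy m g <= y)%E.
Proof.
move=> h; apply: ge_ereal_sup => _ [k [P [[mP tP PT] ->]]].
have /choice[X XP] : forall w, exists i, P i w.
  move=> w; have : (\bigcup_i P i) w by rewrite PT.
  by case=> i _ Piw; exists i.
have PX i : P i = X @^-1` [set i].
  apply/seteqP; split=> w /=; last by move=> <-; exact: XP.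
  move=> Piw; apply: tP => //; exists w; split=> //; exact: XP.
have mX : mrv X by move=> i; rewrite -PX.
by rewrite (partition_entropyE mX PX) h.
Qed.

End process.

(** * Entropy of the powers of a system *)

Section power.
Context d (T : measurableType d) (R : realType) (m : probability T R).
Variables (g : T -> T) (D : set T).
Hypotheses (mg : measurable_fun setT g) (minv : invariant_measure m g).
Hypotheses (mD : measurable D) (D0 : mass m (~` D) = 0).
Variable N : nat.
Hypothesis N0 : (0 < N)%N.

Lemma invariant_iter : invariant_measure m (iter N g).
Proof.
move=> C mC; have mi := @measurable_iter _ _ _ mg N.
have mC' : measurable (iter N g @^-1` C).
  by have := mi measurableT _ mC; rewrite setTI.
by rewrite !massE// mass_inv_iter.
Qed.

(** A word of blocks of length [N] is a word [N] times as long. *)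
Lemma word_word_eq (I : finType) (X : T -> I) n w w' :
  word (iter N g) (word g X N) n w = word (iter N g) (word g X N) n w' <->
  word g X (n * N) w = word g X (n * N) w'.
Proof.
split=> [/word_eq h|/word_eq h].
  apply/word_eq => i ilt; rewrite (divn_eq i N) addnC !iterD !iterM.
  have /h/word_eq : (i %/ N < n)%N by rewrite ltn_divLR.
  by apply; rewrite ltn_mod.
apply/word_eq => i ilt; apply/word_eq => j jlt.
rewrite -!iterM -!iterD h//.
rewrite (@leq_trans (N + i * N))//; first by rewrite ltn_add2r.
by rewrite -mulSn leq_mul2r ilt orbT.
Qed.

Lemma rate_iter (I : finType) (X : T -> I) : mrv X ->
  rate m (iter N g) (word g X N) = N%:R * rate m g X.
Proof.
move=> mX; have mW : mrv (word g X N) by exact: mrv_word.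
have mi := @measurable_iter _ _ _ mg N; have ii := invariant_iter.
have h1 := cvg_Hword mi ii mD D0 mW.
have h2 := cvg_Hword mg minv mD D0 mX.
have h3 : (fun n => N%:R * (rv_entropy m (word g X (n * N)) / (n * N)%:R)) @ \oo -->
    N%:R * rate m g X.
  apply: cvgM; first exact: cvg_cst.
  apply: (@cvg_comp _ _ _ (fun n => n * N)%N _ _ \oo) h2.
  move=> P [k _ kP]; exists k => // n /= kn; apply: kP => /=.
  by apply: leq_trans kn _; rewrite leq_pmulr.
apply: cvg_unique h1 _ => //; apply: cvg_trans h3.
apply: near_eq_cvg; near=> n.
rewrite (_ : rv_entropy m (word (iter N g) (word g X N) n) = rv_entropy m (word g X (n * N))).
  rewrite natrM invfM mulrCA (mulrCA N%:R) divff ?mulr1//.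
  by rewrite pnatr_eq0 -lt0n.
apply: (H_eq_det mD D0); [exact: mrv_word|exact: mrv_word| |].
  by move=> w w' _ _ /word_word_eq.
by move=> w w' _ _ /word_word_eq.
Unshelve. all: by end_near. Qed.

Lemma rate_iter_le (I : finType) (X : T -> I) : mrv X ->
  rate m (iter N g) X <= N%:R * rate m g X.
Proof.
move=> mX; have mi := @measurable_iter _ _ _ mg N; have ii := invariant_iter.
rewrite -rate_iter//.
apply: (rate_det mi ii mD D0) => //; first exact: mrv_word.
by move=> w w' _ _ /word_eq /(_ 0%N); exact.
Qed.

Lemma entropy_iter : entropy m (iter N g) = (N%:R%:E * entropy m g)%E.
Proof.
have mi := @measurable_iter _ _ _ mg N; have ii := invariant_iter.
have NR0 : 0 < N%:R :> R by rewrite ltr0n.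
apply/eqP; rewrite eq_le; apply/andP; split.
  apply: (entropy_le mi ii mD D0) => k X mX.
  apply: (@le_trans _ _ (N%:R * rate m g X)%:E).
    by rewrite lee_fin rate_iter_le.
  rewrite EFinM; apply: lee_wpmul2l; first by rewrite lee_fin ltW.
  exact: (rate_le_entropy mg minv mD D0).
rewrite -lee_pdivlMl//; apply: (entropy_le mg minv mD D0) => k X mX.
rewrite lee_pdivlMl// -EFinM -rate_iter//.
apply: (rate_le_entropy mi ii mD D0); exact: mrv_word.
Qed.

End power.

(** * Induced systems *)

Lemma le_cvg0 (R : realType) (a b c : R) (u : R^nat) : u @ \oo --> 0 ->
  (\forall n \near \oo, a <= b + c * u n) -> a <= b.
Proof.
move=> u0 h; have h2 : (fun n => b + c * u n) @ \oo --> b.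
  rewrite -[X in _ --> X]addr0 -(mulr0 c).
  by apply: cvgD; [exact: cvg_cst|apply: cvgM => //; exact: cvg_cst].
have h1 : (fun=> a) @ \oo --> a by exact: cvg_cst.
exact: ler_cvg_to h1 h2 h.
Qed.

Lemma cvg0_ex (R : realType) (u : R^nat) (de : R) N : u @ \oo --> 0 -> 0 < de ->
  exists n, (N <= n)%N /\ u n < de.
Proof.
move=> /cvgrPdist_lt/[apply] -[n0 _ h]; exists (maxn N n0).
split; first exact: leq_maxl.
have := h (maxn N n0) (leq_maxr _ _); rewrite /= sub0r normrN.
exact: le_lt_trans (ler_norm _).
Qed.

Section first_return_theory.
Context (T : Type) (g : T -> T) (B : set T).

(** For a point [w] of [B], [avoid l (g w)] says that the return time of [w]
    is greater than [l]. *)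
Definition avoid l : set T := [set w | forall j, (j < l)%N -> ~ B (iter j g w)].

Lemma avoid0 : avoid 0 = setT.
Proof. by apply/seteqP; split. Qed.

Lemma avoidS l w : avoid l.+1 w <-> ~ B w /\ avoid l (g w).
Proof.
split=> [h|[h0 h] [|j] //]; last by rewrite ltnS iterSr; exact: h.
by split=> [|j jl]; [exact: (h 0%N)|rewrite -iterSr; exact: h].
Qed.

Lemma le_avoid l k : (k <= l)%N -> avoid l `<=` avoid k.
Proof. by move=> kl w h j jk; apply: h; exact: leq_trans kl. Qed.

Lemma not_avoid l w : ~ avoid l w ->
  exists k, [/\ (k < l)%N, avoid k w & B (iter k g w)].
Proof.
elim: l w => [|l IH] w; first by rewrite avoid0 => /(_ I).
move=> h; have [Bw|nBw] := pselect (B w).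
  by exists 0%N.
have [k [kl ak Bk]] : exists k, [/\ (k < l)%N, avoid k (g w) & B (iter k g (g w))].
  by apply: IH => h'; apply: h; apply/avoidS.
by exists k.+1; rewrite iterSr; split => //; apply/avoidS.
Qed.

Lemma first_return_timeE k w : avoid k (g w) -> B (iter k.+1 g w) ->
  first_return_time g B w = k.+1.
Proof.
move=> ak Bk; rewrite /first_return_time; case: xgetP => [l _ [l0 Bl al]|]; last first.
  move=> h; exfalso; apply: (h k.+1) => /=; split=> // -[|j] //.
  by rewrite ltnS iterSr => jk; exact: ak.
apply/eqP; rewrite eqn_leq; apply/andP; split; rewrite leqNgt; apply/negP => h.
  by apply: (al k.+1).
move: l l0 Bl al h => [//|l] _ Bl al; rewrite ltnS => h.
by apply: (ak l) => //; rewrite -iterSr.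
Qed.

Lemma first_return_time0 w : (forall k, avoid k (g w)) ->
  first_return_time g B w = 0%N.
Proof.
move=> ak; rewrite /first_return_time; case: xgetP => // -[|l] _ [l0 Bl al]//.
by exfalso; apply: (ak l.+1 l) => //; rewrite -iterSr.
Qed.

Lemma first_return_timeP w : (forall k, avoid k (g w)) \/
  exists k, avoid k (g w) /\ B (iter k.+1 g w).
Proof.
have [h|h] := pselect (forall k, avoid k (g w)).
  by left; exact: h.
right; move: h => /existsNP[l /not_avoid[k [_ ak Bk]]]; by exists k; rewrite iterSr.
Qed.

Lemma first_return_in w : B w -> B (first_return g B w).
Proof.
move=> Bw; rewrite /first_return.
have [/first_return_time0 ->//|[k [ak Bk]]] := first_return_timeP w.
by rewrite (first_return_timeE ak Bk).
Qed.

Lemma not_avoid_first_return l w : ~ avoid l (g w) -> exists k,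
  [/\ (k < l)%N, avoid k (g w), B (iter k g (g w)) &
      first_return g B w = iter k g (g w)].
Proof.
move=> /not_avoid[k [kl ak Bk]]; exists k; split => //.
have Bk' : B (iter k.+1 g w) by rewrite iterSr.
by rewrite /first_return (first_return_timeE ak Bk') iterSr.
Qed.

End first_return_theory.

Section induced_measure.
Context d (T : measurableType d) (R : realType) (m p : probability T R).
Variables (g : T -> T) (B : set T).
Hypotheses (mg : measurable_fun setT g) (minv : invariant_measure m g).
Hypotheses (mB : measurable B) (B0 : 0 < mass m B).
Hypothesis pE : forall C, measurable C -> mass p C = mass m (C `&` B) / mass m B.
Local Notation avoid := (avoid g B).
Hypothesis sweep : (fun l => mass m (avoid l)) @ \oo --> 0.
Local Notation S := (first_return g B).

Lemma measurable_pre C : measurable C -> measurable (g @^-1` C).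
Proof. by move=> mC; have := mg measurableT mC; rewrite setTI. Qed.

Lemma measurable_pre_iter n C : measurable C -> measurable (iter n g @^-1` C).
Proof.
by move=> mC; have := @measurable_iter _ _ _ mg n measurableT _ mC; rewrite setTI.
Qed.

Lemma measurable_avoid l : measurable (avoid l).
Proof.
elim: l => [|l IH]; first by rewrite avoid0.
rewrite (_ : avoid _ = ~` B `&` g @^-1` avoid l).
  by apply: measurableI; [exact: measurableC|exact: measurable_pre].
by apply/seteqP; split=> w /avoidS.
Qed.

Lemma massB_le C : measurable C -> mass p C <= mass m C / mass m B.
Proof.
move=> mC; rewrite pE// ler_wpM2r ?invr_ge0 ?mass_ge0//.
by apply: le_mass => //; exact: measurableI.
Qed.

Lemma mass_pB : mass p B = 1.
Proof. by rewrite pE// setIid divff// gt_eqF. Qed.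

Lemma mass_pBC : mass p (~` B) = 0.
Proof. by rewrite massC// mass_pB subrr. Qed.

Lemma measurable_first_return : measurable_fun setT S.
Proof.
move=> _ C mC; rewrite setTI.
rewrite (_ : S @^-1` C = ((\bigcap_l g @^-1` avoid l) `&` C) `|`
   \bigcup_k ((g @^-1` avoid k `&` iter k.+1 g @^-1` B) `&` iter k.+1 g @^-1` C)).
  apply: measurableU.
    apply: measurableI => //; apply: bigcapT_measurable => k.
    exact/measurable_pre/measurable_avoid.
  apply: bigcupT_measurable => k; apply: measurableI; last exact: measurable_pre_iter.
  apply: measurableI; last exact: measurable_pre_iter.
  exact/measurable_pre/measurable_avoid.
apply/seteqP; split=> w.
  have [h|[k [ak Bk]]] := first_return_timeP g B w.
    rewrite /= /first_return first_return_time0// => Cw; left; split=> // l _.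
    exact: h.
  rewrite /= /first_return (first_return_timeE ak Bk) => Ck; right.
  by exists k.
case=> [[h Cw]|[k _ [[ak Bk] Ck]]].
  by rewrite /= /first_return first_return_time0// => k; exact: (h k I).
by rewrite /= /first_return (first_return_timeE ak Bk).
Qed.

Lemma mass_eqU C C1 C2 : measurable C1 -> measurable C2 ->
  (forall w, C w <-> C1 w \/ C2 w) -> (forall w, C1 w -> ~ C2 w) ->
  mass m C = mass m C1 + mass m C2.
Proof.
move=> mC1 mC2 CE dis; rewrite -massU//.
  by congr mass; apply/seteqP; split=> w /CE.
by apply/eqP/seteqP; split=> // w [/dis].
Qed.

(** By invariance [avoid l] has the measure of its preimage, which is cut by
    [B]. The sum over [l] telescopes: the return time to [B] is integrable,
    which makes the truncation of long excursions harmless. *)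
Lemma mass_B_avoid l :
  mass m (B `&` g @^-1` avoid l) = mass m (avoid l) - mass m (avoid l.+1).
Proof.
have mA := measurable_avoid; apply/eqP; rewrite eq_sym subr_eq; apply/eqP.
rewrite -{1}(mass_inv minv (mA l)); apply: mass_eqU => //.
- by apply: measurableI => //; exact: measurable_pre.
- move=> w; split=> [h|[[]//|/avoidS[]//]].
  by have [Bw|nBw] := pselect (B w); [left|right; apply/avoidS].
- by move=> w [Bw _] /avoidS[].
Qed.

(** Among the points that do not visit [B] at the times 1, ..., [j], those of
    [B] give the [j]-th term; the others, pulled back once more, give the
    remainder of order [j + 1]. *)
Lemma kac_partial C L : measurable C ->
  mass m C = \sum_(0 <= j < L) mass m (B `&` g @^-1` avoid j `&` iter j g @^-1` C) +
   mass m (g @^-1` avoid L `&` iter L g @^-1` C).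
Proof.
move=> mC; have mA := measurable_avoid.
elim: L => [|L IH].
  rewrite big_geq// add0r avoid0; congr mass.
  by apply/seteqP; split=> w // -[].
rewrite {1}IH big_nat_recr//= -addrA; congr (_ + _).
have mL : measurable (avoid L.+1 `&` iter L g @^-1` C).
  by apply: measurableI => //; exact: measurable_pre_iter.
rewrite (_ : g @^-1` avoid L.+1 `&` _ =
  g @^-1` (avoid L.+1 `&` iter L g @^-1` C)); last first.
  by apply/seteqP; split=> w /=; rewrite -iterSr.
rewrite (mass_inv minv mL); apply: mass_eqU => //.
- apply: measurableI; last exact: measurable_pre_iter.
  by apply: measurableI => //; exact: measurable_pre.
- move=> w; split=> [[aw Cw]|[[[Bw aw] Cw]|[/avoidS[? ?] ?]]//].
  by have [Bw|nBw] := pselect (B w); [left|right; split => //; apply/avoidS].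
- by move=> w [[Bw _] _] [/avoidS[]].
Qed.

Lemma kac_cvg C : measurable C ->
  \sum_(0 <= j < L) mass m (B `&` g @^-1` avoid j `&` iter j g @^-1` C)
   @[L --> \oo] --> mass m C.
Proof.
move=> mC; have mA := measurable_avoid.
apply/cvgrPdist_le => e e0.
have /cvgrPdist_le/(_ e e0) := sweep; apply: filterS => L.
rewrite sub0r normrN (ger0_norm (mass_ge0 _ _)) => h.
rewrite {1}(kac_partial L mC) addrC addKr ger0_norm ?mass_ge0//.
apply: le_trans h; rewrite -(mass_inv minv (mA L)).
apply: le_mass => //; first apply: measurableI.
- exact: measurable_pre.
- exact: measurable_pre_iter.
- exact: measurable_pre.
Qed.

(** By the same telescoping: the preimage of [C] has a part in [B], which
    returns in one step, and a part out of [B], which is pulled back again. *)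
Let invariant_first_return_sub C : measurable C -> C `<=` B ->
  mass m (B `&` S @^-1` C) = mass m C.
Proof.
move=> mC CB; have mA := measurable_avoid.
have mSC : measurable (S @^-1` C).
  by have := measurable_first_return measurableT mC; rewrite setTI.
pose q l := mass m (avoid l `&` iter l g @^-1` C).
pose V l := B `&` S @^-1` C `&` ~` (g @^-1` avoid l).
have mV l : measurable (V l).
  apply: measurableI; first exact: measurableI.
  by apply/measurableC/measurable_pre.
have VE l : mass m (V l) + q l = mass m C.
  elim: l => [|l <-].
    rewrite (_ : V 0%N = set0) ?mass0 ?add0r; last first.
      by apply/seteqP; split=> // w [_]; rewrite avoid0 => /(_ I).
    congr mass; rewrite avoid0; by apply/seteqP; split=> w // -[].
  pose A := B `&` g @^-1` (avoid l `&` iter l g @^-1` C).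
  have mlC : measurable (avoid l `&` iter l g @^-1` C).
    by apply: measurableI => //; exact: measurable_pre_iter.
  have mAl : measurable A by apply: measurableI => //; exact: measurable_pre.
  have -> : mass m (V l.+1) = mass m (V l) + mass m A.
    apply: mass_eqU => // w; last by move=> [_ h] [_ []].
    split=> [[[Bw Sw] /= na]|[[[Bw Sw] na]|[Bw [aw Cw]]]].
    - have [al|nal] := pselect (avoid l (g w)); [right|by left].
      have [k [kl ak Bk Sk]] := not_avoid_first_return na.
      have kE : k = l.
        apply/eqP; rewrite eqn_leq -ltnS kl/= leqNgt; apply/negP => lk.
        exact: (al k).
      by split=> //; split => //=; move: Sw; rewrite /= Sk kE.
    - split=> //= al; apply: na; exact: le_avoid al.
    - have := CB _ Cw; rewrite /= -iterSr => Bl.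
      split; last by move=> /= al; exact: (al l (ltnSn l) (CB _ Cw)).
      by split => //=; rewrite /first_return (first_return_timeE aw Bl) iterSr.
  rewrite -addrA; congr (_ + _).
  rewrite /q -[RHS](mass_inv minv mlC); apply/esym; apply: mass_eqU => //.
  - by apply: measurableI => //; exact: measurable_pre_iter.
  - move=> w; split=> [[aw Cw]|[[Bw [aw Cw]]|[/avoidS[? ?]]]]//.
    + have [Bw|nBw] := pselect (B w); [by left|right].
      by split; [apply/avoidS|rewrite /= -iterS iterSr].
    + by rewrite /= -iterS iterSr; split.
  - by move=> w [Bw _] [/avoidS[]].
apply/eqP; rewrite -subr_eq0 -normr_le0.
apply: (le_cvg0 (c := 1) sweep); near=> l; rewrite add0r mul1r -(VE l).
have -> : mass m (B `&` S @^-1` C) =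
    mass m (V l) + mass m (B `&` S @^-1` C `&` g @^-1` avoid l).
  apply: mass_eqU => //.
  - apply: measurableI; first exact: measurableI.
    exact: measurable_pre.
  - move=> w; split=> [h|[[]|[]]]//.
    by have [al|nal] := pselect (avoid l (g w)); [right|left].
  - by move=> w [_ h] [_].
have le1 : q l <= mass m (avoid l).
  by apply: le_mass => //; apply: measurableI => //; exact: measurable_pre_iter.
have le2 : mass m (B `&` S @^-1` C `&` g @^-1` avoid l) <= mass m (avoid l).
  rewrite -(mass_inv minv (mA l)); apply: le_mass => //.
    apply: measurableI; first exact: measurableI.
    exact: measurable_pre.
  exact: measurable_pre.
have q0 : 0 <= q l by exact: mass_ge0.
have r0 := mass_ge0 m (B `&` S @^-1` C `&` g @^-1` avoid l).
rewrite ler_norml; apply/andP; split; lra.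
Unshelve. all: by end_near. Qed.

Lemma invariant_first_return : invariant_measure p S.
Proof.
move=> C mC.
have mSC C' : measurable C' -> measurable (S @^-1` C').
  by move=> mC'; have := measurable_first_return measurableT mC'; rewrite setTI.
rewrite !massE//; last exact: mSC.
rewrite !pE//; last exact: mSC.
congr (_ / _)%:E.
rewrite -[RHS]invariant_first_return_sub//; last exact: measurableI.
congr mass; apply/seteqP; split=> w /= [].
  by move=> Sw Bw; split => //; split => //; exact: first_return_in.
by move=> Bw [].
Qed.

End induced_measure.

(** * Entropy of induced systems *)

Section entry_name.
Context d (T : measurableType d) (g : T -> T) (B : set T).
Local Notation avoid := (avoid g B).

(** Values of a name of length at most [L]: the symbols in [I] read before the
    entry into [B], then a symbol in [J] if the entry occurs before the time
    [L]. *)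
Fixpoint entryT (I J : finType) (L : nat) : finType :=
  if L is L'.+1 then (J + I * entryT I J L')%type : finType else unit.

Fixpoint entry_name (I J : finType) (xi : T -> I) (zeta : T -> J) (L : nat)
    : T -> entryT I J L :=
  if L is L'.+1 return T -> entryT I J L then
    fun w => if w \in B then inl (zeta w) else inr (xi w, entry_name xi zeta L' (g w))
  else fun=> tt.

Fixpoint entry_open (I J : finType) L : entryT I J L -> bool :=
  if L is L'.+1 return entryT I J L -> bool then
    fun u => if u is inr v then entry_open v.2 else false
  else fun=> true.

Section names.
Context (I J : finType) (xi : T -> I) (zeta : T -> J).
Local Notation U := (entry_name xi zeta).

Lemma entry_openE L w : entry_open (U L w) = (w \in avoid L).
Proof.
elim: L w => [|L IH] w /=; first by rewrite avoid0 in_setT.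
have [wB|wB] := boolP (w \in B).
  by apply/esym/negbTE; rewrite notin_setE => /avoidS[/(_ (set_mem wB))].
rewrite IH; apply/idP/idP => /set_mem h; apply/mem_set.
  by apply/avoidS; split => //; move: wB; rewrite notin_setE.
by move/avoidS: h => [].
Qed.

Variant entry_nameS_spec L w w' : Prop :=
  | EntryIn of w \in B & w' \in B & zeta w = zeta w'
  | EntryOut of w \notin B & w' \notin B & xi w = xi w' &
      U L (g w) = U L (g w').

Lemma entry_nameSP L w w' : U L.+1 w = U L.+1 w' <-> entry_nameS_spec L w w'.
Proof.
split=> /=; last by case=> [-> -> ->//|/negPf -> /negPf -> -> ->].
case: ifPn => wB; case: ifPn => wB' // [].
  by left.
by right.
Qed.

Lemma entry_name_pred L w w' : U L.+1 w = U L.+1 w' -> U L w = U L w'.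
Proof.
elim: L w w' => // L IH w w' /entry_nameSP[? ? ?|? ? ? /IH ?]; apply/entry_nameSP.
  exact: EntryIn.
exact: EntryOut.
Qed.

Lemma entry_name_hit L w w' : U L w = U L w' -> ~ avoid L w -> exists k,
  [/\ (k < L)%N, avoid k w, B (iter k g w), avoid k w' & B (iter k g w')] /\
  zeta (iter k g w) = zeta (iter k g w').
Proof.
elim: L w w' => [|L IH] w w'; first by rewrite avoid0 => _ [].
move=> /entry_nameSP[wB wB' zE|wB wB' xE UE] nav.
  by exists 0%N; rewrite avoid0; split => //; split => //; exact: set_mem.
move: wB wB'; rewrite !notin_setE => wB wB'.
have [|k [[kL ak Bk ak' Bk'] zE]] := IH _ _ UE.
  by move=> av; apply: nav; apply/avoidS.
by exists k.+1; rewrite !iterSr; split => //; split => //; apply/avoidS.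
Qed.

(** What [U L.+1] adds to [U L]: a single symbol, and a constant one for the
    points that have already entered [B]. *)
Fixpoint entry_last L : T -> J + I :=
  if L is L'.+1 then
    fun w => if w \in B then inl (zeta point) else entry_last L' (g w)
  else fun w => if w \in B then inl (zeta w) else inr (xi w).

Lemma entry_last_closed L w : ~~ entry_open (U L w) -> entry_last L w = inl (zeta point).
Proof.
elim: L w => //= L IH w; case: ifPn => //= wB; exact: IH.
Qed.

Lemma entry_name_last L w w' : entry_last L w = entry_last L w' ->
  U L w = U L w' -> U L.+1 w = U L.+1 w'.
Proof.
elim: L w w' => [|L IH] w w'.
  move=> + _ => /=; case: ifPn => wB; case: ifPn => wB' // [] //.
    by move=> ->.
  by move=> ->.
move=> lE /entry_nameSP[wB wB' zE|wB wB' xE UE]; apply/entry_nameSP.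
  exact: EntryIn.
apply: EntryOut => //; apply: IH => //.
by move: lE; rewrite /= (negPf wB) (negPf wB').
Qed.

End names.

Lemma entry_name_word (I : finType) (xi : T -> I) M n L w w' :
  (n <= M)%N -> (n <= L)%N ->
  entry_name xi (word g xi M) L w = entry_name xi (word g xi M) L w' ->
  word g xi n w = word g xi n w'.
Proof.
elim: n L w w' => [|n IH] [|L] w w' //.
- by move=> _ _ _; apply/word_eq.
- by move=> _ _ _; apply/word_eq.
rewrite ltnS => nM nL /entry_nameSP[_ _|wB wB' xE UE].
  exact: word_le.
apply/word_consP; congr (_, _) => //; apply: IH UE => //.
exact: ltnW.
Qed.

Section retrace.
Context (I J : finType) (xi : T -> I) (zeta : T -> J).
Hypothesis xiB : det setT xi (fun w => w \in B).
Let unit_name := entry_name xi (fun=> tt).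

Lemma word_entry_name L w w' : word g xi L w = word g xi L w' ->
  unit_name L w = unit_name L w'.
Proof.
elim: L w w' => // L IH w w' /word_consP[xE /IH UE]; apply/entry_nameSP.
have wBE : (w \in B) = (w' \in B) by exact: xiB.
have [wB|wB] := boolP (w \in B).
  by apply: EntryIn; rewrite // -wBE.
by apply: EntryOut; rewrite // -wBE.
Qed.

(** The name that ends with [zeta] is recovered from the symbols read before
    the entry and the value of [zeta] at the point of entry. *)
Lemma entry_name_retrace L w w' : unit_name L w = unit_name L w' ->
  (forall k, (k < L)%N -> avoid k w -> B (iter k g w) -> avoid k w' ->
    B (iter k g w') -> zeta (iter k g w) = zeta (iter k g w')) ->
  entry_name xi zeta L w = entry_name xi zeta L w'.
Proof.
elim: L w w' => // L IH w w' /entry_nameSP[wB wB' _|wB wB' xE UE] h.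
  apply/entry_nameSP; apply: EntryIn => //; apply: (h 0%N) => //.
    exact: set_mem.
  exact: set_mem.
apply/entry_nameSP; apply: EntryOut => //.
apply: IH UE _ => k kL ak Bk ak' Bk'.
move: wB wB'; rewrite !notin_setE => wB wB'.
by rewrite -!iterSr; apply: (h k.+1) => //; rewrite ?iterSr//; apply/avoidS.
Qed.

End retrace.

Lemma mrv_entry_name (I J : finType) (xi : T -> I) (zeta : T -> J) L :
  measurable_fun setT g -> measurable B -> mrv xi -> mrv zeta ->
  mrv (entry_name xi zeta L).
Proof.
move=> mg mB mx mz; elim: L => [|L IH]; first exact: mrv_cst.
apply: mrv_if; first exact: mrv_in.
  exact: (mrv_comp (@inl J (I * entryT I J L)%type) mz).
apply: (mrv_comp (@inr J (I * entryT I J L)%type)).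
by apply: mrv_pair => //; exact: mrv_compr.
Qed.

Lemma mrv_entry_last (I J : finType) (xi : T -> I) (zeta : T -> J) L :
  measurable_fun setT g -> measurable B -> mrv xi -> mrv zeta ->
  mrv (entry_last xi zeta L).
Proof.
move=> mg mB mx mz; elim: L => [|L IH].
  apply: mrv_if; first exact: mrv_in.
    exact: (mrv_comp (@inl J I) mz).
  exact: (mrv_comp (@inr J I) mx).
apply: mrv_if; [exact: mrv_in|exact: mrv_cst|exact: mrv_compr].
Qed.

End entry_name.

Section induced_entropy.
Context d (T : measurableType d) (R : realType) (m p : probability T R).
Variables (g : T -> T) (B : set T).
Hypotheses (mg : measurable_fun setT g) (minv : invariant_measure m g).
Hypotheses (mB : measurable B) (B0 : 0 < mass m B).
Hypothesis pE : forall C, measurable C -> mass p C = mass m (C `&` B) / mass m B.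
Local Notation avoid := (avoid g B).
Hypothesis sweep : (fun l => mass m (avoid l)) @ \oo --> 0.
Local Notation S := (first_return g B).

Let massTC : mass m (~` setT) = 0.
Proof. by rewrite setCT mass0. Qed.
Let mS : measurable_fun setT S. Proof. exact: measurable_first_return. Qed.
Let Sinv : invariant_measure p S.
Proof. exact: (invariant_first_return mg minv mB pE sweep). Qed.
Let pB : mass p (~` B) = 0. Proof. exact: mass_pBC pE. Qed.

Let HD (I : finType) (C : set T) (X : T -> I) : R :=
  \sum_i phi (mass m (C `&` X @^-1` [set i])).

Let HD_split (I : finType) (X : T -> I) : mrv X ->
  det setT X (fun w => w \in B) -> rv_entropy m X = HD B X + HD (~` B) X.
Proof.
move=> mX XB; rewrite /HD -big_split/=; apply: eq_bigr => i _; rewrite /pr.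
have [[w [Xw Bw]]|h] := pselect (exists w, X w = i /\ B w).
  rewrite (_ : ~` B `&` _ = set0); last first.
    apply/seteqP; split=> // w' [nBw' Xw']; apply: nBw'; apply: set_mem.
    by rewrite (XB w' w) ?mem_set// Xw Xw'.
  rewrite mass0 phi0 addr0; congr (phi (mass m _)).
  apply/seteqP; split=> w' /= => [Xw'|[]//]; split => //; apply: set_mem.
  by rewrite (XB w' w) ?mem_set// Xw Xw'.
rewrite (_ : B `&` _ = set0); last first.
  by apply/seteqP; split=> // w [Bw Xw]; apply: h; exists w.
rewrite mass0 phi0 add0r; congr (phi (mass m _)).
apply/seteqP; split=> w' /= => [Xw'|[]//]; split => // Bw.
by apply: h; exists w'.
Qed.

Let HD_p (I : finType) (X : T -> I) : mrv X ->
  HD B X = mass m B * rv_entropy p X + phi (mass m B).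
Proof.
move=> mX; rewrite -[phi _]mul1r -(pr_sum1 p mX) mulr_suml mulr_sumr -big_split/=.
apply: eq_bigr => i _; rewrite -phiM ?mass_ge0//.
by rewrite /pr pE// mulrC divfK ?gt_eqF// setIC.
Qed.

Section star.
Context (I J : finType) (xi : T -> I) (zeta : T -> J).
Hypotheses (mx : mrv xi) (mz : mrv zeta).
Hypothesis xiB : det setT xi (fun w => w \in B).
Local Notation U := (entry_name g B xi zeta).
Local Notation V L := (fun w => (xi w, U L (g w))).

Let mU L : mrv (U L). Proof. exact: mrv_entry_name. Qed.
Let mV L : mrv (V L). Proof. by apply: mrv_pair => //; exact: mrv_compr. Qed.

(** Off [B], [U L.+1] and [V L] are the same variable; on [B], [U L.+1] is
    [zeta]. As [xi] tells [B] from its complement, the entropies split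
    accordingly. *)
Lemma CH_entry_name L : cond_entropy m xi (fun w => U L (g w)) =
  mass m B * (rv_entropy p (V L) - rv_entropy p zeta) +
  (rv_entropy m (U L.+1) - rv_entropy m (U L)).
Proof.
rewrite /cond_entropy (H_inv minv (@mU L)).
rewrite HD_split//; last by move=> w w' _ _ [/xiB ->].
have -> : rv_entropy m (U L.+1) = HD B zeta + HD (~` B) (V L).
  rewrite /rv_entropy big_sumType/=; congr (_ + _); apply: eq_bigr => i _;
    congr (phi (mass m _)); apply/seteqP; split=> w /=; case: ifPn => // wB.
  - by case=> ->; split => //; exact: set_mem.
  - by move=> [_ ->].
  - by move=> []; move/negP: wB => + Bw; rewrite mem_set.
  - by case=> <-; split => //; move: wB; rewrite notin_setE.
  - by move=> []; have := set_mem wB.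
  - by move=> [_ <-].
by rewrite HD_p// HD_p//; ring.
Qed.

Lemma H_entry_name_ge0 L : 0 <= rv_entropy m (U L.+1) - rv_entropy m (U L).
Proof.
rewrite subr_ge0; apply: (H_det measurableT massTC) => //.
by move=> w w' _ _; exact: entry_name_pred.
Qed.

Lemma H_entry_name_le L :
  rv_entropy m (U L.+1) - rv_entropy m (U L) <= mass m (avoid L) * ln (#|{: J + I}|)%:R.
Proof.
have mN := mrv_entry_last L mg mB mx mz.
apply: (@le_trans _ _ (cond_entropy m (entry_last g B xi zeta L) (U L))); last first.
  rewrite (_ : avoid L = [set w | entry_open (U L w)]); last first.
    apply/seteqP; split=> w /=; rewrite entry_openE.
      exact: mem_set.
    exact: set_mem.
  apply: (@CH_le_cond _ _ _ _ _ _ _ _ (@entry_open I J L) (inl (zeta point))) => //.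
  exact: entry_last_closed.
rewrite /cond_entropy lerD2r; apply: (H_det measurableT massTC) => //.
  exact: mrv_pair.
by move=> w w' _ _ []; exact: entry_name_last.
Qed.

End star.

Lemma mass_p_avoid_cvg : (fun l => mass p (g @^-1` avoid l)) @ \oo --> 0.
Proof.
have h : (fun l => mass m (avoid l) * (mass m B)^-1) @ \oo --> 0.
  by rewrite -(mul0r (mass m B)^-1); apply: cvgM => //; exact: cvg_cst.
apply: (squeeze_cvgr _ (cvg_cst 0) h); near=> l.
have mA := measurable_avoid mg mB l.
rewrite mass_ge0/= (le_trans (massB_le mB pE (measurable_pre mg mA)))//.
by rewrite mass_inv.
Unshelve. all: by end_near. Qed.

Let mA l : measurable (avoid l). Proof. exact: measurable_avoid. Qed.

(** With [zeta] a [g]-word of length [M], the name [U L] determines the [g]-word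
    of length [M] at its starting point, so the left-hand side of
    [CH_entry_name] is at most [inc m g xi M]. On [B], [V L] determines [zeta],
    and also its value at the next return unless the latter is late. *)
Lemma induced_rate_le (I0 : finType) (P : T -> I0) : mrv P ->
  mass m B * rate p S P <= rate m g (fun w => (w \in B, P w)).
Proof.
move=> mP; pose xi w := (w \in B, P w).
have mx : mrv xi by apply: mrv_pair => //; exact: mrv_in.
have xiB : det setT xi (fun w => w \in B) by move=> w w' _ _ [].
suff main M : (0 < M)%N -> mass m B * rate p S P <= inc m g xi M.
  apply: (le_rate mg measurableT massTC) => //.
  near=> M; apply: main; near: M; exact: nbhs_infty_gt.
move=> M0; pose zeta := word g xi M.
have mz : mrv zeta by exact: mrv_word.
apply/ler_addgt0Pr => e e0.
have [de de0 fano] := @CH_fano_small _ _ _ p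
  #|{: {ffun 'I_M -> bool * I0} * {ffun 'I_M -> bool * I0}}| _ (divr_gt0 e0 B0).
have [L [ML Lde]] : exists L, (M <= L)%N /\ mass p (g @^-1` avoid L) < de.
  exact: (cvg0_ex M mass_p_avoid_cvg de0).
pose V w := (xi w, entry_name g B xi zeta L (g w)).
have mU l : mrv (entry_name g B xi zeta l) by exact: mrv_entry_name.
have mV : mrv V by apply: mrv_pair => //; exact: mrv_compr.
have mzS : mrv (fun w => zeta (S w)) by exact: mrv_compr.
have s1 : rate p S P <= cond_entropy p zeta (fun w => zeta (S w)).
  apply: (@le_trans _ _ (rate p S zeta)).
    apply: (rate_det mS Sinv mB pB) => // w w' _ _.
    by move=> /word_eq/(_ 0%N M0) [].
  apply: (le_trans (rate_le_inc mS mB pB 1 mz)).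
  apply: (CH_le_r mB pB) => //; first exact: mrv_wordg.
  by move=> w w' _ _ /word_eq/(_ 0%N isT).
have s2 : rv_entropy p (fun w => (zeta w, zeta (S w))) <= rv_entropy p V + e / mass m B.
  apply: (@le_trans _ _ (rv_entropy p V + cond_entropy p (fun w => (zeta w, zeta (S w))) V)).
    rewrite /cond_entropy addrC subrK; apply: (H_det mB pB) => //.
    - exact: mrv_pair.
    - by apply: mrv_pair => //; exact: mrv_pair.
    - by move=> w w' _ _ [] -> ->.
  rewrite lerD2l ltW//.
  have mG : measurable (B `&` ~` (g @^-1` avoid L)).
    by apply: measurableI => //; apply/measurableC/measurable_pre.
  apply: (fano _ _ _ _ (B `&` ~` (g @^-1` avoid L))) => //.
  - exact: mrv_pair.
  - move=> w w' [Bw nw] [Bw' nw'] [xBE xPE UE]; congr (_, _).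
      move: M0 ML UE; rewrite /zeta; case: (M) => // M' _ M'L UE.
      apply/word_consP; congr ((_, _), _) => //.
      by apply: (entry_name_word _ _ UE); rewrite // ltnW.
    have [k [kL ak Bk SE]] := not_avoid_first_return nw.
    have [k' [[k'L ak' Bk' ak2' Bk2'] zE]] := entry_name_hit UE nw.
    have SE1 : S w = iter k' g (g w).
      have Bk1 : B (iter k'.+1 g w) by rewrite iterSr.
      by rewrite /first_return (first_return_timeE ak' Bk1) iterSr.
    have SE2 : S w' = iter k' g (g w').
      have Bk1 : B (iter k'.+1 g w') by rewrite iterSr.
      by rewrite /first_return (first_return_timeE ak2' Bk1) iterSr.
    by rewrite SE1 SE2.
  - rewrite setCI setCK; apply: le_lt_trans Lde.
    rewrite -[leRHS]add0r -pB; apply: massUle; first exact: measurableC.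
    exact: measurable_pre.
have s3 : cond_entropy m xi (fun w => entry_name g B xi zeta L (g w)) <= inc m g xi M.
  apply: (CH_le_r measurableT massTC) => //.
  - exact: mrv_compr.
  - exact: mrv_wordg.
  - by move=> w w' _ _; apply: entry_name_word.
have s4 := H_entry_name_ge0 mx mz L.
have s5 := CH_entry_name mx mz xiB L.
have s6 : rv_entropy p (fun w => zeta (S w)) = rv_entropy p zeta by exact: H_inv.
apply: (@le_trans _ _ (mass m B * (rv_entropy p V - rv_entropy p zeta + e / mass m B))).
  rewrite ler_wpM2l ?mass_ge0//; apply: (le_trans s1).
  rewrite /cond_entropy s6; lra.
rewrite mulrDr mulrCA divff ?gt_eqF// mulr1 lerD2r.
apply: le_trans s3; rewrite s5; rewrite -/V lerDl; exact: s4.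
Unshelve. all: by end_near. Qed.

Section upper.
Context (I0 : finType) (P : T -> I0).
Hypothesis mP : mrv P.
Let xi w := (w \in B, P w).
Let mx : mrv xi. Proof. by apply: mrv_pair => //; exact: mrv_in. Qed.
Let xiB : det setT xi (fun w => w \in B). Proof. by move=> w w' _ _ []. Qed.

(** The excursion from a point of [B], read for at most [K] steps. *)
Let Q K w := (xi w, entry_name g B xi (fun=> tt) K (g w)).
Let mU0 K : mrv (entry_name g B xi (fun=> tt) K).
Proof. by apply: mrv_entry_name => //; exact: mrv_cst. Qed.
Let mQ K : mrv (Q K).
Proof. by apply: mrv_pair => //; exact: mrv_compr. Qed.

Let c := ln (#|{: unit + (bool * I0)}|)%:R : R.

Let c_ge0 : 0 <= c.
Proof. by rewrite ln_ge0// ler1n card_sum card_unit. Qed.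

(** Lengthening the truncation by one step adds one symbol, on the set where the
    return is later; [mass_B_avoid] sums these contributions. *)
Let tail K L : (K <= L)%N ->
  mass m B * cond_entropy p (Q L) (Q K) <= (mass m (avoid K) - mass m (avoid L)) * c.
Proof.
elim: L => [|L IH]; rewrite leq_eqVlt => /orP[/eqP ->|].
- by rewrite (CH0_det mB pB)// ?mulr0 ?subrr ?mul0r// => w w' _ _.
- by [].
- by rewrite (CH0_det mB pB)// ?mulr0 ?subrr ?mul0r// => w w' _ _.
rewrite ltnS => KL; have mN := mrv_entry_last L mg mB mx (@mrv_cst _ T unit tt).
have mNg : mrv (fun w => entry_last g B xi (fun=> tt) L (g w)) by exact: mrv_compr.
have h1 : mass m B * cond_entropy p (Q L.+1) (Q L) <=
    (mass m (avoid L) - mass m (avoid L.+1)) * c.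
  rewrite -(mass_B_avoid mg minv mB) -ler_pdivlMl// mulrA.
  apply: (@le_trans _ _ (cond_entropy p (fun w => entry_last g B xi (fun=> tt) L (g w)) (Q L))).
    apply: (CH_le_l mB pB) => // w w' _ _ [lE xE1 xE2 UE].
    by congr ((_, _), _) => //; exact: entry_name_last.
  have := @CH_le_cond _ _ _ p _ _ (fun w => entry_last g B xi (fun=> tt) L (g w))
     (Q L) (fun q => entry_open q.2) (inl tt) mNg (@mQ L).
  rewrite (_ : [set w | _] = g @^-1` avoid L); last first.
    apply/seteqP; split=> w /=; rewrite entry_openE.
      exact: set_mem.
    exact: mem_set.
  rewrite pE; last exact: measurable_pre.
  rewrite setIC [_ / _]mulrC; apply => w; exact: entry_last_closed.
have h2 := IH KL.
have h3 := CH_triangle mB pB (@mQ L.+1) (@mQ L) (@mQ K).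
have := ler_wpM2l (mass_ge0 m B) h3; rewrite mulrDr; lra.
Qed.

(** Adding the name [U L] to the process makes it self-contained: [U L] at time
    0 is determined by [xi] at time 0 and the process up to the next return,
    which is rarely late.
    Indeed a word of excursions is its first excursion followed by the word at
    the return, which is the end of the name read there. *)
Let rate_le_CH_entry K k L : (0 < L)%N ->
  rate m g xi <= cond_entropy m xi (fun w => entry_name g B xi (word S (Q K) k) L (g w)).
Proof.
case: L => // L _; pose zeta := word S (Q K) k.
have mz : mrv zeta by exact: mrv_word.
pose U := entry_name g B xi zeta L.+1.
have mU : mrv U by exact: mrv_entry_name.
have mUg : mrv (fun w => U (g w)) by exact: mrv_compr.
apply/ler_addgt0Pr => e e0.
pose Y w := (U w, xi w); have mY : mrv Y by exact: mrv_pair.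
have [de de0 fano] := @CH_fano_small _ _ _ m #|{: entryT (bool * I0)%type
  {ffun 'I_k -> (bool * I0) * entryT (bool * I0)%type unit K} L.+1}| _ e0.
have [n [Kn n0 nde]] : exists n, [/\ (K <= n)%N, (0 < n)%N & mass m (g @^-1` avoid n) < de].
  have [n [nK nde]] := cvg0_ex (maxn K 1) sweep de0.
  exists n; split; [exact: leq_trans (leq_maxl _ _) nK|
    exact: leq_trans (leq_maxr _ _) nK|by rewrite mass_inv].
apply: (@le_trans _ _ (rate m g Y)).
  apply: (rate_det mg minv measurableT massTC) => // w w' _ _ [_ wE PE].
  by rewrite /xi wE PE.
apply: (le_trans (rate_le_inc mg measurableT massTC n mY)).
rewrite /inc (CH_chain measurableT massTC)//; last exact: mrv_wordg.
have mW : mrv (fun w => (xi w, word g Y n (g w))).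
  by apply: mrv_pair => //; exact: mrv_wordg.
apply: lerD.
  apply: (CH_le_r measurableT massTC) => //; first exact: mrv_wordg.
  by move=> w w' _ _ /word_eq/(_ 0%N n0)[].
apply/ltW/(fano _ _ _ _ (~` (B `&` g @^-1` avoid n))) => //.
- by apply/measurableC/measurableI => //; exact: measurable_pre.
- move=> w w' Gw Gw' [wBE PE /word_eq WE].
  have xE : xi w = xi w' by congr (_, _).
  have WX : word g xi n.+1 w = word g xi n.+1 w'.
    apply/word_consP; congr (_, _) => //; apply/word_eq => i /WE [].
    by move=> _ wE PiE; rewrite /xi wE PiE.
  have UgE : U (g w) = U (g w') by have [] := WE 0%N n0.
  apply/entry_nameSP; have [wB|wB] := boolP (w \in B); last first.
    apply: EntryOut; rewrite // -?wBE//.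
    exact: entry_name_pred.
  apply: EntryIn; rewrite // -?wBE//.
  have wB' : w' \in B by rewrite -wBE.
  have nw : ~ avoid n (g w) by move=> h; apply: Gw; split => //; exact: set_mem.
  have UE : entry_name g B xi (fun=> tt) n (g w) = entry_name g B xi (fun=> tt) n (g w').
    apply: (word_entry_name xiB).
    by have [] := (word_consP _ _ _ _ _).1 WX.
  have [i [[iL ai Bi ai' Bi'] _]] := entry_name_hit UE nw.
  have Bi1 : B (iter i.+1 g w) by rewrite iterSr.
  have Bi1' : B (iter i.+1 g w') by rewrite iterSr.
  have SE1 : S w = iter i g (g w).
    by rewrite /first_return (first_return_timeE ai Bi1) iterSr.
  have SE2 : S w' = iter i g (g w').
    by rewrite /first_return (first_return_timeE ai' Bi1') iterSr.
  have zS : zeta (S w) = zeta (S w').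
    have [+ _ _] := WE i iL; rewrite -SE1 -SE2 => /entry_nameSP[//|].
    by rewrite SE1 mem_set.
  apply/word_eq => -[_|j jk].
    rewrite /Q/=; congr (_, _) => //; apply: (word_entry_name xiB).
    have [_ _] := (word_consP _ _ _ _ _).1 WX.
    exact: word_le.
  by rewrite !iterSr; move/word_eq : zS; apply; exact: ltnW.
- rewrite setCK; apply: le_lt_trans nde; apply: le_mass => //.
    by apply: measurableI => //; exact: measurable_pre.
  exact: measurable_pre.
Qed.

(** On [B], the name [V L] is determined by the excursion up to the time [L] and
    [zeta] at the return, which leaves the increment of the process [Q K]
    under the first return map, up to the truncation error. *)
Let upper_bound K k L : (K <= L)%N -> (0 < L)%N ->
  rate m g xi <= mass m B * inc p S (Q K) k + mass m (avoid K) * c +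
    mass m (avoid L) * ln
    #|{: {ffun 'I_k -> (bool * I0) * entryT (bool * I0)%type unit K} + (bool * I0)}|%:R.
Proof.
move=> KL L0; apply: (le_trans (rate_le_CH_entry K k L0)).
set zeta := word S (Q K) k.
have mz : mrv zeta by exact: mrv_word.
have mzS : mrv (fun w => zeta (S w)) by exact: mrv_compr.
rewrite CH_entry_name//; apply: lerD; last exact: H_entry_name_le.
set V := fun w => (xi w, entry_name g B xi zeta L (g w)).
have mV : mrv V.
  by apply: mrv_pair => //; apply: mrv_compr => //; exact: mrv_entry_name.
have s1 : rv_entropy p V <= rv_entropy p (fun w => (Q L w, zeta (S w))).
  apply: (H_det mB pB) => //; first exact: mrv_pair.
  move=> w w' _ _ [wBE PE UE zS]; congr ((_, _), _) => //.
  apply: (entry_name_retrace UE) => i iL ai Bi ai' Bi'.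
  have Bi1 : B (iter i.+1 g w) by rewrite iterSr.
  have Bi1' : B (iter i.+1 g w') by rewrite iterSr.
  have SE1 : S w = iter i g (g w).
    by rewrite /first_return (first_return_timeE ai Bi1) iterSr.
  have SE2 : S w' = iter i g (g w').
    by rewrite /first_return (first_return_timeE ai' Bi1') iterSr.
  by rewrite -SE1 -SE2.
have s2 : rv_entropy p (fun w => zeta (S w)) = rv_entropy p zeta by exact: H_inv.
have s3 := CH_triangle mB pB (@mQ L) (@mQ K) mzS.
have s4 : mass m B * cond_entropy p (Q L) (Q K) <= mass m (avoid K) * c.
  apply: (le_trans (tail KL)); rewrite ler_wpM2r// gerBl; exact: mass_ge0.
apply: (@le_trans _ _ (mass m B * cond_entropy p (Q L) (fun w => zeta (S w)))).
  by rewrite ler_wpM2l ?mass_ge0// /cond_entropy s2 lerD2r.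
have := ler_wpM2l (mass_ge0 m B) s3; rewrite mulrDr /inc -/zeta; lra.
Qed.

Lemma rate_le_induced : ((rate m g P)%:E <= (mass m B)%:E * entropy p S)%E.
Proof.
apply: (@le_trans _ _ (rate m g xi)%:E).
  rewrite lee_fin; apply: (rate_det mg minv measurableT massTC) => //.
  by move=> w w' _ _ [].
have [->|hfin] := eqVneq (entropy p S) +oo%E.
  by rewrite gt0_muley ?leey// lte_fin.
have hK K : ((rate p S (Q K))%:E <= entropy p S)%E.
  exact: (rate_le_entropy mS Sinv mB pB).
have : (0 <= entropy p S)%E.
  by apply: le_trans (hK 0%N); rewrite lee_fin; exact: (rate_ge0 mS mB pB).
move: hK hfin; case: (entropy p S) => // h hK _ _.
rewrite -EFinM lee_fin.
apply: (le_cvg0 (c := c) sweep); near=> K.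
have h1 k : rate m g xi <= mass m B * inc p S (Q K) k + mass m (avoid K) * c.
  pose a := #|{: {ffun 'I_k -> (bool * I0) * entryT (bool * I0)%type unit K} + (bool * I0)}|.
  apply: (le_cvg0 (c := ln a%:R) sweep); near=> L.
  rewrite [_ * mass m (avoid L)]mulrC; apply: upper_bound; near: L.
    exact: nbhs_infty_ge.
  exact: nbhs_infty_gt.
have h2 : (fun k => mass m B * inc p S (Q K) k + mass m (avoid K) * c) @ \oo -->
    mass m B * rate p S (Q K) + mass m (avoid K) * c.
  apply: cvgD; last exact: cvg_cst.
  apply: cvgM; [exact: cvg_cst|exact: (cvg_inc mS mB pB)].
apply: (@le_trans _ _ (mass m B * rate p S (Q K) + mass m (avoid K) * c)).
  apply: (ler_cvg_to (cvg_cst _) h2); near=> k; exact: h1.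
by rewrite [c * _]mulrC lerD2r ler_wpM2l ?mass_ge0// -lee_fin hK.
Unshelve. all: by end_near. Qed.

End upper.

(** Abramov's formula for induced endomorphisms. *)
Theorem entropy_first_return :
  entropy m g = ((mass m B)%:E * entropy p S)%E.
Proof.
apply/eqP; rewrite eq_le; apply/andP; split.
  by apply: (entropy_le mg minv measurableT massTC) => k X; exact: rate_le_induced.
rewrite -lee_pdivlMl//; apply: (entropy_le mS Sinv mB pB) => k X mX.
rewrite lee_pdivlMl// -EFinM; apply: (@le_trans _ _ (rate m g (fun w => (w \in B, X w)))%:E).
  by rewrite lee_fin induced_rate_le.
apply: (rate_le_entropy mg minv measurableT massTC); apply: mrv_pair => //.
exact: mrv_in.
Qed.

End induced_entropy.

(** * Factors, recurrence and Kac's lemma *)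

Section normalization.
Context d (T : measurableType d) (R : realType).

Lemma normalized_restriction_probability (m : {measure set T -> \bar R})
    (B : set T) : measurable B -> (0 < m B < +oo)%E ->
  exists p : probability T R,
    (p : set T -> \bar R) = normalized_restriction m B.
Proof.
move=> mB /andP[B0 Boo].
have Bfin : m B \is a fin_num by rewrite ge0_fin_numE.
exists (mnormalize (mrestr m mB) (dirac point)).
have E : mrestr m mB setT = m B by rewrite /mrestr setTI.
apply/funext => C.
transitivity ((if (m B == 0%E) || (m B == +oo%E) then [eta dirac point]
     else fun U => (m (U `&` B) * ((fine (m B))^-1)%:E)%E) C).
  by rewrite -[m B]E.
rewrite (gt_eqF B0) (lt_eqF Boo) /= /normalized_restriction.
by rewrite -{2}(fineK Bfin) inver gt_eqF// fine_gt0// B0.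
Qed.

Lemma mass_normalized_restriction (m p : probability T R) (B C : set T) :
  (p : set T -> \bar R) = normalized_restriction m B ->
  measurable B -> 0 < mass m B -> measurable C ->
  mass p C = mass m (C `&` B) / mass m B.
Proof.
move=> pE mB B0 mC.
transitivity (fine (normalized_restriction m B C)); first by rewrite -pE.
transitivity (fine ((mass m (C `&` B))%:E / (mass m B)%:E)%E).
  by rewrite -!massE//; exact: measurableI.
by rewrite inver gt_eqF.
Qed.

(** The time-one map of the flow and the power of a shorter time map agree only
    on the suspension space. *)
Lemma entropy_eq_on (m : probability T R) (g g' : T -> T) (D : set T) :
  measurable_fun setT g -> measurable_fun setT g' ->
  measurable D -> mass m (~` D) = 0 ->
  (forall w, D w -> D (g w)) -> (forall w, D w -> g w = g' w) ->
  entropy m g = entropy m g'.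
Proof.
move=> mg mg' mD D0 gD gg'.
have iE n w : D w -> iter n g w = iter n g' w /\ D (iter n g w).
  move=> Dw; elim: n => //= n [<- Dn]; split; last exact: gD.
  exact: gg'.
congr ereal_sup; apply/seteqP.
suff pE k (P : 'I_k -> set T) : measurable_partition P ->
    partition_entropy m g P = partition_entropy m g' P.
  by split=> _ [k [P [mP ->]]]; exists k, P; rewrite pE.
move=> [mP _ _]; congr (limn _); apply/funext => n; congr (- _ / _).
apply: eq_bigr => u _.
have matom h : measurable_fun setT h -> measurable (join_atom h P u).
  move=> mh; apply: fin_bigcap_measurable; first exact: finite_finset.
  by move=> i _; apply: (measurable_pre_iter mh); exact: mP.
suff -> : fine (m (join_atom g P u)) = fine (m (join_atom g' P u)) by [].
rewrite -/(mass m _) -/(mass m (join_atom g' P u)).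
rewrite (mass_split m mD (matom g mg)) (mass_split m mD (matom g' mg')).
have E0 C : measurable C -> mass m (C `&` ~` D) = 0.
  move=> mC; apply/eqP; rewrite eq_le mass_ge0 andbT -D0.
  apply: le_mass; [|exact: measurableC|by apply: subIsetr].
  by apply: measurableI => //; exact: measurableC.
rewrite !E0; [|exact: matom..]; congr (mass m _ + _).
by apply/seteqP; split=> w [h Dw]; split=> // i _; have := h i I;
  rewrite /= (iE i w Dw).1.
Qed.

End normalization.

Section factor.
Context d1 (T1 : measurableType d1) d2 (T2 : measurableType d2) (R : realType).
Variables (p : probability T1 R) (q : probability T2 R).
Variables (S : T1 -> T1) (g : T2 -> T2) (pi : T1 -> T2) (D : set T1).
Hypotheses (mS : measurable_fun setT S) (Sinv : invariant_measure p S).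
Hypotheses (mg : measurable_fun setT g) (ginv : invariant_measure q g).
Hypotheses (mpi : measurable_fun setT pi)
  (piE : forall C, measurable C -> mass p (pi @^-1` C) = mass q C).
Hypotheses (mD : measurable D) (D0 : mass p (~` D) = 0).
Hypotheses (SD : forall w, D w -> D (S w)).
Hypothesis piS : forall w, D w -> pi (S w) = g (pi w).

Lemma factor_iter n w : D w -> pi (iter n S w) = iter n g (pi w).
Proof.
move=> Dw; suff : pi (iter n S w) = iter n g (pi w) /\ D (iter n S w) by case.
by elim: n => //= n [<- Dn]; split; [exact: piS|exact: SD].
Qed.

Lemma mrv_factor (I : finType) (X : T2 -> I) : mrv X -> mrv (fun w => X (pi w)).
Proof.
move=> mX i; rewrite -[X in measurable X]setTI.
exact: (mpi measurableT (mX i)).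
Qed.

Lemma rate_factor (I : finType) (X : T2 -> I) : mrv X ->
  rate p S (fun w => X (pi w)) = rate q g X.
Proof.
move=> mX; have mXp := mrv_factor mX.
have HE n : rv_entropy p (word S (fun w => X (pi w)) n) = rv_entropy q (word g X n).
  transitivity (rv_entropy p (fun w => word g X n (pi w))); last first.
    by apply: eq_bigr => i _; rewrite /pr -piE//; exact: mrv_word.
  have detp : det D (word S (fun w => X (pi w)) n) (fun w => word g X n (pi w)).
    move=> w w' Dw Dw' /word_eq h; apply/word_eq => i ilt.
    by rewrite -!factor_iter// h.
  have detp' : det D (fun w => word g X n (pi w)) (word S (fun w => X (pi w)) n).
    move=> w w' Dw Dw' /word_eq h; apply/word_eq => i ilt.
    by rewrite !factor_iter// h.
  apply: (H_eq_det mD D0) => //; first exact: mrv_word.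
  exact/mrv_factor/mrv_word.
have T0 : mass q (~` setT) = 0 by rewrite setCT mass0.
congr (limn _); apply/funext => n.
by rewrite (incE mS Sinv mD D0)// (incE mg ginv measurableT T0)// !HE.
Qed.

End factor.

Section ergodic_sweep.
Context d (T : measurableType d) (R : realType) (mu : probability T R).
Variables (f : T -> T) (A : set T).
Hypotheses (mf : measurable_fun setT f) (finv : invariant_measure mu f).
Hypothesis ferg : ergodic_measure mu f.
Hypotheses (mA : measurable A) (A0 : 0 < mass mu A).

(** The set of the points that enter [A] infinitely often is invariant, and its
    measure is at least that of [A], as a decreasing limit of sets that
    contain a preimage of [A]. *)
Lemma ergodic_sweep : mu (\bigcap_l avoid f A l) = 0%E.
Proof.
pose W n := \bigcup_(k in [set k | (n <= k)%N]) iter k f @^-1` A.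
have mW n : measurable (W n).
  by apply: bigcup_measurable => k _; exact: measurable_pre_iter.
pose V := \bigcap_n W n.
have mV : measurable V by exact: bigcapT_measurable.
have Vinv : f @^-1` V = V.
  apply/seteqP; split=> w Vw n _.
    have [k /= nk Ak] := Vw n I; exists k.+1; first exact: leqW.
    by rewrite /= -iterS iterSr.
  have [[//|k] /= nk Ak] := Vw n.+1 I; exists k => //=.
  by rewrite -iterSr.
have mVA : measurable (\bigcap_l avoid f A l).
  by apply: bigcapT_measurable => l; exact: measurable_avoid.
have [V0|V1] := ferg mV Vinv.
  have W0 := mass_cvg0 mW _ V0.
  exfalso; have [|n [_]] := cvg0_ex 0 (W0 _) A0.
    move=> k l kl; apply/subsetPset => w [j /= lj Aj].
    by exists j => //=; exact: leq_trans lj.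
  apply/negP; rewrite -leNgt -(mass_inv_iter mf finv n mA).
  apply: le_mass => //; first exact: measurable_pre_iter.
  by move=> w Aw; exists n => /=.
rewrite massE//; congr EFin; apply/eqP; rewrite eq_le mass_ge0 andbT.
have <- : mass mu (~` V) = 0 by rewrite massC// /mass V1 subrr.
apply: le_mass => //; first exact: measurableC.
by move=> w aw Vw; have [k _ Ak] := Vw 0%N I; exact: (aw k.+1 I k).
Qed.

Lemma avoid_noninc : nonincreasing_seq (avoid f A).
Proof. by move=> k l kl; apply/subsetPset; exact: le_avoid. Qed.

Lemma ergodic_sweep_cvg : (fun l => mass mu (avoid f A l)) @ \oo --> 0.
Proof.
apply: mass_cvg0 ergodic_sweep; last exact: avoid_noninc.
by move=> l; exact: measurable_avoid.
Qed.

End ergodic_sweep.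

Section kac_integral.
Context d (T : measurableType d) (R : realType) (mu : probability T R).
Variables (f : T -> T) (A : set T).
Hypotheses (mf : measurable_fun setT f) (finv : invariant_measure mu f).
Hypotheses (mA : measurable A).
Hypothesis sweep : (fun l => mass mu (avoid f A l)) @ \oo --> 0.
Let D j := A `&` f @^-1` avoid f A j.
Let mD j : measurable (D j).
Proof. by apply: measurableI => //; apply/measurable_pre/measurable_avoid. Qed.

(** The sum is the integral of [h] against the sum of the images of the
    restrictions of [mu] to the sets [D j], which [kac_cvg] identifies with
    [mu]. *)
Lemma kac_integral (h : T -> \bar R) : measurable_fun setT h ->
  (forall x, (0 <= h x)%E) ->
  (\int[mu]_x h x = \sum_(0 <= j <oo) \int[mu]_(x in D j) h (iter j f x))%E.
Proof.
move=> mh h0.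
have mi j : measurable_fun setT (iter j f) by exact: measurable_iter.
pose nu j : {measure set T -> \bar R} :=
  measure_function_pushforward__canonical__measure_function_Measure
    (mrestr mu (mD j)) (mi j).
transitivity (\int[mseries nu 0]_x h x)%E.
  apply: eq_measure_integral => C mC _; rewrite /mseries.
  apply/esym/cvg_lim => //.
  rewrite (_ : (fun n => _) = EFin \o (fun L => \sum_(0 <= j < L)
      mass mu (D j `&` iter j f @^-1` C))).
    suff : (EFin \o (fun L => \sum_(0 <= j < L)
      mass mu (D j `&` iter j f @^-1` C))) @ \oo --> (mass mu C)%:E.
      by rewrite -massE.
    apply: cvg_EFin; first by near=> L.
    exact: kac_cvg.
  apply/funext => L /=; rewrite -sumEFin; apply: eq_bigr => j _.
  rewrite setIC; apply: massE.
  by apply: measurableI => //; exact: measurable_pre_iter.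
rewrite ge0_integral_measure_series//; apply: eq_eseriesr => j _.
rewrite /nu/= ge0_integral_pushforward//.
have mhj : measurable_fun setT (fun x => h (iter j f x)).
  exact: measurableT_comp.
rewrite preimage_setT -(setUv (D j)) ge0_integral_setU//=; last 3 first.
- exact: measurableC.
- by rewrite setUv; exact: mhj.
- exact/disj_setPCl.
rewrite [X in (_ + X)%E](_ : _ = 0%E) ?adde0.
  apply: eq_measure_integral => C mC CD; rewrite /mrestr.
  by congr (mu _); apply/setIidPl.
rewrite -(integral_measure_zero (~` D j) (h \o iter j f)).
apply: eq_measure_integral => C mC CD.
have CD0 : C `&` D j = set0 by exact/disjoints_subset.
transitivity (mu (C `&` D j)); first by [].
by rewrite CD0 measure0.
Unshelve. all: by end_near. Qed.

End kac_integral.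

(** * Mean return time to a cross-section *)

Section suspension_orbits.
Context (R : realType) (T : Type) (f : T -> T) (tau : T -> R).
Variable c : R.
Hypotheses (c0 : 0 < c) (ctau : forall x, c <= tau x).
Local Notation bsum := (birkhoff_sum f tau).

Let roof : roof_function tau. Proof. by exists c. Qed.

Lemma birkhoff_sum0 x : bsum 0 x = 0.
Proof. by rewrite /birkhoff_sum big_ord0. Qed.

Lemma birkhoff_sum_recr k x : bsum k.+1 x = bsum k x + tau (iter k f x).
Proof. by rewrite /birkhoff_sum big_ord_recr. Qed.

Lemma birkhoff_sumD k l x : bsum (k + l) x = bsum k x + bsum l (iter k f x).
Proof.
elim: l => [|l IH]; first by rewrite addn0 birkhoff_sum0 addr0.
by rewrite addnS !birkhoff_sum_recr IH -iterD addrA addnC.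
Qed.

Lemma birkhoff_sum_gap k x : bsum k x + c <= bsum k.+1 x.
Proof. by rewrite birkhoff_sum_recr lerD2l. Qed.

Lemma birkhoff_sum_lb k x : k%:R * c <= bsum k x.
Proof.
elim: k => [|k IH]; first by rewrite mul0r birkhoff_sum0.
by rewrite -natr1 mulrDl mul1r birkhoff_sum_recr lerD.
Qed.

Lemma birkhoff_sum_le k l x : (k <= l)%N -> bsum k x <= bsum l x.
Proof. exact: le_birkhoff_sum. Qed.

Lemma birkhoff_sum_lt k l x : (k < l)%N -> bsum k x < bsum l x.
Proof.
move=> kl; apply: lt_le_trans (birkhoff_sum_le x kl).
by rewrite birkhoff_sum_recr ltrDl (lt_le_trans c0).
Qed.

Lemma birkhoff_sum_ge0 k x : 0 <= bsum k x.
Proof. by rewrite -(birkhoff_sum0 x); exact: birkhoff_sum_le. Qed.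

Lemma susp_flowE k s x t : bsum k x <= t + s < bsum k.+1 x ->
  susp_flow f tau s (x, t) = (iter k f x, t + s - bsum k x).
Proof. by move=> h; rewrite /susp_flow (@susp_indexP _ _ _ _ roof s (x, t) k h). Qed.

Lemma susp_flow_ex s x t : 0 <= t + s ->
  exists k, bsum k x <= t + s < bsum k.+1 x.
Proof. exact: (@susp_index_ex _ _ f _ roof s (x, t)). Qed.

Lemma susp_flowD s u x t : 0 <= t + s -> 0 <= u ->
  susp_flow f tau u (susp_flow f tau s (x, t)) = susp_flow f tau (s + u) (x, t).
Proof.
move=> ts0 u0; have [k kP] := susp_flow_ex x ts0; rewrite (susp_flowE kP).
move: kP => /andP[k1 k2].
have [|l /andP[l1 l2]] := @susp_flow_ex u (iter k f x) (t + s - bsum k x).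
  by rewrite addr_ge0// subr_ge0.
rewrite (@susp_flowE l); last by rewrite l1.
rewrite (@susp_flowE (k + l)); last first.
  by rewrite -addnS !birkhoff_sumD; apply/andP; split; lra.
by rewrite birkhoff_sumD -iterD addnC; congr (_, _); ring.
Qed.

Variable A : set T.

Lemma susp_hit s x : 0 < s -> @cross_section R T A (susp_flow f tau s (x, 0)) <->
  exists k, [/\ (0 < k)%N, s = bsum k x & A (iter k f x)].
Proof.
move=> s0; split.
  have [|k kP] := @susp_flow_ex s x 0; first by rewrite add0r ltW.
  rewrite (susp_flowE kP) => -[/= Ak /= /eqP]; rewrite add0r subr_eq0 => /eqP sE.
  exists k; split => //; rewrite lt0n; apply/eqP => k0.
  by move: s0; rewrite sE k0 birkhoff_sum0 ltxx.
move=> [k [k0 sE Ak]]; rewrite (@susp_flowE k); last first.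
  by rewrite add0r sE lexx/= birkhoff_sum_lt.
by split => //=; rewrite sE add0r subrr.
Qed.

(** The flow leaves the section at once, the roof being bounded below. *)
Lemma escape_cross_section x : escape_time f tau (@cross_section R T A) (x, 0) = 0%E.
Proof.
apply/eqP; rewrite eq_le; apply/andP; split; last first.
  by apply: le_ereal_inf_tmp => _ [s [s0 _] <-]; rewrite lee_fin ltW.
apply/lee_addgt0Pr => e e0; rewrite add0e.
pose s := Num.min e (c / 2).
have s0 : 0 < s by rewrite lt_min e0 divr_gt0.
have sc : s < c.
  by rewrite gt_min; apply/orP; right; rewrite ltr_pdivrMr// ltr_pMr// ltr1n.
apply: (@le_trans _ _ s%:E); last by rewrite lee_fin ge_min lexx.
apply: ereal_inf_lbound; exists s => //; split => //.
rewrite (@susp_flowE 0); last first.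
  rewrite birkhoff_sum_recr birkhoff_sum0 !add0r ltW//= (lt_le_trans sc)//.
by rewrite birkhoff_sum0 add0r subr0 => -[_ /= /eqP]; rewrite gt_eqF.
Qed.

(** Both sides are infinite for a point that never returns: the left one as the
    infimum of the empty set, the right one because the terms are bounded
    below. *)
Lemma hitting_cross_section x : hitting_time f tau (@cross_section R T A) (x, 0) =
  (\sum_(0 <= j <oo) (if pselect (avoid f A j (f x)) then tau (iter j f x) else 0)%:E)%E.
Proof.
rewrite /hitting_time escape_cross_section.
set a := fun j => (if pselect (avoid f A j (f x)) then tau (iter j f x) else 0).
have aE j : avoid f A j (f x) -> a j = tau (iter j f x).
  by rewrite /a; case: pselect.
have [h|[k [ak Ak]]] := first_return_timeP f A x.
  rewrite (_ : [set _ | _ in _] = set0); last first.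
    apply/seteqP; split=> // y [s [s0 hs] _]; rewrite lte_fin in s0.
    have [k [k0 _ Ak]] := (susp_hit _ s0).1 hs; case: k k0 Ak => // k _ Ak.
    by apply: (h k.+1 k) => //; rewrite -iterSr.
  rewrite ereal_inf0; apply/esym/eq_infty => r.
  pose n := (Num.truncn (`|r| / c)).+1.
  apply: (@le_trans _ _ (bsum n x)%:E).
    rewrite lee_fin (le_trans (ler_norm _))//; apply: le_trans (birkhoff_sum_lb n x).
    by rewrite -ler_pdivrMr// ltW// truncnS_gt.
  apply: (@le_trans _ _ (\sum_(0 <= j < n) (a j)%:E)%E); last first.
    apply: nneseries_lim_ge => j _ _.
    by rewrite lee_fin aE// ltW// (lt_le_trans c0).
  rewrite sumEFin lee_fin /birkhoff_sum big_mkord le_eqVlt; apply/orP; left.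
  by apply/eqP; apply: eq_bigr => j _; rewrite aE.
have sumE n : (k < n)%N -> \sum_(0 <= j < n) a j = bsum k.+1 x.
  move=> kn; rewrite (big_cat_nat _ kn)//= [X in _ + X]big_nat_cond [X in _ + X]big1.
    rewrite addr0 /birkhoff_sum big_mkord; apply: eq_bigr => j _.
    by rewrite aE//; apply: le_avoid ak; rewrite -ltnS.
  move=> j /andP[/andP[kj _] _]; rewrite /a; case: pselect => // aj.
  by exfalso; apply: (aj k kj); rewrite -iterSr.
transitivity (bsum k.+1 x)%:E; last first.
  apply/esym/cvg_lim => //; apply: cvg_near_cst; near=> n.
  rewrite sumEFin sumE//; near: n; exact: nbhs_infty_gt.
apply/eqP; rewrite eq_le; apply/andP; split.
  apply: ereal_inf_lbound; exists (bsum k.+1 x) => //=.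
  have b0 : 0 < bsum k.+1 x by rewrite -(birkhoff_sum0 x) birkhoff_sum_lt.
  by split; [rewrite lte_fin|apply/susp_hit => //; exists k.+1].
apply: le_ereal_inf_tmp => _ [s [s0 hs] <-]; rewrite lte_fin in s0.
have [l [l0 -> Al]] := (susp_hit _ s0).1 hs; case: l l0 Al => // l _ Al.
rewrite lee_fin birkhoff_sum_le//.
rewrite ltnS leqNgt; apply/negP => lk.
by apply: (ak l lk); rewrite -iterSr.
Unshelve. all: by end_near. Qed.

End suspension_orbits.

Section mean_return_time.
Context d (T : measurableType d) (R : realType) (mu : probability T R).
Variables (f : T -> T) (A : set T) (tau : T -> R) (c : R).
Hypotheses (mf : measurable_fun setT f) (finv : invariant_measure mu f).
Hypotheses (mA : measurable A) (A0 : 0 < mass mu A).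
Hypothesis sweep : (fun l => mass mu (avoid f A l)) @ \oo --> 0.
Hypotheses (mtau : measurable_fun setT tau).
Hypotheses (c0 : 0 < c) (ctau : forall x, (c <= tau x)%R).

Lemma mean_return_time :
  (\int[normalized_restriction mu A]_(x in A)
     hitting_time f tau (cross_section A) (x, 0%R) =
   (mu A)^-1 * \int[mu]_x (tau x)%:E)%E.
Proof.
have tau0 x : 0 <= tau x by exact: le_trans (ltW c0) (ctau x).
have muA : mu A = (mass mu A)%:E by exact: massE.
have muA_fin : (0 < mu A < +oo)%E by rewrite muA lte_fin A0 ltey.
have [p pE] := @normalized_restriction_probability _ _ _ mu A mA muA_fin.
have k0 : 0 <= (mass mu A)^-1 by rewrite invr_ge0 mass_ge0.
have E1 (h : T -> \bar R) : measurable_fun A h -> (forall x, A x -> 0 <= h x)%E ->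
    (\int[p]_(x in A) h x = (mu A)^-1 * \int[mu]_(x in A) h x)%E.
  move=> mh h0.
  rewrite (@eq_measure_integral _ _ _ A (mscale (NngNum k0) mu)); last first.
    move=> C mC CA; transitivity (normalized_restriction mu A C).
      by rewrite -pE.
    rewrite /normalized_restriction /mscale/=.
    by rewrite (setIidl CA) muA inver gt_eqF// muleC.
  by rewrite ge0_integral_mscale//= muA inver gt_eqF.
pose a j (x : T) := (if pselect (avoid f A j (f x)) then tau (iter j f x) else 0)%:E.
have a0 j x : (0 <= a j x)%E by rewrite /a lee_fin; case: pselect => h //; exact: tau0.
have mi j : measurable_fun setT (fun x => (tau (iter j f x))%:E).
  apply/measurable_EFinP; apply: measurableT_comp => //; exact: measurable_iter.
have mD j : measurable (f @^-1` avoid f A j).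
  by apply/measurable_pre/measurable_avoid.
have aE j : a j = (fun x => (tau (iter j f x))%:E) \_ (f @^-1` avoid f A j).
  apply/funext => x; rewrite /a /patch; case: pselect => h.
    by rewrite mem_set.
  by rewrite memNset.
have ma j : measurable_fun setT (a j).
  rewrite aE; apply/(measurable_restrict _ _ _) => //.
  by rewrite setTI; exact: measurable_funTS.
have hE x : hitting_time f tau (cross_section A) (x, 0%R) = (\sum_(0 <= j <oo) a j x)%E.
  exact: (hitting_cross_section f c0 ctau).
rewrite -pE; transitivity (\int[p]_(x in A) (\sum_(0 <= j <oo) a j x))%E.
  by apply: eq_integral => x _; exact: hE.
rewrite E1; last 2 first.
- apply: (@ge0_emeasurable_sum _ _ _ A (fun j x => a j x) xpredT) => //.
  by move=> j _; exact: measurable_funTS.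
- by move=> x _; apply: nneseries_ge0.
congr (_ * _)%E; rewrite integral_nneseries//; last first.
  by move=> j; exact: measurable_funTS.
rewrite (kac_integral mf finv mA sweep (h := fun x => (tau x)%:E)); last 2 first.
- exact/measurable_EFinP.
- by move=> x; rewrite lee_fin.
by apply: eq_eseriesr => j _; rewrite integral_mkcondr aE.
Qed.

End mean_return_time.

(** * The suspension flow as a measure-preserving system *)

Section lebesgue_shift.
Context (R : realType).

Lemma measurable_shift (a : R) :
  measurable_fun setT (fun x : measurableTypeR R => x + a : measurableTypeR R).
Proof. exact: measurable_funD. Qed.

Lemma lebesgue_shift (a : R) (E : set (measurableTypeR R)) : measurable E ->
  lebesgue_measure ((fun x => x + a) @^-1` E) = lebesgue_measure E.
Proof.
move=> mE; pose nu : {measure set (measurableTypeR R) -> \bar R} :=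
  measure_function_pushforward__canonical__measure_function_Measure
    (@lebesgue_measure R) (measurable_shift a).
apply/esym; apply: (@lebesgue_measure_unique R nu) => // _ [[u v] /= uv <-].
rewrite /nu /= /pushforward.
rewrite (_ : _ @^-1` _ = `]u - a, v - a]%classic).
  rewrite !lebesgue_measure_itv/= !lte_fin ltrD2r; case: ifP => // _.
  by rewrite -!EFinB; congr (_%:E); ring.
by apply/seteqP; split=> x /=; rewrite !in_itv/= ltrBlDr lerBrDr.
Qed.

End lebesgue_shift.

Section measurable_tools.
Context d (T : measurableType d) (R : realType).

Lemma measurable_set_bool (b : T -> bool) :
  measurable_fun setT b -> measurable [set x | b x].
Proof.
move=> mb; rewrite (_ : [set x | b x] = setT `&` b @^-1` [set true]).
  exact: mb.
by rewrite setTI.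
Qed.

Lemma measurable_set_le (h k : T -> measurableTypeR R) :
  measurable_fun setT h -> measurable_fun setT k -> measurable [set x | h x <= k x].
Proof. by move=> mh mk; apply/measurable_set_bool/measurable_fun_ler. Qed.

Lemma measurable_set_lt (h k : T -> measurableTypeR R) :
  measurable_fun setT h -> measurable_fun setT k -> measurable [set x | h x < k x].
Proof. by move=> mh mk; apply/measurable_set_bool/measurable_fun_ltr. Qed.

Lemma integral_invariant (mu : probability T R) (f : T -> T) (h : T -> \bar R) :
  measurable_fun setT f -> invariant_measure mu f ->
  measurable_fun setT h -> (forall x, (0 <= h x)%E) ->
  (\int[mu]_x h (f x) = \int[mu]_x h x)%E.
Proof.
move=> mf finv mh h0.
pose nu : {measure set T -> \bar R} :=
  measure_function_pushforward__canonical__measure_function_Measure mu mf.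
transitivity (\int[nu]_x h x)%E.
  by rewrite /nu/= ge0_integral_pushforward.
by apply: eq_measure_integral => C mC _; exact: finv.
Qed.

End measurable_tools.

Section suspension_system.
Context d (T : measurableType d) (R : realType) (mu : probability T R).
Variables (f : T -> T) (tau : T -> R) (c : R).
Hypotheses (mf : measurable_fun setT f) (finv : invariant_measure mu f).
Hypotheses (mtau : measurable_fun setT (tau : T -> measurableTypeR R)).
Hypotheses (c0 : 0 < c) (ctau : forall x, c <= tau x).
Local Notation P := (T * measurableTypeR R)%type.
Local Notation bsum := (birkhoff_sum f tau).
Local Notation X := (susp_flow f tau).
Local Notation Om := (susp_space tau : set P).

Lemma measurable_birkhoff_sum k :
  measurable_fun setT (bsum k : T -> measurableTypeR R).
Proof.
elim: k => [|k IH].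
  by rewrite (_ : bsum 0 = cst 0)//; apply/funext => x; rewrite birkhoff_sum0.
rewrite (_ : bsum k.+1 = (fun x => bsum k x + tau (iter k f x))); last first.
  by apply/funext => x; rewrite birkhoff_sum_recr.
apply: measurable_funD => //; apply: measurableT_comp => //; exact: measurable_iter.
Qed.

Let mfst (U : T -> measurableTypeR R) : measurable_fun setT U ->
  measurable_fun setT (fun p : P => U p.1 : measurableTypeR R).
Proof. by move=> mU; apply: measurableT_comp => //; exact: measurable_fst. Qed.

Let msnd a : measurable_fun setT (fun p : P => p.2 + a : measurableTypeR R).
Proof.
apply: (measurableT_comp (measurable_shift a)); exact: measurable_snd.
Qed.

Lemma measurable_susp_space : measurable Om.
Proof.
rewrite (_ : Om = [set p : P | 0 <= p.2 + 0] `&` [set p : P | p.2 + 0 < tau p.1]).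
  apply: measurableI.
    by apply: (@measurable_set_le _ P R (cst 0)).
  by apply: (@measurable_set_lt _ P R) => //; exact: mfst.
by apply/seteqP; split=> -[x t]; rewrite /susp_space /= addr0 => /andP.
Qed.

(** On each of the countably many sets where the number of crossings of the roof
    is constant the flow is a measurable formula. At the points with
    [p.2 + s < 0] that number is 0, by default. *)
Lemma measurable_susp_flow s : measurable_fun setT (X s : P -> P).
Proof.
pose Xk k (p : P) : P := (iter k f p.1, p.2 + (s - bsum k p.1)).
have mXk k : measurable_fun setT (Xk k).
  apply: measurable_fun_pair.
    by apply: measurableT_comp; [exact: measurable_iter|exact: measurable_fst].
  apply: (@measurable_funD _ P R _ (fun p => p.2)); first exact: measurable_snd.
  apply: (@mfst (fun x => s - bsum k x)); apply: measurable_funB => //.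
  exact: measurable_birkhoff_sum.
pose I k : set P := [set p : P | bsum k p.1 <= p.2 + s] `&`
                    [set p : P | p.2 + s < bsum k.+1 p.1].
have mI k : measurable (I k).
  apply: measurableI.
    apply: (@measurable_set_le _ P R) => //; apply: mfst.
    exact: measurable_birkhoff_sum.
  apply: (@measurable_set_lt _ P R) => //; apply: mfst.
  exact: measurable_birkhoff_sum.
pose N : set P := [set p : P | p.2 + s < 0].
have mN : measurable N by apply: (@measurable_set_lt _ P R _ (cst 0)).
move=> _ C mC; rewrite setTI.
have mXC k : measurable (Xk k @^-1` C).
  by rewrite -[X in measurable X]setTI; exact: mXk.
rewrite (_ : X s @^-1` C = (N `&` Xk 0%N @^-1` C) `|`
    \bigcup_k (I k `&` Xk k @^-1` C)).
  apply: measurableU; first exact: measurableI.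
  by apply: bigcupT_measurable => k; exact: measurableI.
have XE x t k : I k (x, t) -> X s (x, t) = Xk k (x, t).
  by move=> [k1 k2]; rewrite (susp_flowE c0 ctau (k := k)) ?k1// /Xk addrA.
have XN x t : N (x, t) -> X s (x, t) = Xk 0%N (x, t).
  rewrite /N/= => ts0; rewrite /susp_flow /susp_index; case: xgetP => [k _|_].
    move=> /= /andP[k1 _]; exfalso; move: ts0.
    by rewrite ltNge (le_trans _ k1)// (birkhoff_sum_ge0 f c0 ctau).
  by rewrite /Xk/= addrA.
apply/seteqP; split=> -[x t] /=.
  have [ts0 Cx|ts0 Cx] := ltP (t + s) 0.
    by left; split => //; rewrite -XN.
  right; have [k /andP[k1 k2]] := susp_flow_ex f c0 ctau x ts0.
  by exists k => //; split; [split|rewrite /= -XE].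
by case=> [[h]|[k _ [h]]] /=; [rewrite XN|rewrite (XE x t k)].
Qed.

(** The product measure; its restriction to the suspension space is the flow
    invariant measure before normalization. *)
Definition under_measure : {measure set P -> \bar R} := (mu \x @lebesgue_measure R)%E.

Lemma under_measureX (U : set T) (V : set (measurableTypeR R)) :
  measurable U -> measurable V ->
  under_measure (U `*` V) = (mu U * lebesgue_measure V)%E.
Proof. exact: product_measure1E. Qed.

Lemma under_measure_Om : under_measure Om = (\int[mu]_x (tau x)%:E)%E.
Proof.
apply: eq_integral => x _ /=; rewrite (_ : xsection Om x = `[0, tau x[%classic).
  rewrite lebesgue_measure_itv/= lte_fin (lt_le_trans c0)//.
  by rewrite -EFinB subr0.
by apply/seteqP; split=> t; rewrite /xsection/= in_itv/= inE.
Qed.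

Variable t0 : R.
Hypotheses (t00 : 0 < t0) (t0c : t0 <= c).

(** The flow pushes the slice of the last [t0] units of time before the roof
    onto the slice of the first [t0] units of time over the base, and moves
    the rest upwards. *)
Lemma under_measure_inv C : measurable C ->
  under_measure (X t0 @^-1` C `&` Om) = under_measure (C `&` Om).
Proof.
move=> mC.
pose G0 : set P := C `&` ([set p : P | 0 <= p.2 + 0] `&` [set p : P | p.2 + 0 < t0]).
pose G1 : set P := C `&` ([set p : P | t0 <= p.2 + 0] `&` [set p : P | p.2 + 0 < tau p.1]).
have mG0 : measurable G0.
  apply: measurableI => //; apply: measurableI.
    by apply: (@measurable_set_le _ P R (cst 0)).
  by apply: (@measurable_set_lt _ P R _ (cst t0)).
have mG1 : measurable G1.
  apply: measurableI => //; apply: measurableI.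
    by apply: (@measurable_set_le _ P R (cst t0)).
  by apply: (@measurable_set_lt _ P R) => //; exact: mfst.
have ms (G : set P) (x : T) : measurable G -> measurable (xsection G x : set (measurableTypeR R)).
  by move=> mG; exact: measurable_xsection.
have mF (G : set P) : measurable G ->
    measurable_fun setT (fun x => lebesgue_measure (xsection G x)).
  by move=> mG; exact: measurable_fun_xsection.
have ctau0 x : t0 <= tau x by exact: le_trans (ctau x).
transitivity (\int[mu]_x (lebesgue_measure (xsection G0 x) + lebesgue_measure (xsection G1 x)))%E.
  rewrite ge0_integralD//; [|exact: mF..].
  rewrite -(integral_invariant mf finv (mF _ mG0))// -ge0_integralD//; last 2 first.
  - exact: (measurableT_comp (mF _ mG0) mf).
  - exact: mF.
  apply: eq_integral => x _ /=.
  have -> : xsection (X t0 @^-1` C `&` Om) x =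
      (fun t => t + (t0 - tau x)) @^-1` xsection G0 (f x) `|`
      (fun t => t + t0) @^-1` xsection G1 x.
    apply/seteqP; split=> t; rewrite /xsection/= !inE.
      move=> [Ct /andP[/= t_ge0 ttau]].
      have [h|h] := ltP (t + t0) (tau x).
        right; split; last by split=> /=; rewrite ?addr0 ?lerDr.
        move: Ct; rewrite /= (@susp_flowE _ _ f tau c c0 ctau 0).
          by rewrite birkhoff_sum0 subr0.
        by rewrite birkhoff_sum_recr birkhoff_sum0 add0r h addr_ge0// ltW.
      left; split; last by split=> /=; lra.
      move: Ct; rewrite /= (@susp_flowE _ _ f tau c c0 ctau 1).
        by rewrite birkhoff_sum_recr birkhoff_sum0 add0r addrA.
      have := ctau0 (f x); rewrite !birkhoff_sum_recr birkhoff_sum0/=; have := t00; lra.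
    have := ctau0 x; have := ctau0 (f x) => h1 h2.
    case=> -[Ct [/= t1 t2]].
      have t_0 : 0 <= t by lra.
      split; last by rewrite /susp_space/= t_0/=; lra.
      rewrite /= (@susp_flowE _ _ f tau c c0 ctau 1).
        by rewrite birkhoff_sum_recr birkhoff_sum0 add0r -addrA.
      by rewrite !birkhoff_sum_recr birkhoff_sum0/=; have := t00; lra.
    have t_0 : 0 <= t by lra.
    split; last by rewrite /susp_space/= t_0/=; have := t00; lra.
    rewrite /= (@susp_flowE _ _ f tau c c0 ctau 0).
      by rewrite birkhoff_sum0 subr0.
    by rewrite !birkhoff_sum_recr birkhoff_sum0/=; have := t00; lra.
  rewrite measureU//=; last 3 first.
  - by rewrite -[X in measurable X]setTI; apply: measurable_shift => //; exact: ms.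
  - by rewrite -[X in measurable X]setTI; apply: measurable_shift => //; exact: ms.
  - apply/seteqP; split=> // t; rewrite /xsection/= !inE.
    by move=> -[[_ [/= ? ?]] [_ [/= ? ?]]]; lra.
  by rewrite !lebesgue_shift//; exact: ms.
apply: eq_integral => x _ /=.
have -> : xsection (C `&` Om) x = xsection G0 x `|` xsection G1 x.
  have := ctau0 x => h; apply/seteqP; split=> t; rewrite /xsection/= !inE.
    move=> [Ct /andP[/= t_0 tt]].
    have [h'|h'] := ltP t t0; [left|right]; split => //; split => /=; lra.
  by move=> [|] [Ct [/= ? ?]]; split => //; rewrite /susp_space/=; have := t00; lra.
rewrite measureU//=; [exact: ms|exact: ms|].
apply/seteqP; split=> // t; rewrite /xsection/= !inE.
by move=> -[[_ [/= ? ?]] [_ [/= ? ?]]]; lra.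
Qed.

End suspension_system.

(** * Extensions by rotations *)

Section truncation.
Context (R : realType).

Lemma truncn_divn (x : R) M : (0 < M)%N ->
  (Num.truncn (x * M%:R) %/ M)%N = Num.truncn x.
Proof.
move=> M0; have MR0 : 0 < M%:R :> R by rewrite ltr0n.
have [x0|x0] := ltP x 0.
  have neg (y : R) : y < 0 -> Num.truncn y = 0%N.
    move=> y0; apply/eqP; rewrite -leqn0 truncn_le_nat (lt_trans y0)//.
  by rewrite !neg ?div0n// pmulr_llt0.
have xM0 : 0 <= x * M%:R by rewrite mulr_ge0// ltW.
apply/eqP; rewrite eqn_leq; apply/andP; split.
  rewrite -ltnS ltn_divLR// truncn_lt_nat// natrM ltr_pM2r//.
  exact: truncnS_gt.
rewrite leq_divRL// truncn_ge_nat// natrM ler_pM2r//.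
by rewrite truncn_le.
Qed.

Lemma mrv_truncn d (T : measurableType d) (I : finType) (h : T -> measurableTypeR R)
    (b : nat -> I) : measurable_fun setT h ->
  mrv (fun w => b (Num.truncn (h w))).
Proof.
move=> mh i.
have mlt n : measurable [set w | (Num.truncn (h w) <= n)%N].
  rewrite (_ : [set w | _] = [set w | h w < n.+1%:R]).
    by apply: (@measurable_set_lt _ T R _ (cst n.+1%:R)).
  by apply/seteqP; split=> w /=; rewrite truncn_le_nat.
have meq n : measurable [set w | Num.truncn (h w) = n].
  case: n => [|n].
    rewrite (_ : [set w | _] = [set w | (Num.truncn (h w) <= 0)%N]) //.
    by apply/seteqP; split=> w /=; rewrite leqn0 => /eqP.
  rewrite (_ : [set w | _] = [set w | (Num.truncn (h w) <= n.+1)%N] `&`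
    ~` [set w | (Num.truncn (h w) <= n)%N]).
    by apply: measurableI => //; exact: measurableC.
  apply/seteqP; split=> w /=; first by move=> ->; rewrite leqnn ltnn.
  move=> [h1 /negP]; rewrite -ltnNge => h2.
  by apply/eqP; rewrite eqn_leq h1.
rewrite (_ : _ @^-1` _ = \bigcup_(n in [set n | b n = i])
    [set w | Num.truncn (h w) = n]).
  by apply: bigcup_measurable => n _; exact: meq.
by apply/seteqP; split=> w /=; [exists (Num.truncn (h w))|case=> n <- /= ->].
Qed.

(** Integer part of a rotation. On a circle of [K * M] cells, [u] is the cell of
    a point, [W] the integer part of the angle, and [ui] the cell of the
    rotated point, so that [ui] is [u - W] or [u - W - 1] modulo [K * M]. These
    lie in the same block of [M] cells unless [M] divides [u - W]. *)
Lemma rotation_cell K M u ui W j : (0 < K)%N -> (0 < M)%N ->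
  (u < K * M)%N -> (ui < K * M)%N ->
  (u + j * (K * M) = ui + W \/ u + j * (K * M) = (ui + W).+1)%N ->
  u != W %[mod M] ->
  (ui %/ M = ((u + (K * M - W %% (K * M))) %% (K * M)) %/ M)%N.
Proof.
move=> K0 M0; set N := (K * M)%N => uN uiN jE uW.
have N0 : (0 < N)%N by rewrite muln_gt0 K0.
set v := ((u + _) %% N)%N.
have vN : (v < N)%N by rewrite ltn_mod.
have vW : (v + W = u %[mod N])%N.
  rewrite /v modnDml -modnDmr -addnA subnK ?modnDr//.
  by rewrite ltnW// ltn_mod.
have MN : (M %| N)%N by rewrite dvdn_mull.
have vM : (v %% M != 0)%N.
  apply: contra uW => /eqP v0.
  have : ((v + W) %% N %% M = u %% N %% M)%N by rewrite vW.
  by rewrite !modn_dvdm// -modnDml v0 add0n => ->.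
have cancel a b : (a + W = b + W %[mod N])%N -> (a < N)%N -> (b < N)%N -> a = b.
  by move=> /eqP; rewrite eqn_modDr => /eqP + aN bN; rewrite !modn_small.
have uE : (u + j * N = u %[mod N])%N by rewrite addnC modnMDl.
case: jE => jE.
  by rewrite (cancel ui v)//; rewrite vW -uE jE.
have uiS : (ui.+1 + W = v + W %[mod N])%N by rewrite vW -uE jE addSn.
have [uilt|uige] := ltnP ui.+1 N.
  have uv := cancel _ _ uiS uilt vN.
  by rewrite -uv divnS// /dvdn uv (negPf vM).
have uiE : ui.+1 = N by apply/eqP; rewrite eqn_leq uiN.
have v0 : v = 0%N.
  apply: cancel => //; rewrite -uiS uiE add0n.
  by rewrite -{1}[N]mul1n modnMDl.
by rewrite v0 mod0n eqxx in vM.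
Qed.

End truncation.

Section rotation_extension.
Context d (T : measurableType d) (R : realType).
Local Notation P := (T * measurableTypeR R)%type.
Variables (q : probability T R) (p : probability P R).
Variables (g : T -> T) (S : P -> P) (A : set T) (t0 : R) (r : T -> R).
Hypotheses (mg : measurable_fun setT g) (ginv : invariant_measure q g).
Hypotheses (mS : measurable_fun setT S) (Sinv : invariant_measure p S).
Hypotheses (mA : measurable A) (qA : mass q A = 1) (t00 : 0 < t0).
Let B : set P := A `*` `[0, t0[%classic.
Hypotheses (SB : forall w, B w -> B (S w))
  (S1 : forall w, B w -> (S w).1 = g w.1)
  (S2 : forall w, B w -> exists j : nat, (S w).2 = w.2 - r w.1 + j%:R * t0).
Hypotheses (mr : measurable_fun setT (r : T -> measurableTypeR R))
  (r0 : forall x, 0 <= r x).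
Hypothesis pprod : forall (U : set T) (V : set (measurableTypeR R)),
  measurable U -> measurable V -> mass p (U `*` V) =
  mass q U * (fine (lebesgue_measure (V `&` `[0, t0[%classic)) / t0).

Let mB : measurable B.
Proof. exact: measurableX. Qed.

Let pB : mass p (~` B) = 0.
Proof.
rewrite massC// pprod// qA.
rewrite setIid lebesgue_measure_itv/= lte_fin t00 -EFinB subr0/=.
by rewrite divff ?mul1r ?subrr// gt_eqF.
Qed.

(** Index of the arc containing [s], when the fiber is cut into [K] arcs; it is
    less than [K] on the fiber, where the default value of [inord] in [grid]
    is not reached. *)
Definition cell K (s : R) := Num.truncn (s * K%:R / t0).

Definition grid K (w : P) : 'I_K.+1 := inord (cell K w.2).

Lemma le_cell K s s' : s <= s' -> (cell K s <= cell K s')%N.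
Proof.
move=> ss'; apply: le_truncn; rewrite ler_pM2r ?invr_gt0//.
by apply: ler_wpM2r; rewrite ?ler0n.
Qed.

Lemma cell_refine K M s : (0 < M)%N -> (cell (K * M) s %/ M)%N = cell K s.
Proof.
by move=> M0; rewrite /cell natrM mulrA mulrAC truncn_divn.
Qed.

Let scale_ge0 K (s : R) : 0 <= s -> 0 <= s * K%:R / t0.
Proof.
by move=> s0; apply: divr_ge0; [apply: mulr_ge0 => //; exact: ler0n|exact: ltW].
Qed.

Lemma cell_lt K s : (0 < K)%N -> 0 <= s < t0 -> (cell K s < K)%N.
Proof.
move=> K0 /andP[s0 st]; have KR : 0 < K%:R :> R by rewrite ltr0n.
rewrite /cell truncn_lt_nat; last exact: scale_ge0.
by rewrite ltr_pdivrMr// mulrC ltr_pM2l.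
Qed.

Lemma gridE K w : (0 < K)%N -> B w -> grid K w = cell K w.2 :> nat.
Proof.
move=> K0 [_ /=]; rewrite in_itv/= => wt; rewrite inordK//.
exact/leqW/cell_lt.
Qed.

Lemma grid_eq K w w' : (0 < K)%N -> B w -> B w' ->
  grid K w = grid K w' <-> cell K w.2 = cell K w'.2.
Proof.
move=> K0 Bw Bw'; split=> [h|h]; last by rewrite /grid h.
by rewrite -!gridE// h.
Qed.

Let mcell K : measurable_fun setT (fun s : measurableTypeR R => s * K%:R / t0 : measurableTypeR R).
Proof. by apply: measurable_funM => //; exact: measurable_funM. Qed.

Lemma mrv_grid K : mrv (grid K).
Proof.
apply: (@mrv_truncn R _ P 'I_K.+1 (fun w => w.2 * K%:R / t0) inord).
exact: (measurableT_comp (mcell K) (@measurable_snd _ _ _ _)).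
Qed.

Let mcellset K n : measurable [set s : measurableTypeR R | cell K s = n].
Proof.
have := @mrv_truncn R _ (measurableTypeR R) bool _ (fun k => k == n) (mcell K) true.
by rewrite (_ : _ @^-1` _ = [set s | cell K s = n])//; apply/seteqP; split=> s /= /eqP.
Qed.

Lemma mass_cell K n (U : set T) : (0 < K)%N -> measurable U ->
  mass p (U `*` [set s | cell K s = n]) = (if (n < K)%N then mass q U / K%:R else 0).
Proof.
move=> K0 mU; rewrite pprod//; have KR : 0 < K%:R :> R by rewrite ltr0n.
case: ifPn => nK; last first.
  rewrite (_ : _ `&` _ = set0) ?measure0 ?mul0r ?mulr0//.
  apply/seteqP; split=> // s [/= sn]; rewrite in_itv/= => /(cell_lt K0).
  by rewrite sn (negPf nK).
rewrite (_ : _ `&` _ = `[n%:R * t0 / K%:R, n.+1%:R * t0 / K%:R[%classic); last first.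
  have e1 s : (n%:R * t0 / K%:R <= s) = (n%:R <= s * K%:R / t0).
    by rewrite ler_pdivrMr// ler_pdivlMr.
  have e2 s : (s < n.+1%:R * t0 / K%:R) = (s * K%:R / t0 < n.+1%:R).
    by rewrite ltr_pdivlMr// ltr_pdivrMr.
  apply/seteqP; split=> s /=; rewrite !in_itv/=.
    rewrite e1 e2 => -[sn /andP[s0 st]]; apply/andP; split.
      by rewrite -sn truncn_le; exact: scale_ge0.
    by rewrite -sn truncnS_gt.
  move=> /andP[h1 h2]; have s0 : 0 <= s.
    apply: le_trans h1; apply: divr_ge0; last exact: ltW.
    by apply: mulr_ge0; [exact: ler0n|exact: ltW].
  split; first by apply: truncn_def; rewrite -e1 -e2 h1.
  rewrite s0/=; apply: (lt_le_trans h2).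
  by rewrite ler_pdivrMr// mulrC ler_pM2l// ler_nat.
rewrite lebesgue_measure_itv/= lte_fin ltr_pM2r ?invr_gt0// ltr_pM2r// ltr_nat leqnn.
rewrite -EFinB/= -mulrBl -mulrBl -natrB// subSnn mul1r mulrAC divff ?mul1r//.
by rewrite gt_eqF.
Qed.

Let mfst (U : set T) : measurable U -> measurable (fst @^-1` U : set P).
Proof. by move=> mU; rewrite -[X in measurable X]setTI; exact: measurable_fst. Qed.

Let mrv_fst (I : finType) (X : T -> I) : mrv X -> mrv (fun w : P => X w.1).
Proof. by move=> mX k; exact: (mfst (mX k)). Qed.

Let msnd (V : set (measurableTypeR R)) : measurable V -> measurable (snd @^-1` V : set P).
Proof. by move=> mV; rewrite -[X in measurable X]setTI; exact: measurable_snd. Qed.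

(** Approximation in measure by a variable read from a finite partition of the
    base and a grid on the fiber. In this form it is stable under pairing,
    hence under finite unions, and under limits in measure. *)
Definition grid_approx (I : Type) (Q : P -> I) := forall de : R, 0 < de ->
  exists K, (0 < K)%N /\ exists (J : finType) (U : T -> J) (G : set P),
    [/\ mrv U, measurable G, mass p (~` G) < de &
        det G (fun w => (U w.1, grid K w)) Q].

Lemma grid_approx_det (I J : Type) (Q : P -> I) (Q' : P -> J) :
  grid_approx Q -> det setT Q Q' -> grid_approx Q'.
Proof.
move=> aQ QQ' de de0; have [K [K0 [L [U [G [mU mG Gde dG]]]]]] := aQ de de0.
exists K; split => //; exists L, U, G; split => // w w' Gw Gw' E.
by apply: QQ' => //; exact: dG.
Qed.

Lemma grid_approx_pair (I J : Type) (Q : P -> I) (Q' : P -> J) :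
  grid_approx Q -> grid_approx Q' -> grid_approx (fun w => (Q w, Q' w)).
Proof.
move=> aQ aQ' de de0; have de20 : 0 < de / 2 by rewrite divr_gt0.
have [K [K0 [L [U [G [mU mG Gde dG]]]]]] := aQ _ de20.
have [K' [K'0 [L' [U' [G' [mU' mG' Gde' dG']]]]]] := aQ' _ de20.
exists (K * K')%N; split; first by rewrite muln_gt0 K0.
exists (L * L')%type, (fun x => (U x, U' x)), ((G `&` G') `&` B); split.
- exact: mrv_pair.
- by apply: measurableI => //; exact: measurableI.
- rewrite (setCI (G `&` G') B) (setCI G G') [ltRHS](splitr de).
  have h1 := massUle p (measurableU _ _ (measurableC mG) (measurableC mG')) (measurableC mB).
  have h2 := massUle p (measurableC mG) (measurableC mG').
  apply: (le_lt_trans h1); rewrite pB addr0; apply: (le_lt_trans h2).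
  exact: ltrD.
- move=> w w' [[Gw Gw'] Bw] [[Hw Hw'] Bw'] [UE UE' gE].
  have cE : cell (K * K') w.2 = cell (K * K') w'.2.
    by apply/grid_eq; rewrite ?muln_gt0 ?K0.
  congr (_, _).
    apply: dG => //; congr (_, _) => //; apply/grid_eq => //.
    by rewrite -!(cell_refine K _ K'0) cE.
  apply: dG' => //; congr (_, _) => //; apply/grid_eq => //.
  by rewrite -!(cell_refine K' _ K0) mulnC cE.
Qed.

Lemma grid_approx_cst (I : Type) (i : I) : grid_approx (fun=> i).
Proof.
move=> de de0; exists 1%N; split => //; exists unit, (fun=> tt), setT; split => //.
  exact: mrv_cst.
by rewrite setCT mass0.
Qed.

Lemma grid_approx_fst (U : set T) : measurable U -> grid_approx (fun w => w.1 \in U).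
Proof.
move=> mU de de0; exists 1%N; split => //.
exists bool, (fun x => x \in U), setT; split => //.
- exact: mrv_in.
- by rewrite setCT mass0.
- by move=> w w' _ _ [].
Qed.

(** [a < w.2] is known from the cell of [w.2], unless this is the cell of
    [a]. *)
Lemma grid_approx_lt (a : R) : grid_approx (fun w => a < w.2).
Proof.
move=> de de0; pose K := (Num.truncn (de^-1)).+1.
have K0 : (0 < K)%N by [].
have Kde : K%:R^-1 < de.
  by rewrite invf_plt ?posrE ?ltr0n// truncnS_gt.
pose C : set P := setT `*` [set s | cell K s = cell K a].
have mC : measurable C by apply: measurableX.
exists K; split => //; exists unit, (fun=> tt), (B `&` ~` C); split.
- exact: mrv_cst.
- by apply: measurableI => //; exact: measurableC.
- rewrite setCI setCK (le_lt_trans (massUle _ _ _))//; first exact: measurableC.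
  rewrite pB add0r mass_cell// massT mul1r; case: ifP => _ //.
- move=> w w' [Bw nC] [Bw' nC'] [/(grid_eq K0 Bw Bw') cE].
  apply/idP/idP => h; rewrite ltNge; apply/negP => h'.
    apply: nC'; split => //=; apply/eqP; rewrite eqn_leq le_cell//=.
    by rewrite -cE le_cell// ltW.
  apply: nC; split => //=; apply/eqP; rewrite eqn_leq le_cell//=.
  by rewrite cE le_cell// ltW.
Qed.

(** A countable union is close in measure to a finite one. *)
Lemma grid_approx_bigcup (E : (set P)^nat) : (forall n, measurable (E n)) ->
  (forall n, grid_approx (fun w => w \in E n)) ->
  grid_approx (fun w => w \in \bigcup_n E n).
Proof.
move=> mE aE de de0.
pose F n := \bigcup_(i < n) E i.
have aF n : grid_approx (fun w => w \in F n).
  elim: n => [|n IH].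
    apply: (grid_approx_det (grid_approx_cst tt)) => w w' _ _ _.
    by rewrite /F bigcup_mkord big_ord0 !in_set0.
  apply: (grid_approx_det (grid_approx_pair IH (aE n))) => w w' _ _ [h1 h2].
  by rewrite /F !bigcup_mkord !big_ord_recr/= !in_setU -!bigcup_mkord h1 h2.
have mF n : measurable (F n) by exact: bigcup_measurable.
have mEE : measurable (\bigcup_n E n) by exact: bigcupT_measurable.
pose D n := \bigcup_n E n `\` F n.
have mD n : measurable (D n) by exact: measurableD.
have D0 : (fun n => mass p (D n)) @ \oo --> 0.
  apply: mass_cvg0 => //.
    move=> n k nk; apply/subsetPset => w [Ew nF]; split => // -[i /= ik Ei].
    by apply: nF; exists i => //=; exact: leq_trans nk.
  rewrite (_ : \bigcap_n D n = set0) ?measure0//.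
  apply/seteqP; split=> // w h; have [[i _ Ei] _] := h 0%N I.
  by have [_] := h i.+1 I; apply; exists i => /=.
have de20 : 0 < de / 2 by rewrite divr_gt0.
have [n [_ Dn]] := cvg0_ex 0 D0 de20.
have [K [K0 [L [U [G [mU mG Gde dG]]]]]] := aF n _ de20.
exists K; split => //; exists L, U, (G `&` ~` D n); split => //.
- by apply: measurableI => //; exact: measurableC.
- rewrite setCI setCK (le_lt_trans (massUle _ _ _))//; first exact: measurableC.
  by rewrite [ltRHS](splitr de) ltrD.
have FE w : ~ D n w -> (w \in \bigcup_n E n) = (w \in F n).
  move=> nD; apply/idP/idP => /set_mem h; apply/mem_set.
    by apply: contrapT => nF; apply: nD.
  by case: h => i _ Ei; exists i.
by move=> w w' [Gw nD] [Gw' nD'] E1; rewrite !FE//; exact: dG.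
Qed.

(** The approximable sets form a sigma-algebra, which contains the rectangles
    because their sides are approximable. *)
Lemma grid_approx_set (C : set P) : measurable C -> grid_approx (fun w => w \in C).
Proof.
pose Cl (C : set P) := measurable C /\ grid_approx (fun w => w \in C).
have ClC C' : Cl C' -> Cl (~` C').
  move=> [mC aC]; split; first exact: measurableC.
  by apply: (grid_approx_det aC) => w w' _ _ E; rewrite !in_setC E.
have ClU (E : (set P)^nat) : (forall n, Cl (E n)) -> Cl (\bigcup_n E n).
  move=> h; split; first by apply: bigcupT_measurable => n; have [] := h n.
  by apply: grid_approx_bigcup => n; have [] := h n.
have Cl0 : Cl set0.
  split => //; apply: (grid_approx_det (grid_approx_cst tt)) => w w' _ _ _.
  by rewrite !in_set0.
have Clsnd (V : set (measurableTypeR R)) : measurable V -> Cl (snd @^-1` V).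
  move=> mV; suff : [set V | Cl (snd @^-1` V)] V by [].
  move: V mV; apply: smallest_sub.
    split => /=; first by rewrite preimage_set0.
      by move=> V; rewrite setTD preimage_setC; exact: ClC.
    by move=> F h; rewrite preimage_bigcup; exact: ClU.
  move=> _ [[a b] _ <-] /=; split.
    exact: msnd.
  apply: (grid_approx_det (grid_approx_pair (grid_approx_lt a) (grid_approx_lt b))).
  move=> w w' _ _ [h1 h2]; apply/idP/idP => /set_mem /=; rewrite in_itv/=;
    rewrite leNgt => hh; apply/mem_set; rewrite /= in_itv/= leNgt.
    by rewrite -h1 -h2.
  by rewrite h1 h2.
move=> mC; suff : Cl C by case.
move: C mC; rewrite measurable_prod_measurableType; apply: smallest_sub.
  by split => //= C'; rewrite setTD; exact: ClC.
move=> _ [U mU [V mV <-]]; split; first exact: measurableX.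
have [_ aV] := Clsnd V mV.
apply: (grid_approx_det (grid_approx_pair (grid_approx_fst mU) aV)).
move=> w w' _ _ [h1 h2]; rewrite (_ : _ `*` _ = fst @^-1` U `&` snd @^-1` V)//.
by rewrite !in_setI -[w \in fst @^-1` U]/(w.1 \in U) h1 h2.
Qed.

Lemma grid_approx_rv (I : finType) (Q : P -> I) : mrv Q -> grid_approx Q.
Proof.
move=> mQ.
suff [L [Z [aZ ZQ]]] : exists (L : Type) (Z : P -> L), grid_approx Z /\
    forall i, i \in enum I -> det setT Z (fun w => w \in Q @^-1` [set i]).
  apply: (grid_approx_det aZ) => w w' _ _ ZE.
  have := @ZQ (Q w) (mem_enum _ _) w w' Logic.I Logic.I ZE.
  by rewrite mem_set// => /esym /set_mem.
elim: (enum I) => [|i s [L [Z [aZ ZQ]]]].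
  by exists unit, (fun=> tt); split => //; exact: grid_approx_cst.
exists (L * bool)%type, (fun w => (Z w, w \in Q @^-1` [set i])); split.
  by apply: grid_approx_pair => //; apply: grid_approx_set; exact: mQ.
move=> j; rewrite inE => /orP[/eqP ->|js] w w' _ _ [ZE QE] //.
exact: ZQ ZE.
Qed.

(** The total angle of the first [i] rotations. *)
Definition cocycle i x : R := \sum_(l < i) r (iter l g x).

Let cocycle_ge0 i x : 0 <= cocycle i x.
Proof. by apply: sumr_ge0. Qed.

Let mcocycle i : measurable_fun setT (cocycle i : T -> measurableTypeR R).
Proof.
elim: i => [|i IH].
  by rewrite (_ : cocycle 0 = cst 0)//; apply/funext => x; rewrite /cocycle big_ord0.
rewrite (_ : cocycle i.+1 = (fun x => cocycle i x + r (iter i g x))); last first.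
  by apply/funext => x; rewrite /cocycle big_ord_recr.
by apply: measurable_funD => //; apply: measurableT_comp => //; exact: measurable_iter.
Qed.

Lemma rotation_iter i w : B w -> [/\ B (iter i S w), (iter i S w).1 = iter i g w.1 &
  exists j : nat, (iter i S w).2 = w.2 - cocycle i w.1 + j%:R * t0].
Proof.
move=> Bw; elim: i => [|i [Bi Ei [j jE]]].
  split => //; exists 0%N; by rewrite /cocycle big_ord0 subr0 mul0r addr0.
rewrite !iterS; split; first exact: SB.
  by rewrite S1// Ei.
have [k kE] := S2 Bi; exists (j + k)%N.
by rewrite kE jE Ei /cocycle big_ord_recr/= natrD; ring.
Qed.

Definition shift_cell N i x := Num.truncn (cocycle i x * N%:R / t0).

(** An integer part of a sum is the sum of the integer parts, or one more. *)
Lemma cell_rotation N i w : (0 < N)%N -> B w -> exists j : nat,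
  (cell N w.2 + j * N = cell N (iter i S w).2 + shift_cell N i w.1 \/
   cell N w.2 + j * N = (cell N (iter i S w).2 + shift_cell N i w.1).+1)%N.
Proof.
move=> N0 Bw; have [Bi _ [j jE]] := rotation_iter i Bw; exists j.
move: Bw Bi => [_ +] [_]; rewrite /= !in_itv/= => /andP[s0 st] /andP[si0 sit].
pose sc (s : R) := s * N%:R / t0.
have scE : sc (iter i S w).2 + sc (cocycle i w.1) = sc w.2 + j%:R * N%:R.
  by rewrite /sc jE; field; rewrite gt_eqF.
have /andP[a1 a2] := truncn_itv (scale_ge0 N s0).
have /andP[b1 b2] := truncn_itv (scale_ge0 N si0).
have /andP[d1 d2] := truncn_itv (scale_ge0 N (cocycle_ge0 i w.1)).
move: a1 a2 b1 b2 d1 d2; rewrite -/(cell N _) -/(cell N _) -/(shift_cell N i w.1).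
rewrite -/(sc w.2) -/(sc (iter i S w).2) -/(sc (cocycle i w.1)).
set u := cell N w.2; set ui := cell N _; set W := shift_cell _ _ _.
rewrite -!natr1 => a1 a2 b1 b2 d1 d2.
have h1 : (ui + W < (u + j * N).+1)%N.
  rewrite -(ltr_nat R) -natr1 !natrD natrM; lra.
have h2 : (u + j * N < (ui + W).+2)%N.
  rewrite -(ltr_nat R) -natr1 -natr1 !natrD natrM; lra.
move: h1 h2; rewrite !ltnS => h1 h2.
have [h3|h3] := leqP (u + j * N)%N (ui + W)%N.
  by left; apply/eqP; rewrite eqn_leq h1 h3.
by right; apply/eqP; rewrite eqn_leq h2 h3.
Qed.

Let sum_modn (F : nat -> R) K M : (0 < M)%N ->
  \sum_(0 <= v < K * M) F (v %% M)%N = K%:R * \sum_(0 <= b < M) F b.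
Proof.
move=> M0; elim: K => [|K IH]; first by rewrite mul0n big_geq// mul0r.
rewrite mulSn addnC (@big_cat_nat _ _ _ (K * M)) ?leq_addr//= IH.
rewrite -natr1 mulrDl mul1r; congr (_ + _).
rewrite -{1}[(K * M)%N]add0n big_addn addKn; apply: eq_big_nat => b /andP[_ bM].
by rewrite addnC modnMDl modn_small.
Qed.

(** The starting cell is uniformly distributed and independent of the base
    point, hence of the angle. *)
Lemma mass_bad K M i : (0 < K)%N -> (0 < M)%N ->
  mass p (B `&` [set w | (cell (K * M) w.2 == shift_cell (K * M) i w.1 %[mod M])%N])
  <= M%:R^-1.
Proof.
move=> K0 M0; set N := (K * M)%N; have N0 : (0 < N)%N by rewrite muln_gt0 K0.
pose Wm x : 'I_M.+1 := inord (shift_cell N i x %% M).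
have mWm : mrv Wm.
  apply: (@mrv_truncn R _ T 'I_M.+1 (fun x => cocycle i x * N%:R / t0)
    (fun n => inord (n %% M))).
  exact: (measurableT_comp (mcell N) (mcocycle i)).
have WmE x : Wm x = (shift_cell N i x %% M)%N :> nat.
  by rewrite inordK// leqW// ltn_mod.
pose bad : set P := [set w | (cell N w.2 == shift_cell N i w.1 %[mod M])%N].
have mbad : measurable bad.
  have mu := @mrv_truncn R _ P 'I_M.+1 (fun w => w.2 * N%:R / t0)
    (fun n => inord (n %% M)) (measurableT_comp (mcell N) (@measurable_snd _ _ _ _)).
  have mW1 : mrv (fun w : P => Wm w.1) by exact: mrv_fst.
  have := mrv_comp (fun uw : 'I_M.+1 * 'I_M.+1 => uw.1 == uw.2) (mrv_pair mu mW1) true.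
  congr measurable; apply/seteqP; split=> w /= => [/eqP/(congr1 (@nat_of_ord _))|].
    by rewrite WmE inordK ?leqW ?ltn_mod// => h; apply/eqP.
  by move=> /eqP h; apply/eqP/ord_inj; rewrite WmE inordK ?leqW ?ltn_mod.
have mBb : measurable (B `&` bad) by exact: measurableI.
pose F b : R := mass q [set x | (shift_cell N i x %% M)%N = b].
have mF b : measurable [set x | (shift_cell N i x %% M)%N = b].
  have := @mrv_truncn R _ T bool (fun x => cocycle i x * N%:R / t0)
    (fun n => (n %% M)%N == b) (measurableT_comp (mcell N) (mcocycle i)) true.
  by congr measurable; apply/seteqP; split=> x /= /eqP.
have F1 : \sum_(0 <= b < M) F b <= 1.
  rewrite -(pr_sum1 q mWm) big_ord_recr/= -[leLHS]addr0 lerD ?pr_ge0//.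
  rewrite big_mkord; apply: ler_sum => b _; apply: le_mass => // x /= xb.
  by apply/ord_inj; rewrite WmE xb.
rewrite (mass_rv p (@mrv_grid N) mBb).
apply: (@le_trans _ _ (\sum_(v < N.+1) (if (v < N)%N then F (v %% M)%N / N%:R else 0))).
  apply: ler_sum => v _; rewrite -(mass_cell v N0 (mF _)); apply: le_mass.
  - by apply: measurableI => //; exact: mrv_grid.
  - by apply: measurableX.
  - move=> w [[Bw /= /eqP bw] gw]; have cE : cell N w.2 = v by rewrite -gridE// gw.
    by split => //=; rewrite -cE bw.
rewrite big_ord_recr/= ltnn addr0.
rewrite (eq_bigr (fun v : 'I_N => F (v %% M)%N / N%:R)) => [|v _]; last first.
  by rewrite ltn_ord.
rewrite -mulr_suml -(big_mkord xpredT (fun v => F (v %% M)%N)) sum_modn//.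
rewrite ler_pdivrMr ?ltr0n// natrM mulrCA mulVf ?pnatr_eq0 -?lt0n// mulr1.
by rewrite ler_piMr.
Qed.

Definition shift_word n N x : {ffun 'I_n -> 'I_N.+1} :=
  [ffun i : 'I_n => inord (shift_cell N i x %% N)].

Lemma mrv_shift_word n N : mrv (shift_word n N).
Proof.
apply: mrv_ffun => i.
apply: (@mrv_truncn R _ T 'I_N.+1 (fun x => cocycle i x * N%:R / t0)
  (fun k => inord (k %% N))).
exact: (measurableT_comp (mcell N) (mcocycle i)).
Qed.

Let mass_bigsetU n (F : nat -> set P) : (forall i, measurable (F i)) ->
  mass p (\big[setU/set0]_(i < n) F i) <= \sum_(i < n) mass p (F i).
Proof.
move=> mF; elim: n => [|n IH]; first by rewrite !big_ord0 mass0.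
rewrite !big_ord_recr/=; apply: le_trans (massUle _ _ _) _ => //.
  exact: bigsetU_measurable.
by rewrite lerD2r.
Qed.

(** Once the shifts are known to the precision of a cell of the finer grid,
    the position at time 0 in the finer grid determines the positions in the
    coarse grid at the times below [n], except near the [n] rotated
    boundaries. With [M = n ^ 2] the bound is of order [ln n]. *)
Lemma CH_word_grid K M n : (0 < K)%N -> (0 < M)%N ->
  cond_entropy p (word S (grid K) n) (fun w => shift_word n (K * M) w.1) <=
  ln (K * M).+1%:R + (ln 2 + n%:R / M%:R * (n%:R * ln K.+1%:R + ln 2)).
Proof.
move=> K0 M0; set N := (K * M)%N; have N0 : (0 < N)%N by rewrite muln_gt0 K0.
have mW : mrv (fun w : P => shift_word n N w.1).
  by apply: mrv_fst; exact: mrv_shift_word.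
have mE : mrv (word S (grid K) n) by apply: mrv_word => //; exact: mrv_grid.
have mu : mrv (grid N) by exact: mrv_grid.
apply: (@le_trans _ _ (cond_entropy p (fun w => (word S (grid K) n w, grid N w))
    (fun w => shift_word n N w.1))).
  apply: (CH_le_l mB pB) => //; first exact: mrv_pair.
  by move=> w w' _ _ [].
rewrite (CH_chain mB pB)//; apply: lerD.
  by rewrite -[in leRHS](card_ord N.+1); exact: CH_le_card.
pose bad i : set P := B `&`
  [set w | (cell N w.2 == shift_cell N i w.1 %[mod M])%N].
have mbad i : measurable (bad i).
  have mWi := @mrv_truncn R _ T 'I_M.+1 (fun x => cocycle i x * N%:R / t0)
    (fun k => inord (k %% M)) (measurableT_comp (mcell N) (mcocycle i)).
  have mui := @mrv_truncn R _ P 'I_M.+1 (fun w => w.2 * N%:R / t0)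
    (fun n => inord (n %% M)) (measurableT_comp (mcell N) (@measurable_snd _ _ _ _)).
  have mWi1 : mrv (fun w : P => inord (shift_cell N i w.1 %% M) : 'I_M.+1).
    exact: (mrv_fst mWi).
  apply: measurableI => //.
  have := mrv_comp (fun uw : 'I_M.+1 * 'I_M.+1 => uw.1 == uw.2) (mrv_pair mui mWi1) true.
  congr measurable; apply/seteqP; split=> w /= => [/eqP/(congr1 (@nat_of_ord _))|].
    by rewrite !inordK ?leqW ?ltn_mod// => h; apply/eqP.
  by move=> /eqP h; apply/eqP/ord_inj; rewrite !inordK ?leqW ?ltn_mod.
pose G := B `&` ~` (\big[setU/set0]_(i < n) bad i).
have mG : measurable G.
  by apply: measurableI => //; apply/measurableC/bigsetU_measurable.
have dG : det G (fun w => (grid N w, shift_word n N w.1)) (word S (grid K) n).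
  move=> w w' [Bw nw] [Bw' nw'] [/(grid_eq N0 Bw Bw') cE /ffunP WE].
  apply/word_eq => i ilt.
  have [Bi _ _] := rotation_iter i Bw; have [Bi' _ _] := rotation_iter i Bw'.
  apply/grid_eq => //; rewrite -!(cell_refine K _ M0) -/N.
  have WiE : (shift_cell N i w.1 %% N = shift_cell N i w'.1 %% N)%N.
    have := congr1 (@nat_of_ord _) (WE (Ordinal ilt)).
    by rewrite !ffunE !inordK ?leqW ?ltn_mod.
  have cellN (v : P) : B v -> (cell N v.2 < N)%N.
    by move=> [_ /=]; rewrite in_itv/= => vt; exact: cell_lt.
  have nbad (v : P) : B v -> ~ (\big[setU/set0]_(j < n) bad j) v ->
      (cell N v.2 != shift_cell N i v.1 %[mod M])%N.
    move=> Bv nv; apply/negP => h; apply: nv.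
    by rewrite -bigcup_mkord; exists i.
  have [j jE] := cell_rotation i N0 Bw; have [j' jE'] := cell_rotation i N0 Bw'.
  rewrite (rotation_cell K0 M0 (cellN _ Bw) (cellN _ Bi) jE (nbad _ Bw nw)).
  rewrite (rotation_cell K0 M0 (cellN _ Bw') (cellN _ Bi') jE' (nbad _ Bw' nw')).
  by rewrite -/N WiE cE.
have half : 0 < (2^-1 : R) < 1 by rewrite invr_gt0 invf_lt1 ?ltr0n ?ltr1n.
have mY : mrv (fun w : P => (grid N w, shift_word n N w.1)) by exact: mrv_pair.
apply: (le_trans (CH_fano p mE mY mG dG half)).
have -> : 1 - 2^-1 = 2^-1 :> R by field.
rewrite lnV ?posrE ?ltr0n// opprK lerD2l.
have -> : ln (#|{: {ffun 'I_n -> 'I_K.+1}}|%:R / 2^-1) = n%:R * ln K.+1%:R + ln 2 :> R.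
  rewrite card_ffun !card_ord invrK lnM ?posrE ?ltr0n ?expn_gt0// natrX lnXn ?ltr0n//.
  by rewrite mulr_natl.
apply: ler_wpM2r.
  by rewrite addr_ge0 ?mulr_ge0 ?ler0n ?ln_ge0 ?ler1n.
apply: (@le_trans _ _ (mass p (~` B) + mass p (\big[setU/set0]_(i < n) bad i))).
  rewrite /G (setCI B) setCK; apply: massUle; first exact: measurableC.
  exact: bigsetU_measurable.
rewrite pB add0r; apply: (le_trans (mass_bigsetU n mbad)).
apply: (@le_trans _ _ (\sum_(i < n) M%:R^-1)).
  by apply: ler_sum => i _; exact: mass_bad.
by rewrite sumr_const card_ord mulr_natl.
Qed.

Let fst_mass (C : set T) : measurable C -> mass p (fst @^-1` C) = mass q C.
Proof.
move=> mC; rewrite (_ : _ @^-1` _ = C `*` setT); last first.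
  by apply/seteqP; split=> w // [].
rewrite pprod// setTI lebesgue_measure_itv/= lte_fin t00 -EFinB subr0/=.
by rewrite divff ?mulr1// gt_eqF.
Qed.

(** Over blocks of length [n] the base contributes at most [n * h], and the
    positions an amount of order [ln n] when the fine grid has [K * n ^ 2]
    cells. With [n = k ^ 2], [ln n / n] is at most [2 / k]. *)
Lemma rate_grid_le (J : finType) (U : T -> J) K h : mrv U -> (0 < K)%N ->
  (entropy q g <= h%:E)%E -> rate p S (fun w => (U w.1, grid K w)) <= h.
Proof.
move=> mU K0 hq; set Y := fun w => _.
have T0 : mass q (~` setT) = 0 by rewrite setCT mass0.
have mU1 : mrv (fun w : P => U w.1) by exact: mrv_fst.
have mgr : mrv (grid K) by exact: mrv_grid.
have mY : mrv Y by exact: mrv_pair.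
have bound n M : (0 < n)%N -> (0 < M)%N -> n%:R * rate p S Y <= n%:R * h +
    (ln (K * M).+1%:R + (ln 2 + n%:R / M%:R * (n%:R * ln K.+1%:R + ln 2))).
  move=> n0 M0; pose Z x := (word g U n x, shift_word n (K * M) x).
  have mZ : mrv Z by apply: mrv_pair; [exact: mrv_word|exact: mrv_shift_word].
  have mZ1 : mrv (fun w : P => Z w.1) by exact: mrv_fst.
  have mSn := @measurable_iter _ _ _ mS n; have Sninv := invariant_iter mS Sinv n.
  have mgn := @measurable_iter _ _ _ mg n; have gninv := invariant_iter mg ginv n.
  have SnB w : B w -> B (iter n S w) by move=> Bw; have [] := rotation_iter n Bw.
  have Sn1 w : B w -> (iter n S w).1 = iter n g w.1.
    by move=> Bw; have [] := rotation_iter n Bw.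
  have mWY : mrv (word S Y n) by exact: mrv_word.
  rewrite -(rate_iter mS Sinv mB pB n0 mY).
  apply: (le_trans (rate_le_CH mSn Sninv mB pB mWY mZ1)); apply: lerD.
    rewrite (@rate_factor _ _ _ _ _ p q _ _ fst B mSn Sninv mgn gninv
      (@measurable_fst _ _ _ _) fst_mass mB pB SnB Sn1 _ _ mZ).
    apply: (le_trans (rate_iter_le mg ginv measurableT T0 n0 mZ)).
    rewrite ler_wpM2l// -lee_fin; apply: le_trans hq.
    exact: (rate_le_entropy mg ginv measurableT T0).
  apply: le_trans (CH_word_grid n K0 M0).
  have mWg : mrv (word S (grid K) n) by exact: mrv_word.
  have mW1 : mrv (fun w : P => shift_word n (K * M) w.1).
    by apply: mrv_fst; exact: mrv_shift_word.
  apply: (@le_trans _ _ (cond_entropy p (word S (grid K) n) (fun w => Z w.1))).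
    apply: (CH_le_l mB pB) => // w w' Bw Bw' [/word_eq gE /word_eq UE _].
    apply/word_eq => i ilt; congr (_, _); last exact: gE.
    have [_ -> _] := rotation_iter i Bw; have [_ -> _] := rotation_iter i Bw'.
    exact: UE.
  by apply: (CH_le_r mB pB) => // w w' _ _ [].
pose C : R := 2 * ln K.+1%:R + 2 * ln 2.
have C0 : 0 <= C by rewrite addr_ge0 ?mulr_ge0 ?ln_ge0 ?ler1n.
apply: (le_cvg0 (c := C + 4) (@cvg_harmonic R)); near=> m.
pose k := m.+1; have k0 : 0 < k%:R :> R by rewrite ltr0n.
have k1 : 1 <= k%:R :> R by rewrite ler1n.
pose n := (k * k)%N.
have n0 : (0 < n)%N by [].
have nR0 : 0 < n%:R :> R by rewrite ltr0n.
have := bound n (n * n)%N n0 isT.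
have L1 : ln (K * (n * n)).+1%:R <= ln K.+1%:R + 4 * k%:R :> R.
  apply: (@le_trans _ _ (ln (K.+1%:R * (n * n)%:R))).
    rewrite ler_ln ?posrE ?ltr0n// -?natrM ?ltr0n// ler_nat mulSn addnC -addn1.
    by rewrite leq_add2l.
  rewrite lnM ?posrE ?ltr0n// lerD2l (_ : (n * n)%:R = k%:R ^+ 4); last first.
    by rewrite !natrM; ring.
  rewrite lnXn// -[leLHS]mulr_natl ler_wpM2l// (le_trans (ln_le_sub1 k0))//.
  by rewrite gerBl.
have L2 : n%:R / (n * n)%:R * (n%:R * ln K.+1%:R + ln 2) <= ln K.+1%:R + ln 2 :> R.
  rewrite natrM invfM mulrA divff ?gt_eqF// mul1r mulrDr mulrA mulVf ?gt_eqF// mul1r.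
  rewrite lerD2l ler_piMl ?ln_ge0 ?ler1n// invf_le1// ler1n.
  exact: n0.
move=> bnd; have {bnd} : n%:R * rate p S Y <= n%:R * h + (C + 4 * k%:R).
  by apply: (le_trans bnd); rewrite /C; lra.
rewrite -ler_pdivlMl// => /le_trans; apply.
rewrite mulrDr mulrA mulVf ?gt_eqF// mul1r lerD2l /harmonic/= -/k.
rewrite ler_pdivrMl// /n natrM.
have -> : k%:R * k%:R * ((C + 4) / k%:R) = k%:R * (C + 4) :> R.
  by field; rewrite gt_eqF.
have := ler_wpM2l C0 k1; lra.
Unshelve. all: by end_near. Qed.

(** Rotating the fibers isometrically adds no entropy. *)
Theorem entropy_rotation_extension : entropy p S = entropy q g.
Proof.
have T0 : mass q (~` setT) = 0 by rewrite setCT mass0.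
apply/eqP; rewrite eq_le; apply/andP; split; last first.
  apply: (entropy_le mg ginv measurableT T0) => k X mX.
  rewrite -(@rate_factor _ _ _ _ _ p q _ _ fst B mS Sinv mg ginv
      (@measurable_fst _ _ _ _) fst_mass mB pB SB S1 _ _ mX).
  by apply: (rate_le_entropy mS Sinv mB pB); exact: mrv_fst.
have e0 : (0 <= entropy q g)%E.
  apply: le_trans (rate_le_entropy mg ginv measurableT T0 (@mrv_cst _ _ unit tt)).
  by rewrite lee_fin; apply: (rate_ge0 mg measurableT T0); exact: mrv_cst.
have hle h : (entropy q g <= h%:E)%E -> (entropy p S <= h%:E)%E.
  move=> hq; apply: (entropy_le mS Sinv mB pB) => k X mX; rewrite lee_fin.
  apply/ler_addgt0Pr => e ep.
  have [de de0 fano] := @CH_fano_small _ _ _ p #|{: 'I_k}| _ ep.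
  have [K [K0 [J [U [G [mU mG Gde dG]]]]]] := grid_approx_rv mX de0.
  have mUg : mrv (fun w : P => (U w.1, grid K w)).
    by apply: mrv_pair; [exact: mrv_fst|exact: mrv_grid].
  apply: (le_trans (rate_le_CH mS Sinv mB pB mX mUg)); apply: lerD.
    exact: rate_grid_le.
  by apply/ltW/(fano _ _ _ _ G).
by case: (entropy q g) e0 hle => [h _|_ _|//]; [apply|rewrite leey].
Qed.

End rotation_extension.

(** * The time-one map and the first return map *)

Section first_return_measurable.
Context d (T : measurableType d) (g : T -> T) (B : set T).
Hypotheses (mg : measurable_fun setT g) (mB : measurable B).

Lemma measurable_first_return_time k :
  measurable [set x | first_return_time g B x = k].
Proof.
have mA l : measurable (g @^-1` avoid g B l) by apply/measurable_pre/measurable_avoid.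
case: k => [|k].
  rewrite (_ : [set x | _] = \bigcap_l g @^-1` avoid g B l).
    exact: bigcapT_measurable.
  apply/seteqP; split=> x /= => [|h]; last first.
    by apply: first_return_time0 => l; exact: h.
  have [h _ l _|[l [al Bl]]] := first_return_timeP g B x; first exact: h.
  by rewrite (first_return_timeE al Bl).
rewrite (_ : [set x | _] = g @^-1` avoid g B k `&` iter k.+1 g @^-1` B).
  by apply: measurableI => //; exact: measurable_pre_iter.
apply/seteqP; split=> x /= => [|[ak Bk]]; last exact: first_return_timeE.
have [h|[l [al Bl]]] := first_return_timeP g B x.
  by rewrite first_return_time0.
by rewrite (first_return_timeE al Bl) => -[<-].
Qed.

End first_return_measurable.

Section flow_first_return.
Context (R : realType) (T : Type) (f : T -> T) (tau : T -> R).
Variables (c t0 : R) (A : set T).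
Hypotheses (c0 : 0 < c) (ctau : forall x, c <= tau x).
Hypotheses (t00 : 0 < t0) (t0c : t0 < c).
Local Notation bsum := (birkhoff_sum f tau).
Local Notation X := (susp_flow f tau t0).
Let B : set (T * R) := A `*` `[0, t0[%classic.

Lemma susp_flow_iter j x s : 0 <= s < tau x ->
  iter j X (x, s) = susp_flow f tau (j%:R * t0) (x, s).
Proof.
move=> /andP[s0 stau]; elim: j => [|j IH].
  rewrite mul0r (@susp_flowE _ _ f tau c c0 ctau 0).
    by rewrite birkhoff_sum0 addr0 subr0.
  by rewrite birkhoff_sum_recr birkhoff_sum0 add0r addr0 s0.
rewrite iterS IH (susp_flowD f c0 ctau); last exact: ltW.
  by rewrite -natr1 mulrDl mul1r.
by rewrite addr_ge0// mulr_ge0// ltW.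
Qed.

(** A flow line is in the box during the [t0] units of time that follow each of
    its passages over [A]; these intervals are disjoint as [t0] is less than
    the roof. *)
Lemma in_flow_box j x s : 0 <= s < tau x -> B (iter j X (x, s)) <->
  exists l, A (iter l f x) /\ bsum l x <= s + j%:R * t0 < bsum l x + t0.
Proof.
move=> sx; have /andP[s0 stau] := sx; rewrite susp_flow_iter//; split.
  have [|l lP] := @susp_flow_ex _ _ f tau c c0 ctau (j%:R * t0) x s.
    by rewrite addr_ge0// mulr_ge0// ltW.
  rewrite (susp_flowE c0 ctau lP) => -[/= Al]; rewrite in_itv/= => h.
  by exists l; split => //; lra.
move=> [l [Al /andP[h1 h2]]].
rewrite (@susp_flowE _ _ f tau c c0 ctau l); last first.
  by rewrite h1/= (lt_le_trans h2)// birkhoff_sum_recr lerD2l ltW// (lt_le_trans t0c).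
by split => //=; rewrite in_itv/=; lra.
Qed.

(** An interval of length [t0] contains exactly one time of a sequence of step
    [t0]: each passage is seen by the discrete time flow. *)
Lemma flow_grid_hit s b : s < b -> exists j,
  b <= s + j.+1%:R * t0 < b + t0 /\ s + j%:R * t0 < b.
Proof.
move=> sb.
have ex : exists j, b <= s + j%:R * t0.
  exists (Num.truncn ((b - s) / t0)).+1.
  by rewrite -lerBlDl -ler_pdivrMr// ltW// truncnS_gt.
case: (ex_minnP ex) => -[|j] jb jmin.
  by move: jb; rewrite mul0r addr0 leNgt sb.
have jb' : s + j%:R * t0 < b.
  by rewrite ltNge; apply/negP => /jmin; rewrite ltnn.
by exists j; split => //; rewrite jb/= -natr1 mulrDl mul1r addrA ltrD2r.
Qed.

Let before_base i s : 0 <= s -> s + i.+1%:R * t0 < t0 -> False.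
Proof.
move=> s0; rewrite -natr1 mulrDl mul1r => h.
have : 0 <= i%:R * t0 by rewrite mulr_ge0// ltW.
by move: h s0; lra.
Qed.

(** The first return to the box over the section is the first return map of
    the section together with the rotation of the fiber by the return time.
    This includes the points that never return, at which both maps are the
    identity. *)
Lemma first_return_flow x s : B (x, s) ->
  (first_return X B (x, s)).1 = first_return f A x /\
  exists j : nat, (first_return X B (x, s)).2 =
    s - bsum (first_return_time f A x) x + j%:R * t0.
Proof.
move=> [/= Ax]; rewrite in_itv/= => /andP[s0 st].
have sx : 0 <= s < tau x by rewrite s0 (lt_le_trans st)// (le_trans (ltW t0c)).
have [h|[k [ak Ak]]] := first_return_timeP f A x.
  rewrite /first_return (first_return_time0 h) (first_return_time0 (g := X))/=.
    by split => //; exists 0%N; rewrite birkhoff_sum0 subr0 mul0r addr0.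
  move=> l i il; rewrite -iterSr => /(in_flow_box _ sx)[[|n] [An]].
    by rewrite birkhoff_sum0 add0r => /andP[_ /(before_base s0)].
  by move=> _; apply: (h n.+1 n) => //; rewrite -iterSr.
have sr : s < bsum k.+1 x.
  apply: (lt_le_trans st); apply: (le_trans (ltW t0c)).
  apply: le_trans (birkhoff_sum_le f c0 ctau x (ltn0Sn k)).
  by rewrite birkhoff_sum_recr birkhoff_sum0 add0r.
have [j [/andP[j1 j2] j3]] := flow_grid_hit sr.
have aj : avoid X B j (X (x, s)).
  move=> i ij; rewrite -iterSr => /(in_flow_box _ sx)[[|n] [An /andP[n1 n2]]].
    by move: n2; rewrite birkhoff_sum0 add0r => /(before_base s0).
  have nk : (n < k)%N.
    rewrite ltnNge; apply/negP => kn.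
    have := birkhoff_sum_le f c0 ctau x (kn : (k.+1 <= n.+1)%N).
    have : s + i.+1%:R * t0 <= s + j%:R * t0.
      by rewrite lerD2l ler_pM2r// ler_nat.
    by move: n1 j3; lra.
  by apply: (ak n nk); rewrite -iterSr.
have Bj : B (iter j.+1 X (x, s)).
  by apply/in_flow_box => //; exists k.+1; rewrite j1 j2.
rewrite /first_return (first_return_timeE ak Ak) (first_return_timeE aj Bj).
rewrite susp_flow_iter// (@susp_flowE _ _ f tau c c0 ctau k.+1).
  by split => //; exists j.+1 => /=; ring.
rewrite j1/= (lt_le_trans j2)//.
apply: le_trans (birkhoff_sum_gap f ctau k.+1 x).
by rewrite lerD2l ltW.
Qed.

Lemma flow_box_hit k x s : 0 <= s < tau x -> A (iter k.+1 f x) ->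
  exists j, B (iter j X (x, s)).
Proof.
move=> sx Ak; have /andP[s0 stau] := sx.
have sr : s < bsum k.+1 x.
  apply: (lt_le_trans stau).
  apply: le_trans (birkhoff_sum_le f c0 ctau x (ltn0Sn k)).
  by rewrite birkhoff_sum_recr birkhoff_sum0 add0r.
have [j [/andP[j1 j2] j3]] := flow_grid_hit sr.
by exists j.+1; apply/in_flow_box => //; exists k.+1; rewrite j1 j2.
Qed.

End flow_first_return.

Section flow_entropy.
Context d (T : measurableType d) (R : realType) (mu : probability T R).
Variables (f : T -> T) (tau : T -> R) (A : set T) (c : R).
Hypotheses (mf : measurable_fun setT f) (finv : invariant_measure mu f).
Hypotheses (mA : measurable A) (A0 : 0 < mass mu A).
Hypothesis sweep0 : mu (\bigcap_l avoid f A l) = 0%E.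
Hypotheses (mtau : measurable_fun setT (tau : T -> measurableTypeR R)).
Hypotheses (c0 : 0 < c) (ctau : forall x, c <= tau x).
Variable It : R.
Hypothesis tau_int : (\int[mu]_x (tau x)%:E = It%:E)%E.
Local Notation P := (T * measurableTypeR R)%type.
Local Notation Om := (susp_space tau : set P).
Local Notation M := (under_measure mu).

Lemma roof_integral_gt0 : 0 < It.
Proof.
rewrite -lte_fin -tau_int; apply: (@lt_le_trans _ _ (\int[mu]_x (cst c%:E x))%E).
  rewrite integral_cst// [X in (_ * X)%E](_ : _ = 1%E) ?mule1 ?lte_fin//.
  exact: probability_setT.
apply: ge0_le_integral => //.
- by move=> x _; rewrite lee_fin ltW.
- exact/measurable_EFinP.
- by move=> x _; rewrite lee_fin.
Qed.

Let It0 : 0 < It := roof_integral_gt0.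

Let mOm : measurable Om. Proof. exact: measurable_susp_space. Qed.

Let under_fin C : measurable C -> M (C `&` Om) \is a fin_num.
Proof.
move=> mC; rewrite ge0_fin_numE//; apply: (@le_lt_trans _ _ (M Om)).
  by apply: le_measure; rewrite ?inE//; exact: measurableI.
by rewrite (under_measure_Om mu c0 ctau) tau_int ltey.
Qed.

Lemma susp_measure_probability : exists m : probability P R,
  (m : set P -> \bar R) = susp_measure mu tau.
Proof.
have Om_int : M Om = It%:E by rewrite (under_measure_Om mu c0 ctau).
have h : (0 < M Om < +oo)%E by rewrite Om_int lte_fin It0 ltey.
have [m mE] := normalized_restriction_probability mOm h.
exists m; rewrite mE; apply/funext => C.
by rewrite /normalized_restriction /susp_measure Om_int tau_int.
Qed.

Variable m : probability P R.
Hypothesis mE : (m : set P -> \bar R) = susp_measure mu tau.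

Let massE' C : measurable C -> mass m C = fine (M (C `&` Om)) / It.
Proof.
move=> mC; rewrite /mass mE /susp_measure tau_int inver gt_eqF//.
by rewrite -/(M _) -(fineK (under_fin mC)).
Qed.

Variable t0 : R.
Hypotheses (t00 : 0 < t0) (t0c : t0 < c).
Local Notation X := (susp_flow f tau t0 : P -> P).
Let B : set P := A `*` `[0, t0[%classic.

Let mX s : measurable_fun setT (susp_flow f tau s : P -> P).
Proof. exact: (measurable_susp_flow mf mtau c0 ctau). Qed.

Let mB : measurable B. Proof. exact: measurableX. Qed.

Let BOm : B `<=` Om.
Proof.
move=> [x s] [/= Ax]; rewrite in_itv/= => /andP[s0 st].
by rewrite /susp_space/= s0 (lt_le_trans st)// (le_trans (ltW t0c)).
Qed.

Lemma susp_flow_invariant : invariant_measure m X.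
Proof.
move=> C mC; have mXC : measurable (X @^-1` C) by exact: measurable_pre.
rewrite !massE// !massE'//; congr (fine _ / _)%:E.
exact: (under_measure_inv mf finv mtau c0 ctau t00 (ltW t0c)).
Qed.

(** The box lies under the roof, so the flow invariant measure is there a
    product. *)
Let mass_rect (U : set T) (V : set (measurableTypeR R)) :
  measurable U -> measurable V -> mass m ((U `*` V) `&` B) =
  mass mu (U `&` A) * fine (lebesgue_measure (V `&` `[0, t0[%classic)) / It.
Proof.
move=> mU mV; rewrite massE'; last by apply: measurableI => //; exact: measurableX.
congr (_ / _).
have -> : (U `*` V) `&` B `&` Om = (U `&` A) `*` (V `&` `[0, t0[%classic).
  rewrite setIidl; last by move=> w [_ /BOm].
  by apply/seteqP; split=> -[x s] /= [[? ?] [? ?]]; split; split.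
have mVI : measurable (V `&` `[0, t0[%classic) by exact: measurableI.
rewrite under_measureX//; last exact: measurableI.
rewrite fineM//; first by apply: fin_num_measure; exact: measurableI.
rewrite ge0_fin_numE//; apply: (@le_lt_trans _ _ (lebesgue_measure `[0, t0[%classic)).
  by apply: le_measure; rewrite ?inE.
by rewrite lebesgue_measure_itv/= lte_fin t00 -EFinB ltey.
Qed.

Let mass_box : mass m B = mass mu A * t0 / It.
Proof.
rewrite -(setIid B) [X in X `&` _](_ : _ = A `*` `[0, t0[%classic)// mass_rect//.
rewrite !setIid lebesgue_measure_itv/= lte_fin t00 -EFinB subr0//.
Qed.

Let box_gt0 : 0 < mass m B.
Proof. by rewrite mass_box divr_gt0// mulr_gt0. Qed.

(** A flow line that never enters the box stays over points that never return
    to [A]. *)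
Let sweepB : (fun l => mass m (avoid X B l)) @ \oo --> 0.
Proof.
have mav l : measurable (avoid X B l) by exact: measurable_avoid.
have mI : measurable (\bigcap_l avoid X B l) by exact: bigcapT_measurable.
apply: mass_cvg0 => //.
  by move=> k l kl; apply/subsetPset; exact: le_avoid.
rewrite massE// massE'//.
pose N0 := f @^-1` \bigcap_l avoid f A l.
have mNI : measurable (\bigcap_l avoid f A l).
  by apply: bigcapT_measurable => l; exact: measurable_avoid.
have mN0 : measurable N0 by exact: measurable_pre.
have N00 : mu N0 = 0%E by rewrite finv.
rewrite (_ : M _ = 0%E) ?mul0r//; apply/eqP; rewrite eq_le measure_ge0 andbT.
apply: (@le_trans _ _ (M (N0 `*` setT))).
  apply: le_measure; rewrite ?inE//; [exact: measurableI|exact: measurableX|].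
  move=> [x s] [h sx]; split => //= k _ i ik Ai.
  have [|j Bj] := @flow_box_hit R T f tau c t0 A c0 ctau t00 t0c i x s sx.
    by rewrite iterSr.
  exact: (h j.+1 I j).
by rewrite under_measureX// N00 mul0e.
Qed.

(** The return map to the box is the extension of [first_return f A] by the
    rotations of angle [- r]. *)
Theorem entropy_susp_flow_step (q : probability T R) :
  (q : set T -> \bar R) = normalized_restriction mu A ->
  entropy m X = ((mass mu A * t0 / It)%:E * entropy q (first_return f A))%E.
Proof.
move=> qE.
have hB : (0 < m B < +oo)%E by rewrite massE// lte_fin box_gt0 ltey.
have [p pE] := normalized_restriction_probability mB hB.
have mpE C : measurable C -> mass p C = mass m (C `&` B) / mass m B.
  exact: mass_normalized_restriction.
have mqE C : measurable C -> mass q C = mass mu (C `&` A) / mass mu A.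
  exact: mass_normalized_restriction.
have sweep : (fun l => mass mu (avoid f A l)) @ \oo --> 0.
  apply: mass_cvg0 sweep0; first by move=> l; exact: measurable_avoid.
  by move=> k l kl; apply/subsetPset; exact: le_avoid.
rewrite (entropy_first_return (mX t0) susp_flow_invariant mB box_gt0 mpE sweepB).
rewrite mass_box; congr (_ * _)%E.
pose r x := birkhoff_sum f tau (first_return_time f A x) x.
apply: (@entropy_rotation_extension _ T R q p (first_return f A) (first_return X B)
  A t0 r).
- exact: measurable_first_return.
- exact: (invariant_first_return mf finv mA mqE sweep).
- exact: measurable_first_return.
- exact: (invariant_first_return (mX t0) susp_flow_invariant mB mpE sweepB).
- by [].
- by rewrite mqE// setIid divff// gt_eqF.
- by [].
- exact: first_return_in.
- by move=> [x s] Bw; have [] := first_return_flow f c0 ctau t00 t0c Bw.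
- by move=> [x s] Bw; have [] := first_return_flow f c0 ctau t00 t0c Bw.
- move=> _ C mC; rewrite setTI.
  rewrite (_ : r @^-1` C = \bigcup_k ([set x | first_return_time f A x = k] `&`
    birkhoff_sum f tau k @^-1` C)).
    apply: bigcupT_measurable => k; apply: measurableI.
      exact: measurable_first_return_time.
    by rewrite -[X in measurable X]setTI; apply: measurable_birkhoff_sum.
  apply/seteqP; split=> x /=; first by move=> Cx; exists (first_return_time f A x).
  by move=> [k _ [<-]].
- by move=> x; exact: (birkhoff_sum_ge0 f c0 ctau).
- move=> U V mU mV; rewrite mpE; last exact: measurableX.
  rewrite mass_rect// mass_box mqE//; field.
  by rewrite !gt_eqF.
Qed.

End flow_entropy.

Section time_one_entropy.
Context d (T : measurableType d) (R : realType) (mu : probability T R).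
Variables (f : T -> T) (tau : T -> R) (A : set T) (c : R).
Hypotheses (mf : measurable_fun setT f) (finv : invariant_measure mu f).
Hypotheses (mA : measurable A) (A0 : 0 < mass mu A).
Hypothesis sweep0 : mu (\bigcap_l avoid f A l) = 0%E.
Hypotheses (mtau : measurable_fun setT (tau : T -> measurableTypeR R)).
Hypotheses (c0 : 0 < c) (ctau : forall x, c <= tau x).
Variable It : R.
Hypothesis tau_int : (\int[mu]_x (tau x)%:E = It%:E)%E.

(** The time step [t0 = 1 / N] is chosen below the roof; the factors [N] and [t0]
    cancel. *)
Theorem entropy_susp_flow :
  entropy (susp_measure mu tau) (susp_flow f tau 1) =
  ((mass mu A / It)%:E * entropy (normalized_restriction mu A) (first_return f A))%E.
Proof.
have [m mE] := susp_measure_probability mtau c0 ctau tau_int.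
have muA_fin : (0 < mu A < +oo)%E by rewrite massE// lte_fin A0 ltey.
have [q qE] := normalized_restriction_probability mA muA_fin.
rewrite -mE -qE; pose N := (Num.truncn c^-1).+1.
have NR0 : 0 < N%:R :> R by rewrite ltr0n.
pose t0 : R := N%:R^-1; have t00 : 0 < t0 by rewrite invr_gt0.
have t0c : t0 < c by rewrite invf_plt ?posrE// truncnS_gt.
pose Om : set (T * measurableTypeR R) := susp_space tau.
have mOm : measurable Om by exact: measurable_susp_space.
have mX s := measurable_susp_flow mf mtau c0 ctau s.
have Xinv := susp_flow_invariant mf finv mtau c0 ctau tau_int mE t00 t0c.
have OmC : mass m (~` Om) = 0.
  rewrite /mass mE /susp_measure setICl.
  by rewrite measure0 mul0e.
rewrite (@entropy_eq_on _ _ _ m _ (iter N (susp_flow f tau t0)) Om); last 6 first.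
- exact: mX.
- exact: measurable_iter.
- exact: mOm.
- exact: OmC.
- move=> [x s] /andP[/= s0 _]; apply: susp_flow_space; last by rewrite addr_ge0.
  by exists c.
- move=> [x s] sx; rewrite (susp_flow_iter f c0 ctau t00)//.
  by rewrite mulfV// gt_eqF.
rewrite (entropy_iter (mX t0) Xinv measurableT (D := setT)) ?setCT ?mass0//.
rewrite (entropy_susp_flow_step mf finv mA A0 sweep0 mtau c0 ctau tau_int mE t00 t0c qE).
rewrite muleA -EFinM; congr ((_)%:E * _)%E.
by rewrite mulrA [_ * (_ * t0)]mulrCA mulfV ?mulr1// gt_eqF.
Qed.

End time_one_entropy.

(** * Mean return time and entropy *)

Theorem corollary1 (R : realType) (Sigma : ptopologicalType)
    (f : borel Sigma -> borel Sigma)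
    (mu : probability (borel Sigma) R)
    (tau : borel Sigma -> R) (A : set (borel Sigma))
    (f_bij : bijective f)
    (f_meas : measurable_fun [set: borel Sigma] f)
    (mu_inv : invariant_measure mu f)
    (mu_erg : ergodic_measure mu f)
    (tau_roof : roof_function tau)
    (tau_L1 : mu.-integrable [set: borel Sigma] (EFin \o tau))
    (A_meas : measurable A)
    (A_pos : (0 < mu A)%E) :
  let mu_A := normalized_restriction mu A in
  let mu_bar := susp_measure mu tau in
  let X := susp_flow f tau in
  let n_A := hitting_time f tau (cross_section A) in
  let h_A := entropy mu_A (first_return f A) in
  let h_X := entropy mu_bar (X 1) in
  (\int[mu_A]_(x in A) n_A (x, 0%R) = (mu A)^-1 * \int[mu]_x (tau x)%:E)%E /\
  ((0 < h_X < +oo)%E ->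
   (\int[mu_A]_(x in A) n_A (x, 0%R) = h_A / h_X)%E).

Proof.
move=> mu_A mu_bar X n_A h_A h_X.
have [c c0 ctau] := tau_roof.
have A0 : 0 < mass mu A by rewrite -lte_fin -massE.
have mtau : measurable_fun setT (tau : borel Sigma -> measurableTypeR R).
  by have /measurable_int/measurable_EFinP := tau_L1.
have sweep0 := ergodic_sweep f_meas mu_inv mu_erg A_meas A0.
have sweep := ergodic_sweep_cvg f_meas mu_inv mu_erg A_meas A0.
have part1 := mean_return_time f_meas mu_inv A_meas A0 sweep mtau c0 ctau.
split; first exact: part1.
have := integrable_fin_num measurableT tau_L1; rewrite fin_numE.
set I := (\int[mu]_x _)%E => Ifin.
have tau_int : (\int[mu]_x (tau x)%:E = (fine I)%:E)%E by rewrite fineK// fin_numE.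
have I0 := roof_integral_gt0 mtau c0 ctau tau_int.
move=> /andP[hX0 hXoo]; rewrite [LHS]part1 tau_int massE//.
have hXE : h_X = ((mass mu A / fine I)%:E * h_A)%E.
  exact: (entropy_susp_flow f_meas mu_inv A_meas A0 sweep0 mtau c0 ctau tau_int).
have k0 : 0 < mass mu A / fine I by rewrite divr_gt0.
rewrite hXE in hX0 hXoo *; move: hX0 hXoo; clear hXE; case: h_A => [h| |].
- rewrite -EFinM lte_fin pmulr_rgt0// => h0 _.
  rewrite !inver !gt_eqF ?mulr_gt0 ?invr_gt0// -!EFinM.
  congr (_%:E).
  by field; rewrite !gt_eqF.
- by rewrite gt0_muley ?lte_fin.
- by rewrite gt0_muleNy ?lte_fin.
Qed.
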